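(* Let $k\ge 1$ be an integer and let $G$ be a finite simple graph of order $n$ with $n\ge 2k+2$. If $e(G)\ge 2k\left(n-k-\frac12\right)$, then $G$ contains $k$ cycles of consecutive even lengths, i.e., cycles of lengths $2m,2m+2,\dots,2m+2k-2$ for some integer $m\ge 2$.
   Context: $e(G)$ denotes the number of edges of $G$. *)

(* Defs.v *)
From mathcomp Require Import all_boot.
Set Implicit Arguments. Unset Strict Implicit. Unset Printing Implicit Defensive.

Definition simple_graph (T : finType) (e : rel T) : Prop :=
  symmetric e /\ irreflexive e.

Definition edges (T : finType) (e : rel T) : {set {set T}} :=
  [set A : {set T} | [exists x : T, [exists y : T, e x y && (A == [set x; y])]]].

Definition num_edges (T : finType) (e : rel T) : nat := #|edges e|.

Definition has_cycle_of_length (T : finType) (e : rel T) (L : nat) : Prop :=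
  exists s : seq T, [/\ 3 <= L, size s = L, uniq s & cycle e s].

(* Main.v *)
Require Import Defs.
From mathcomp Require Import all_boot zify.
Set Implicit Arguments. Unset Strict Implicit. Unset Printing Implicit Defensive.

(* A graph with at least k (2n - 2k - 1) edges either contains a subgraph of
   minimum degree greater than 2k (delete vertices of degree at most 2k one at a
   time), or the deletion ends at K_{2k+2} minus at most one edge, which has cycles
   of all lengths 4, ..., 2k+2.  In the first case a maximum cut gives a bipartite
   graph of minimum degree greater than k.  In an end block of it, with cut vertex
   x and y a neighbour of x, the k cycles come from k paths from x to y of lengths
   l, l+2, ..., l+2k-2, all avoiding the edge xy.

   Such paths exist in every bipartite graph A in which A + xy is 2-connected and
   every vertex other than x and y has degree greater than k, by induction on |A|.
   Choose a complete bipartite core (S, T) with x in S and |S| <= |T|, first |S| and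
   then |T| as large as possible; from x it offers |S| path lengths to each vertex
   of T and |S| - 1 to the other vertices of S.  By maximality a vertex outside has
   few neighbours in the core, so an end block D of the rest still has degrees
   large enough for the induction hypothesis, the core and D being traversed in
   succession; the number of lengths is additive up to one.  Only |S| = 2 with D
   attached to both vertices of S and not to T loses one path, and then a second
   option is found elsewhere: in another end block, in the rest of the graph, or
   beyond the cut vertex of D.  If the neighbours of y all lie in the core, the core is shrunk
   first. *)

(** In a bipartite graph all paths between two given vertices have lengths of one parity, so 2 is
    the natural step: joining progressions of o1 and o2 lengths gives o1 + o2 - 1 lengths. A vertex
    that loses d neighbours on passing to a smaller instance lowers by d the number of lengths
    obtained there, and the core has to offer d additional prefixes in return; the degree conditions
    are this balance. The roots are exempt from the degree condition because the cut vertex of an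
    end block may have few neighbours inside it. The exceptional case arises because the paths start
    at x: if D is entered from the other vertex a of S, a vertex of D whose only core neighbour is x
    loses an edge, and with |S| = 2 there is only one prefix.

    The bound k (2n - 2k - 1) drops by exactly 2k when n drops by one, and at n = 2k + 2 it is one
    less than the number of pairs of vertices. A degree of at least 2k + 1 remains greater than k
    when a maximum cut halves it. *)

(* In a large context zify spends most of its time on the other hypotheses. *)
Ltac nlia :=
  repeat match goal with
  | H : ?P |- _ =>
    lazymatch P with
    | is_true (leq _ _) => fail
    | @eq nat _ _ => fail
    | _ => clear H
    end
  end; lia.

(** * Walks and paths inside a vertex set *)

Section Walks.
Variable V : finType.
Implicit Types (e : rel V) (A B D : {set V}) (u v w : V).

Definition within e B : rel V := fun u v => [&& u \in B, v \in B & e u v].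

(** The conjunct [u \in B] matters for the empty walk, which would otherwise connect every vertex
    outside [B] to itself. *)
Definition conn e B u v := (u \in B) && connect (within e B) u v.

Definition pth e B u v (L : nat) : Prop :=
  exists p, [/\ path e u p, last u p = v, uniq (u :: p),
                {subset u :: p <= B} & size p = L].

(** The offset [l] is left free: the induction only counts lengths. *)
Definition fam e B u v k : Prop :=
  exists l, forall i, i < k -> pth e B u v (l + 2 * i).

Lemma conn_refl e B u : u \in B -> conn e B u u.
Proof. by move=> uB; rewrite /conn uB connect0. Qed.

Lemma path_within e B u p :
  path e u p -> {subset u :: p <= B} -> path (within e B) u p.
Proof.
elim: p u => //= v p IH u /andP[euv pp] sub.
apply/andP; split; first by rewrite /within euv !sub ?inE ?eqxx ?orbT.
by apply: IH => // z zp; apply: sub; rewrite inE zp orbT.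
Qed.

Lemma within_path e B u p :
  u \in B -> path (within e B) u p -> path e u p /\ {subset u :: p <= B}.
Proof.
elim: p u => [|v p IH] u uB /=; first by split=> // z; rewrite inE => /eqP->.
case/andP=> /and3P[_ vB euv] /(IH _ vB)[pp sub]; split; first by rewrite euv.
by move=> z; rewrite inE => /orP[/eqP->|] //; apply: sub.
Qed.

Lemma pth_conn e B u v L : pth e B u v L -> conn e B u v.
Proof.
case=> p [pp lp _ sub _]; rewrite /conn sub ?mem_head //=.
by apply/connectP; exists p => //; apply: path_within.
Qed.

Lemma conn_pth e B u v : conn e B u v -> exists L, pth e B u v L.
Proof.
case/andP=> uB /connectP[p0 pp0 ->]; case/shortenP: pp0 => p pp up _.
have [pe sub] := within_path uB pp.
by exists (size p), p.
Qed.

Lemma conn_inr e B u v : conn e B u v -> v \in B.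
Proof.
by case/conn_pth=> L [p [_ <- _ sub _]]; apply/sub/mem_last.
Qed.

Lemma conn_inl e B u v : conn e B u v -> u \in B.
Proof. by case/andP. Qed.

Lemma conn_trans e B u v w : conn e B u v -> conn e B v w -> conn e B u w.
Proof.
by case/andP=> uB uv /andP[_ vw]; rewrite /conn uB; apply: connect_trans vw.
Qed.

Lemma conn1 e B u v : u \in B -> v \in B -> e u v -> conn e B u v.
Proof.
by move=> uB vB euv; rewrite /conn uB connect1 // /within uB vB.
Qed.

Lemma conn_sym e B u v : symmetric e -> conn e B u v -> conn e B v u.
Proof.
move=> es h; rewrite /conn (conn_inr h) /=; case/andP: h => _.
rewrite (@sym_connect_sym _ (within e B)) //.
by move=> a b; rewrite /within es andbCA.
Qed.

Lemma conn_sub e B B' u v :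
  {subset B <= B'} -> conn e B u v -> conn e B' u v.
Proof.
move=> sub /conn_pth[L [p [pp lp up sp _]]].
by apply: (@pth_conn _ _ _ _ (size p)); exists p; split=> // z /sp /sub.
Qed.

Lemma conn_subrel e e' B u v :
  {in B &, subrel e e'} -> conn e B u v -> conn e' B u v.
Proof.
move=> sub /andP[uB uv]; rewrite /conn uB /=.
apply: connect_sub uv => a b /and3P[aB bB eab].
by rewrite connect1 // /within aB bB sub.
Qed.

(** The walk is cut at its first edge out of [D], so that the prefix is still a walk inside [D].
    Connectivity of a large set is transferred to its parts in this way. *)
Lemma conn_first_exit e B D u v :
  conn e B u v -> u \in D -> v \notin D ->
  exists a b, [/\ conn e (B :&: D) u a, b \in B, b \notin D & e a b].
Proof.
case/andP=> uB /connectP[p pp ->] {v}.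
elim: p u uB pp => [|c p IH] u uB /=; first by move=> _ ->.
case/andP=> /and3P[_ cB euc] pp uD lD.
have uBD : u \in B :&: D by rewrite inE uB.
have [cD|cD] := boolP (c \in D); last first.
  by exists u, c; split=> //; apply: conn_refl.
have [a [b [ca bB bD eab]]] := IH c cB pp cD lD.
exists a, b; split=> //; apply: conn_trans ca.
by apply: conn1; rewrite // inE cB.
Qed.

Lemma conn_stay e B D u v :
  conn e B u v -> u \in D ->
  conn e (B :&: D) u v \/
  exists a b, [/\ conn e (B :&: D) u a, b \in B, b \notin D & e a b].
Proof.
case/andP=> uB /connectP[p pp ->] {v}.
elim: p u uB pp => [|c p IH] u uB /=.
  by move=> _ uD; left; apply: conn_refl; rewrite inE uB.
case/andP=> /and3P[_ cB euc] pp uD.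
have uBD : u \in B :&: D by rewrite inE uB.
have [cD|cD] := boolP (c \in D); last first.
  by right; exists u, c; split=> //; apply: conn_refl.
have uc : conn e (B :&: D) u c by apply: conn1; rewrite // inE cB.
case: (IH c cB pp cD) => [h|[a [b [ca bB bD eab]]]]; [left|right].
  exact: conn_trans uc h.
by exists a, b; split=> //; apply: conn_trans ca.
Qed.

Lemma pth0 e B u : u \in B -> pth e B u u 0.
Proof. by move=> uB; exists [::]; split=> // z; rewrite inE => /eqP->. Qed.

Lemma pth_sub e B B' u v L :
  {subset B <= B'} -> pth e B u v L -> pth e B' u v L.
Proof.
by move=> sub [p [pp lp up sp sz]]; exists p; split=> // z /sp /sub.
Qed.

Lemma pth_subrel e e' B u v L :
  subrel e e' -> pth e B u v L -> pth e' B u v L.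
Proof.
by move=> sub [p [pp lp up sp sz]]; exists p; split=> //; apply: sub_path pp.
Qed.

Lemma pth_cat e B1 B2 B u p q v L1 L2 :
  pth e B1 u p L1 -> e p q -> pth e B2 q v L2 ->
  (forall z, z \in B1 -> z \notin B2) ->
  {subset B1 <= B} -> {subset B2 <= B} -> pth e B u v (L1 + L2).+1.
Proof.
case=> p1 [pp1 lp1 up1 sp1 <-] epq [p2 [pp2 lp2 up2 sp2 <-]] dis s1 s2.
exists (p1 ++ q :: p2); split; last by rewrite size_cat addnS.
- by rewrite cat_path pp1 /= lp1 epq.
- by rewrite last_cat.
- rewrite -cat_cons cat_uniq up1 up2 andbT andTb.
  by apply/hasPn=> z /sp2; apply: contraL => /sp1; apply: dis.
- move=> z; rewrite -cat_cons mem_cat => /orP[/sp1/s1 //|/sp2/s2 //].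
Qed.

Lemma pth_cons e B u q v L :
  e u q -> pth e B q v L -> u \notin B -> pth e (u |: B) u v L.+1.
Proof.
move=> euq h uB.
apply: (pth_cat (B1 := [set u]) (L1 := 0) _ euq h).
- by apply: pth0; rewrite inE.
- by move=> z; rewrite inE => /eqP->.
- by move=> z; rewrite !inE => ->.
- by move=> z; rewrite !inE => ->; rewrite orbT.
Qed.

Lemma pth_rev e B u v L : symmetric e -> pth e B u v L -> pth e B v u L.
Proof.
move=> es [p [pp lp up sp sz]].
exists (rev (belast u p)); split; last by rewrite size_rev size_belast.
- rewrite -lp rev_path; apply: sub_path pp => a b /=; by rewrite es.
- case: p pp lp up sp sz => //= a p _ _ _ _ _.
  by rewrite rev_cons last_rcons.
- have e1 : v :: rev (belast u p) = rev (u :: p).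
    by rewrite (lastI u p) rev_rcons lp.
  by rewrite e1 rev_uniq.
- move=> z; have e1 : v :: rev (belast u p) = rev (u :: p).
    by rewrite (lastI u p) rev_rcons lp.
  by rewrite e1 mem_rev; apply: sp.
Qed.

Lemma pth_parity e B (col : V -> bool) u v L :
  (forall a b, e a b -> col a != col b) -> pth e B u v L ->
  odd L = (col u != col v).
Proof.
move=> hcol [p [pp <- _ _ <-]].
elim: p u pp => [|a p IH] u /=; first by rewrite eqxx.
case/andP=> /hcol eua /IH->.
by move: eua; case: (col u); case: (col a); case: (col (last a p)).
Qed.

End Walks.

(** * Components, and paths in complete bipartite graphs *)

Section Comp.
Variable V : finType.
Variable e : rel V.
Hypothesis es : symmetric e.
Implicit Types (A B D S T : {set V}) (u v w : V).

Definition comp B u := [set v | conn e B u v].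

Definition connected D := forall u v, u \in D -> v \in D -> conn e D u v.

Lemma comp_self B u : u \in B -> u \in comp B u.
Proof. by move=> uB; rewrite inE conn_refl. Qed.

Lemma comp_subset B u v : v \in comp B u -> v \in B.
Proof. by rewrite inE => /conn_inr. Qed.

Lemma comp_closed B u v w :
  v \in comp B u -> e v w -> w \in B -> w \in comp B u.
Proof.
rewrite !inE => uv evw wB; apply: (conn_trans uv).
by apply: conn1 => //; apply: conn_inr uv.
Qed.

Lemma comp_connected B u : connected (comp B u).
Proof.
have h v : v \in comp B u -> conn e (comp B u) u v.
  move=> vK; have uv := vK; rewrite inE in uv.
  have uB := comp_self (conn_inl uv).
  case: (conn_stay uv uB) => [|[a [b [ca bB bK eab]]]].
    by apply: conn_sub => z; rewrite inE => /andP[].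
  have := conn_inr ca; rewrite inE => /andP[_ aK].
  by rewrite (comp_closed aK eab bB) in bK.
move=> v w /h uv /h uw; apply: conn_trans uw; exact: conn_sym.
Qed.

(** A walk in [A] between vertices outside [D] can enter [D] only from [b], so its part before that
    already reaches [b] outside [D]. Applied from both ends, this reconnects the walk at [b]. *)
Lemma connected_del_pendant A D b :
  connected A -> {subset D <= A} ->
  (forall v w, v \in D -> w \in A -> e v w -> w \in D \/ w = b) ->
  connected (A :\: D).
Proof.
move=> cA sub pend.
have h u v : u \in A :\: D -> v \in A :\: D ->
    conn e (A :\: D) u v \/ conn e (A :\: D) u b.
  move=> uAD vAD; have uA : u \in A by move: uAD; rewrite inE => /andP[].
  have vA : v \in A by move: vAD; rewrite inE => /andP[].
  have sAD : {subset A :&: (A :\: D) <= A :\: D} by move=> z; rewrite inE => /andP[].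
  case: (conn_stay (cA _ _ uA vA) uAD) => [/(conn_sub sAD)|]; first by left.
  case=> a [c [ca cA1 cAD eac]]; right.
  have /(conn_sub sAD) ca' := ca.
  have cD : c \in D by move: cAD; rewrite inE cA1 andbT negbK.
  have := conn_inr ca'; rewrite inE => /andP[aD aA].
  have eca : e c a by rewrite es.
  by case: (pend c a cD aA eca) => [aD'|<-] //; rewrite aD' in aD.
move=> u v uAD vAD; case: (h u v) => // ub.
case: (h v u) => // [|vb]; first exact: conn_sym.
by apply: conn_trans ub _; apply: conn_sym.
Qed.

(** Two steps from [x] over some [t] other than [u] to some [s] lead into the biclique without [x]
    and [t] and add 2 to the length. If [#|S| <= #|T|], this offers [#|S|] lengths from [x] to each
    vertex of [T]. *)
Lemma biclique_pth S T x u j :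
  x \in S -> u \in T -> {in S & T, forall s t, e s t} ->
  (forall z, z \in S -> z \notin T) ->
  j < #|S| -> j < #|T| -> pth e (S :|: T) x u (2 * j).+1.
Proof.
elim: j S T x => [|j IH] S T x xS uT com dis jS jT.
  have xT := dis _ xS.
  apply: (@pth_sub _ _ (x |: [set u])).
    by move=> z; rewrite !inE => /orP[/eqP->|/eqP->]; rewrite ?xS ?uT ?orbT.
  apply: (pth_cons (com _ _ xS uT)); first by apply: pth0; rewrite inE.
  by rewrite inE; apply: contraNneq xT => ->.
have [t] : exists t, t \in T :\ u.
  by apply/card_gt0P; rewrite (cardsD1 u) uT in jT; nlia.
rewrite !inE => /andP[tu tT].
have jS1 : j < #|S :\ x| by rewrite (cardsD1 x) xS in jS; nlia.
have jT1 : j < #|T :\ t| by rewrite (cardsD1 t) tT in jT; nlia.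
have [s sS] : exists s, s \in S :\ x by apply/card_gt0P; nlia.
have p1 : pth e ((S :\ x) :|: (T :\ t)) s u (2 * j).+1.
  apply: IH => //.
  - by rewrite !inE eq_sym tu.
  - by move=> a b; rewrite !inE => /andP[_ aS] /andP[_ bT]; apply: com.
  - by move=> z; rewrite !inE => /andP[_ /dis/negPf->]; rewrite andbF.
have sS' : s \in S by move: sS; rewrite inE => /andP[].
have p2 := pth_cons (_ : e t s) p1 _.
have {p2}: pth e (t |: ((S :\ x) :|: (T :\ t))) t u (2 * j).+2.
  apply: p2; first by rewrite es com.
  rewrite !inE eqxx /= orbF; apply/negP=> /andP[_ tS].
  by have := dis _ tS; rewrite tT.
move/(pth_cons (com _ _ xS tT)) => p3.
have -> : (2 * j.+1).+1 = (2 * j).+3 by nlia.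
apply: (pth_sub _ (p3 _)).
  move=> z; rewrite !inE => /or3P[/eqP->|/eqP->|]; rewrite ?xS ?tT ?orbT //.
  by case/orP=> /andP[_ ->]; rewrite ?orbT.
rewrite !inE eqxx /=; apply/norP; split.
  by apply/eqP=> xt; have := dis _ xS; rewrite xt tT.
by rewrite (negPf (dis _ xS)) andbF.
Qed.

(** After a first step into [T] the sides are exchanged and [x] is no longer available, which costs
    one length. *)
Lemma biclique_pth_same S T x s j :
  x \in S -> s \in S -> x != s -> {in S & T, forall s t, e s t} ->
  (forall z, z \in S -> z \notin T) ->
  j.+1 < #|S| -> j < #|T| -> pth e (S :|: T) x s (2 * j).+2.
Proof.
move=> xS sS xs com dis jS jT.
have [t tT] : exists t, t \in T by apply/card_gt0P; nlia.
have jS1 : j < #|S :\ x| by rewrite (cardsD1 x) xS in jS; nlia.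
have p1 : pth e (T :|: (S :\ x)) t s (2 * j).+1.
  apply: biclique_pth => //.
  - by rewrite !inE eq_sym xs.
  - by move=> a b aT; rewrite !inE es => /andP[_ bS]; apply: com.
  - move=> z zT; rewrite !inE negb_and; apply/orP; right.
    by apply/negP=> /dis; rewrite zT.
apply: (pth_sub _ (pth_cons (com _ _ xS tT) p1 _)).
  by move=> z; rewrite !inE => /or3P[/eqP->|->|/andP[_ ->]]; rewrite ?xS ?orbT.
by rewrite !inE eqxx /= orbF dis.
Qed.

End Comp.

(** * Rooted instances and linked sets *)

(* Paths inside D from X to Y: a rooted instance in which the two roots have
   been removed, so that only the traces X and Y of their neighbourhoods remain. *)
Definition linked (V : finType) (e : rel V) (D X Y : {set V}) k : Prop :=
  exists l, forall i, i < k ->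
    exists h t, [/\ h \in X, t \in Y & pth e D h t (l + 2 * i)].

Definition properly (V : finType) (col : V -> bool) (e : rel V) : Prop :=
  forall u v, e u v -> col u != col v.

(* That is, A with the edge xy added is 2-connected. *)
Definition rooted (V : finType) (e : rel V) (A : {set V}) x y : Prop :=
  forall v w, w \in A :\ v -> conn e (A :\ v) w x || conn e (A :\ v) w y.

(** The induction on [#|A|] is carried by [n]. For [k <= 1] connectivity is enough; such instances
    occur when the other segments already supply all the lengths. *)
Definition paths_at (V : finType) n : Prop :=
  forall (col : V -> bool) (e : rel V) (A : {set V}) x y k,
  #|A| < n -> symmetric e -> properly col e ->
  (forall u v, e u v -> u \in A) -> x \in A -> y \in A -> x != y ->
  (exists w, [/\ w \in A, w != x & w != y]) -> rooted e A x y ->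
  (1 < k -> forall v, v \in A -> v != x -> v != y -> k < #|[set w | e v w]|) ->
  fam e A x y k.

(** These are the hypotheses of [paths_at] seen from inside: membership in [X] or [Y] stands for the
    edge to a root, a single colour on each trace lets the colouring extend to the roots, and [.+2]
    counts the roots. *)
Definition links_below (V : finType) n : Prop :=
  forall (col : V -> bool) (e : rel V) (D X Y : {set V}) k,
  #|D|.+2 < n -> symmetric e -> properly col e -> D != set0 ->
  (exists c, forall v, v \in X -> col v = c) ->
  (exists c, forall v, v \in Y -> col v = c) ->
  (forall v w, v \in D -> w \in D :\ v ->
     exists2 t, t \in X :|: Y & conn e (D :\ v) w t) ->
  (forall w, w \in D -> exists2 t, t \in X & conn e D w t) ->
  (forall w, w \in D -> exists2 t, t \in Y & conn e D w t) ->
  (1 < k -> forall v, v \in D ->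
     k < #|[set w in D | e v w]| + (v \in X) + (v \in Y)) ->
  linked e D X Y k.

Section AddRoots.
Variables (V : finType) (e : rel V) (D X Y : {set V}) (p q : V).
Hypotheses (es : symmetric e) (pD : p \notin D) (qD : q \notin D) (pq : p != q).

(** The roots are borrowed from the vertices outside [D], with their old edges discarded, so that
    the instance with roots lives on the same type. *)
Definition add_roots : rel V := fun u v =>
  [|| [&& u \in D, v \in D & e u v],
      (u == p) && (v \in D :&: X), (v == p) && (u \in D :&: X),
      (u == q) && (v \in D :&: Y) | (v == q) && (u \in D :&: Y)].

Lemma add_roots_sym : symmetric add_roots.
Proof.
move=> u v; rewrite /add_roots es.
have -> : [&& u \in D, v \in D & e v u] = [&& v \in D, u \in D & e v u].
  by rewrite andbCA.
by congr (_ || _); do 4![case: (_ && _)].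
Qed.

Lemma add_roots_in u v : u \in D -> v \in D -> add_roots u v = e u v.
Proof.
move=> uD vD; rewrite /add_roots uD vD /=.
have /negPf-> : u != p by apply: contraNneq pD => <-.
have /negPf-> : v != p by apply: contraNneq pD => <-.
have /negPf-> : u != q by apply: contraNneq qD => <-.
have /negPf-> : v != q by apply: contraNneq qD => <-.
by rewrite !orbF.
Qed.

Lemma add_roots_p v : add_roots p v = (v \in D :&: X).
Proof.
by rewrite /add_roots eqxx (negPf pq) !inE (negPf pD) !andbF /= !orbF.
Qed.

Lemma add_roots_q v : add_roots q v = (v \in D :&: Y).
Proof.
by rewrite /add_roots eqxx eq_sym (negPf pq) !inE (negPf qD) !andbF /= !orbF.
Qed.

Lemma pth_add_roots L : pth add_roots (p |: (q |: D)) p q L ->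
  exists h t L', [/\ L = L'.+2, h \in X, t \in Y & pth e D h t L'].
Proof.
case=> s0; case/lastP: s0 => [|s z]; first by case=> _ /= pq'; have := pq; rewrite pq' eqxx.
case=> pp; rewrite last_rcons => zq; rewrite {}zq in pp *.
rewrite cons_uniq mem_rcons inE negb_or rcons_uniq => /and3P[/andP[_ ps] qs us] sub <-.
have sD : {subset s <= D}.
  move=> a az; have := sub a; rewrite !inE mem_rcons inE az !orbT => /(_ isT).
  case/or3P=> // /eqP aE; first by rewrite -aE az in ps.
  by rewrite -aE az in qs.
move: pp; rewrite rcons_path => /andP[pp lq].
case: s pp lq sD us {ps qs sub} => [|h s] /=.
  by rewrite add_roots_p inE (negPf qD).
case/andP; rewrite add_roots_p inE => /andP[hD hX] pp.
rewrite add_roots_sym add_roots_q inE => /andP[tD tY] sD us.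
exists h, (last h s), (size s); split=> //; first by rewrite size_rcons.
exists s; split=> //.
elim: s h pp sD {us hD hX tD tY} => //= a s IH h /andP[ha pa] sD.
rewrite -add_roots_in ?sD ?inE ?eqxx ?orbT // ha /=.
by apply: IH => // b bs; apply: sD; rewrite inE bs orbT.
Qed.

End AddRoots.

Lemma links_of_paths (V : finType) n :
  n <= #|V| -> paths_at V n -> links_below V n.
Proof.
move=> nV H col e D X Y k cD es hcol D0 [cx hX] [cy hY] r1 r2 r3 deg.
have cC : 2 < #|~: D| by rewrite cardsCs setCK; nlia.
have [p] : exists p, p \in ~: D by apply/card_gt0P; nlia.
rewrite inE => pD.
have [q] : exists q, q \in (~: D) :\ p.
  by apply/card_gt0P; have := cardsD1 p (~: D); rewrite inE pD; nlia.
rewrite !inE => /andP[qp qD]; have pq : p != q by rewrite eq_sym.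
set e' := add_roots e D X Y p q; set A := p |: (q |: D).
have DA : {subset D <= A} by move=> z zD; rewrite !inE zD !orbT.
have eD u v : u \in D -> v \in D -> e' u v = e u v by apply: add_roots_in.
have sub (B : {set V}) : {subset B <= D} -> {in B &, subrel e e'}.
  by move=> BD u v uB vB; rewrite eD // ?BD.
have toX (B : {set V}) w t : {subset B <= D} -> t \in X -> conn e B w t ->
    conn e' (p |: B) w p.
  move=> BD tX wt; have tB := conn_inr wt.
  have wt' : conn e' (p |: B) w t.
    apply: (conn_sub _ (conn_subrel (sub _ BD) wt)).
    by move=> z zB; rewrite inE zB orbT.
  apply: (conn_trans wt'); apply: conn1; rewrite ?inE ?tB ?eqxx ?orbT //.
  by rewrite /e' add_roots_sym // add_roots_p // inE BD.
have toY (B : {set V}) w t : {subset B <= D} -> t \in Y -> conn e B w t ->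
    conn e' (q |: B) w q.
  move=> BD tY wt; have tB := conn_inr wt.
  have wt' : conn e' (q |: B) w t.
    apply: (conn_sub _ (conn_subrel (sub _ BD) wt)).
    by move=> z zB; rewrite inE zB orbT.
  apply: (conn_trans wt'); apply: conn1; rewrite ?inE ?tB ?eqxx ?orbT //.
  by rewrite /e' add_roots_sym // add_roots_q // inE BD.
have fm : fam e' A p q k.
  (* Each root gets the colour opposite to that of its trace. *)
  apply: (H (fun z => if z == p then ~~ cx else if z == q then ~~ cy else col z)).
  - rewrite /A !cardsU1 !inE negb_or pq pD qD /=; nlia.
  - exact: add_roots_sym.
  - have cc v : v \in D -> (if v == p then ~~ cx else if v == q then ~~ cy else col v) = col v.
      move=> vD; have /negPf-> : v != p by apply: contraNneq pD => <-.
      by have /negPf-> : v != q by apply: contraNneq qD => <-.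
    move=> u v; rewrite /e' /add_roots.
    case/or4P=> [/and3P[uD vD euv]|/andP[/eqP-> ]|/andP[/eqP-> ]|/orP[]/andP[/eqP-> ]].
    + by rewrite !cc //; apply: hcol.
    + by rewrite inE => /andP[vD /hX vX]; rewrite eqxx cc // vX; case: (cx).
    + by rewrite inE => /andP[vD /hX vX]; rewrite eqxx cc // vX; case: (cx).
    + by rewrite inE (negPf qp) => /andP[vD /hY vX]; rewrite eqxx cc // vX; case: (cy).
    + by rewrite inE (negPf qp) => /andP[vD /hY vX]; rewrite eqxx cc // vX; case: (cy).
  - move=> u v; rewrite /e' /add_roots.
    case/or4P=> [/and3P[uD _ _]|/andP[/eqP-> _]|/andP[_]|/orP[]/andP[]].
    + exact: DA.
    + by rewrite !inE eqxx.
    + by rewrite inE => /andP[/DA].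
    + by move=> /eqP-> _; rewrite !inE eqxx orbT.
    + by rewrite inE => _ /andP[/DA].
  - by rewrite !inE eqxx.
  - by rewrite !inE eqxx orbT.
  - by [].
  - have /set0Pn[w wD] := D0; exists w; split; first exact: DA.
      by apply: contraNneq pD => <-.
    by apply: contraNneq qD => <-.
  - move=> v w; rewrite !inE => /andP[wv].
    have [ewp|wp] := eqVneq w p.
      by rewrite ewp conn_refl // !inE eqxx andbT -ewp.
    have [ewq|wq] := eqVneq w q.
      by move=> _; apply/orP; right; rewrite ewq conn_refl // !inE eqxx orbT andbT -ewq.
    move=> /= wD; have DD : {subset D <= D} by [].
    have Dv : {subset D :\ v <= D} by move=> z; rewrite inE => /andP[].
    have [vD|vD] := boolP (v \in D).
      have vp : v != p by apply: contraNneq pD => <-.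
      have vq : v != q by apply: contraNneq qD => <-.
      have wDv : w \in D :\ v by rewrite !inE wv.
      have [t] := r1 v w vD wDv; rewrite inE => /orP[tX|tY] wt.
        rewrite (conn_sub _ (toX _ _ _ Dv tX wt)) //.
        by move=> z; rewrite !inE; case: (eqVneq z p) => [->|_ /andP[-> ->]]; rewrite 1?eq_sym ?vp ?orbT.
      rewrite (conn_sub _ (toY _ _ _ Dv tY wt)) ?orbT //.
      by move=> z; rewrite !inE; case: (eqVneq z q) => [->|_ /andP[-> ->]]; rewrite 1?eq_sym ?vq ?orbT.
    have vz z : z \in D -> z != v by move=> zD; apply: contraNneq vD => <-.
    have [vp|vp] := eqVneq v p.
      have [t tY wt] := r3 w wD.
      rewrite (conn_sub _ (toY _ _ _ DD tY wt)) ?orbT //.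
      move=> z; rewrite !inE => /orP[/eqP->|zD]; last by rewrite vz // zD !orbT.
      by rewrite eqxx orbT andbT vp.
    have [t tX wt] := r2 w wD.
    rewrite (conn_sub _ (toX _ _ _ DD tX wt)) //.
    move=> z; rewrite !inE => /orP[/eqP->|zD]; last by rewrite vz // zD !orbT.
    by rewrite eqxx andbT eq_sym.
  - move=> k1 v; rewrite !inE => /or3P[->//|->//|vD] _ _.
    have := deg k1 v vD.
    set N := [set w | e' v w]; rewrite (cardsD1 p N) (cardsD1 q (N :\ p)).
    have -> : (p \in N) = (v \in X).
      by rewrite inE /e' add_roots_sym // add_roots_p // inE vD.
    have -> : (q \in N :\ p) = (v \in Y).
      by rewrite !inE qp /e' add_roots_sym // add_roots_q // inE vD.
    have sN : [set w in D | e v w] \subset N :\ p :\ q.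
      apply/subsetP=> w; rewrite !inE => /andP[wD evw]; rewrite eD // evw andbT.
      apply/andP; split; first by apply: contraNneq qD => <-.
      by apply: contraNneq pD => <-.
    have := subset_leq_card sN; nlia.
case: k {deg} fm => [|k] [l hl]; first by exists 0.
(* The two edges at the roots are removed; [l2] makes the truncated subtraction exact. *)
exists (l - 2) => i ik.
have l2 : 2 <= l.
  have := hl 0 isT; rewrite muln0 addn0 => /(pth_add_roots es pD qD pq).
  by case=> h [t [L [-> _ _ _]]].
have := hl i ik => /(pth_add_roots es pD qD pq)[h [t [L [eL hX' tY ph]]]].
exists h, t; split=> //.
by have -> : l - 2 + 2 * i = L by nlia.
Qed.

(** * End blocks *)

Definition nbs (V : finType) (e : rel V) (P : {set V}) : {set V} :=
  [set v | [exists p in P, e p v]].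

Lemma mem_nbs1 (V : finType) (e : rel V) b v : (v \in nbs e [set b]) = e b v.
Proof.
rewrite inE; apply/exists_inP/idP => [[p /set1P->]//|ebv].
by exists b; rewrite ?inE.
Qed.

Section Pieces.
Variables (V : finType) (e : rel V).
Hypothesis es : symmetric e.
Variables (C : {set V}) (c : V).
Hypotheses (cC : connected e C) (cin : c \in C).
Implicit Types (D : {set V}) (b v w t : V).

(* For a minimal piece, D + b has no cut vertex: it is an end block of C. *)
Definition piece b D :=
  [&& b \in C, c \notin D & [exists w in C :\ b, D == comp e (C :\ b) w]].

Definition min_piece b D :=
  piece b D /\ forall b' D', piece b' D' -> D' \subset D -> D' = D.

Lemma pieceP b D : piece b D ->
  [/\ b \in C, c \notin D & exists2 w, w \in C :\ b & D = comp e (C :\ b) w].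
Proof. by case/and3P=> bC cD /exists_inP[w wC /eqP eD]; split=> //; exists w. Qed.

Lemma piece_comp b w : b \in C -> w \in C :\ b -> c \notin comp e (C :\ b) w ->
  piece b (comp e (C :\ b) w).
Proof. by move=> bC wC cK; rewrite /piece bC cK /=; apply/exists_inP; exists w. Qed.

Lemma exists_min_piece b D : piece b D ->
  exists b' D', min_piece b' D' /\ D' \subset D.
Proof.
have [n] := ubnP #|D|; elim: n b D => // n IH b D lt_n pD.
pose sm := [exists b' : V, exists D' : {set V}, piece b' D' && (D' \proper D)].
have [/existsP[b' /existsP[D' /andP[pD' ss]]]|no] := boolP sm.
  have [] := IH b' D' _ pD'; first by have := proper_card ss; nlia.
  move=> b2 [D2 [m2 s2]]; exists b2, D2; split=> //.
  exact: subset_trans s2 (proper_sub ss).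
exists b, D; split=> //; split=> // b' D' pD' ss; apply/eqP.
rewrite eqEsubset ss /=; apply: contraNT no => ns.
by apply/existsP; exists b'; apply/existsP; exists D'; rewrite pD' properE ss.
Qed.

Section OnePiece.
Variables (b : V) (D : {set V}).
Hypothesis pD : piece b D.

Lemma piece_subset : {subset D <= C}.
Proof.
have [_ _ [w _ ->]] := pieceP pD.
by move=> z /comp_subset; rewrite inE => /andP[].
Qed.

Lemma piece_cut : b \notin D.
Proof.
have [_ _ [w _ ->]] := pieceP pD.
by apply/negP=> /comp_subset; rewrite !inE eqxx.
Qed.

Lemma piece_connected : connected e D.
Proof. by have [_ _ [w _ ->]] := pieceP pD; apply: comp_connected. Qed.

Lemma piece_nonempty : D != set0.
Proof.
have [_ _ [w wC ->]] := pieceP pD.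
by apply/set0Pn; exists w; apply: comp_self.
Qed.

Lemma piece_closed v w : v \in D -> w \in C -> e v w -> w \in D \/ w = b.
Proof.
have [_ _ [w0 _ ->]] := pieceP pD => vD wC evw.
have [->|wb] := eqVneq w b; [by right|left].
by apply: comp_closed vD evw _; rewrite !inE wb.
Qed.

Lemma piece_attached : exists2 t, t \in D & e b t.
Proof.
have [bC cD _] := pieceP pD; have /set0Pn[w wD] := piece_nonempty.
have [a [d [ca dC dD ead]]] := conn_first_exit (cC (piece_subset wD) cin) wD cD.
have := conn_inr ca; rewrite inE => /andP[_ aD]; exists a => //.
case: (piece_closed aD dC ead) => [dD'|db]; last by rewrite es -db.
by rewrite dD' in dD.
Qed.

Lemma piece_to_cut v : v \in D -> exists2 t, t \in nbs e [set b] & conn e D v t.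
Proof.
move=> vD; have [t tD ebt] := piece_attached.
exists t; last exact: piece_connected.
by rewrite mem_nbs1.
Qed.

Lemma rest_connected : connected e (C :\: D).
Proof.
apply: (connected_del_pendant es (b := b)) => //; first exact: piece_subset.
exact: piece_closed.
Qed.

Lemma cut_in_rest : b \in C :\: D.
Proof. by have [bC _ _] := pieceP pD; rewrite inE piece_cut. Qed.

Lemma target_in_rest : c \in C :\: D.
Proof. by have [_ cD _] := pieceP pD; rewrite inE cD. Qed.

End OnePiece.

(** If [w] could not reach [b] in [C :\ v], its component there would stay inside [D] and be a piece
    with cut vertex [v]. It omits [v], against the minimality of [D]. *)
Lemma min_piece_conn b D v w : min_piece b D -> v \in D -> w \in D :\ v ->
  exists2 t, t \in nbs e [set b] & conn e (D :\ v) w t.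
Proof.
move=> [pD mD] vD wDv; have [bC cD _] := pieceP pD.
have sD := piece_subset pD; have bD := piece_cut pD.
have /andP[wv wD] : (w != v) && (w \in D) by move: wDv; rewrite !inE.
have wCv : w \in C :\ v by rewrite !inE wv sD.
have stayD : {subset (C :\ v) :&: D <= D :\ v}.
  by move=> z; rewrite !inE => /andP[/andP[-> _] ->].
have bv : b != v by apply: contraNneq bD => ->.
have bCv : b \in C :\ v by rewrite !inE bv.
have out : ~~ conn e (C :\ v) w b -> False.
  move=> nb; set K := comp e (C :\ v) w.
  have exitb a d : conn e ((C :\ v) :&: D) w a -> d \in C :\ v -> d \notin D -> e a d -> False.
    move=> ca; rewrite inE => /andP[_ dC] dD ead.
    have := conn_inr ca; rewrite !inE => /andP[/andP[av aC] aD].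
    case: (piece_closed pD aD dC ead) => [dD'|db]; first by rewrite dD' in dD.
    move: nb; rewrite (conn_trans (v := a)) //.
      by apply: conn_sub ca => z; rewrite inE => /andP[].
    by rewrite db in ead; apply: conn1 => //; rewrite !inE av.
  have KD : K \subset D.
    apply/subsetP=> z; rewrite inE => cz; apply/negPn/negP=> zD.
    have [a [d [ca dC dD ead]]] := conn_first_exit cz wD zD.
    exact: exitb ca dC dD ead.
  have cK : c \notin K by apply: contra cD => /(subsetP KD).
  have KE := mD _ _ (piece_comp (sD _ vD) wCv cK) KD.
  by have := vD; rewrite -KE => /comp_subset; rewrite !inE eqxx.
have /conn_first_exit-/(_ D wD bD) : conn e (C :\ v) w b by apply/negPn/negP=> /out.
case=> a [d [/(conn_sub stayD) ca]]; rewrite inE => /andP[_ dC] dD ead.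
have := conn_inr ca; rewrite !inE => /andP[_ aD].
case: (piece_closed pD aD dC ead) => [dD'|db]; first by rewrite dD' in dD.
by exists a => //; rewrite mem_nbs1 es -db.
Qed.

(** A piece joined to a vertex of another one by walks avoiding the other's cut vertex is absorbed
    by it, and minimality makes the two equal. That [b] avoids [D'] keeps [b] in the rest when both
    pieces are removed. *)
Lemma min_pieces_apart b D b' D' : min_piece b D -> min_piece b' D' -> D != D' ->
  (forall z, z \in D -> z \notin D') /\ b \notin D'.
Proof.
move=> [pD mD] [pD' mD'] neq.
have [bC cD _] := pieceP pD; have [bC' cD' [w' wC' eD']] := pieceP pD'.
have absorb u : u \in D' -> (forall z, z \in D -> conn e (C :\ b') u z) -> False.
  rewrite {1}eD' inE => cu h; case/eqP: neq; apply: mD' (pD) _.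
  by apply/subsetP=> z /h uz; rewrite eD' inE (conn_trans cu uz).
have subC (B : {set V}) : {subset B <= C} -> b' \notin B -> {subset B <= C :\ b'}.
  by move=> sB nb z zB; rewrite !inE sB // andbT; apply: contraNneq nb => <-.
have bD' : b \notin D'.
  apply/negP=> bD'.
  have bb' : b != b' by apply: contraTneq bD' => ->; apply: piece_cut pD'.
  (* If [b'] is in [D], then [c] reaches [b] outside [D], hence without meeting [b'], and would lie
     in [D']. *)
  have [b'D|b'D] := boolP (b' \in D).
    case/negP: cD'; rewrite eD' inE.
    apply: (@conn_trans _ _ _ _ b); first by move: bD'; rewrite {1}eD' inE.
    apply: (conn_sub _ (rest_connected pD (cut_in_rest pD) (target_in_rest pD))).
    by apply: subC => [z|]; rewrite inE ?b'D // => /andP[].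
  apply: (absorb b) => // z zD; have [t tD ebt] := piece_attached pD.
  have tC := subC _ (piece_subset pD) b'D _ tD.
  apply: (@conn_trans _ _ _ _ t).
    by apply: conn1; rewrite ?ebt // !inE bb'.
  by apply: (conn_sub (subC _ (piece_subset pD) b'D)); apply: (piece_connected pD).
split=> // u uD; apply/negP=> uD'.
have [b'D|b'D] := boolP (b' \in D); last first.
  apply: (absorb u) => // z zD.
  by apply: (conn_sub (subC _ (piece_subset pD) b'D)); apply: (piece_connected pD).
have sD'b : {subset D' <= C :\ b}.
  by move=> z zD'; rewrite !inE (piece_subset pD') // andbT; apply: contraNneq bD' => <-.
case/eqP: neq; apply/esym; apply: mD (pD') _.
have [_ _ [w wC eD]] := pieceP pD.
apply/subsetP=> z zD'; rewrite eD inE.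
apply: (@conn_trans _ _ _ _ u); first by move: uD; rewrite eD inE.
by apply: (conn_sub sD'b); apply: (piece_connected pD').
Qed.

End Pieces.

(** * Degrees into a vertex set *)

Section Degrees.
Variables (V : finType) (e : rel V).
Implicit Types (B D S T P : {set V}) (u v w : V).

Definition nb B v := #|[set w in B | e v w]|.

Lemma nb_sub B B' v : {subset B <= B'} -> nb B v <= nb B' v.
Proof.
move=> sub; apply/subset_leq_card/subsetP=> w; rewrite !inE.
by case/andP=> /sub-> ->.
Qed.

Lemma nbU B B' v : nb (B :|: B') v <= nb B v + nb B' v.
Proof.
rewrite /nb; apply: leq_trans (leq_card_setU _ _).
by apply/subset_leq_card/subsetP=> w; rewrite !inE andb_orl.
Qed.

Lemma nb1 b v : nb [set b] v = e v b.
Proof.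
rewrite /nb; case evb: (e v b).
  rewrite (_ : [set w in [set b] | e v w] = [set b]) ?cards1 //.
  by apply/setP=> w; rewrite !inE; case: eqP => // ->.
apply: eq_card0 => w; rewrite !inE; case: eqP => //= ->; exact: evb.
Qed.

Lemma nb_le_card B v : nb B v <= #|B|.
Proof. by apply/subset_leq_card/subsetP=> w; rewrite inE => /andP[]. Qed.

Lemma deg_nb B v : (forall w, e v w -> w \in B) -> #|[set w | e v w]| = nb B v.
Proof.
move=> h; apply: eq_card => w; rewrite !inE.
by case evw: (e v w); rewrite ?andbF // h.
Qed.

Lemma nb_gt0 B v : (0 < nb B v) = [exists w in B, e v w].
Proof.
apply/card_gt0P/exists_inP=> [[w]|[w wB evw]]; last by exists w; rewrite inE wB.
by rewrite inE => /andP[wB evw]; exists w.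
Qed.

Lemma nb0 B v : (forall w, w \in B -> ~~ e v w) -> nb B v = 0.
Proof.
move=> h; apply: eq_card0 => w; rewrite !inE.
by apply/negP=> /andP[/h/negP].
Qed.

Lemma mem_nbs P v : symmetric e -> (v \in nbs e P) = (0 < nb P v).
Proof. by move=> es; rewrite nb_gt0 inE; apply: eq_existsb => w; rewrite es. Qed.

Lemma nb_full B v w : nb B v = #|B| -> w \in B -> e v w.
Proof.
move=> h wB; have : w \in [set w in B | e v w].
  have /eqP-> // : [set w in B | e v w] == B.
  rewrite eqEcard [X in _ <= X]h leqnn andbT.
  by apply/subsetP=> z; rewrite inE => /andP[].
by rewrite inE => /andP[].
Qed.

Lemma nb_two B v : 1 < nb B v ->
  exists u1 u2, [/\ u1 \in B, u2 \in B, u1 != u2, e v u1 & e v u2].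
Proof.
move=> h; have [u1 u1N] : exists u, u \in [set w in B | e v w].
  by apply/card_gt0P; apply: leq_trans h.
have [u2] : exists u, u \in [set w in B | e v w] :\ u1.
  by apply/card_gt0P; move: h; rewrite /nb (cardsD1 u1) u1N.
move: u1N; rewrite !inE => /andP[u1B e1] /and3P[ne u2B e2].
by exists u1, u2; split=> //; rewrite eq_sym.
Qed.

End Degrees.

(** Two of the three outside vertices pay for the roots added to [D], the third for the strict
    inequality in [links_below]. *)
Lemma card_outside3 (V : finType) (A D : {set V}) p q r :
  {subset D <= A} -> p \in A -> q \in A -> r \in A ->
  p \notin D -> q \notin D -> r \notin D ->
  p != q -> p != r -> q != r -> #|D|.+2 < #|A|.
Proof.
move=> DA pA qA rA pD qD rD pq pr qr.
have : p |: (q |: (r |: D)) \subset A.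
  by apply/subsetP=> z; rewrite !inE => /or4P[/eqP->|/eqP->|/eqP->|/DA].
move/subset_leq_card; rewrite !cardsU1 !inE !negb_or pq pr qr pD qD rD /=; nlia.
Qed.

Lemma fam_sub (V : finType) (e : rel V) (B B' : {set V}) u v k :
  {subset B <= B'} -> fam e B u v k -> fam e B' u v k.
Proof. by move=> sub [l h]; exists l => i /h; apply: pth_sub. Qed.

(** * Paths through a complete bipartite core and an end block *)

Section Core.
Variables (V : finType) (col : V -> bool) (e : rel V) (A : {set V}) (x y : V).
Variable k : nat.
Implicit Types (B C D M P S T ex : {set V}) (b c u v w : V).

(* One step of the induction: a rooted graph on A, with the theorem available in
   smaller graphs. *)
Record setting : Prop := Setting {
  st_sym : symmetric e;
  st_col : properly col e;
  st_A : forall u v, e u v -> u \in A;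
  st_x : x \in A;
  st_y : y \in A;
  st_xy : x != y;
  st_nxy : ~~ e x y;
  st_R : rooted e A x y;
  st_deg : forall v, v \in A -> v != x -> v != y -> k < #|[set w | e v w]|;
  st_k : 1 < k;
  st_links : links_below V #|A|
}.

Hypothesis G : setting.

Let es := st_sym G.
Let hcol := st_col G.
Let eA := st_A G.
Let hdeg := st_deg G.
Let LK := st_links G.

Lemma eAr u v : e u v -> v \in A.
Proof. by rewrite es; apply: eA. Qed.

Lemma col_nb u v : e u v -> col v = ~~ col u.
Proof. by move/hcol; case: (col u); case: (col v). Qed.

(* The o1 prefixes from r to P and the o2 suffixes from b to c contribute
   o1 + o2 - 1 lengths, so D may be used with a degree bound lower by as much. *)
Lemma assemble B D M P r b c o1 o2 beta gamma :
  #|D|.+2 < #|A| -> D != set0 ->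
  (forall z, z \in B -> z \notin D) -> (forall z, z \in B -> z \notin M) ->
  (forall z, z \in D -> z \notin M) ->
  0 < o1 -> 0 < o2 ->
  (forall p i, p \in P -> i < o1 -> pth e B r p (beta + 2 * i)) ->
  (forall i, i < o2 -> pth e M b c (gamma + 2 * i)) ->
  (exists c0 : bool, forall p, p \in P -> col p = c0) ->
  (forall v w, v \in D -> w \in D :\ v ->
     exists2 t, t \in nbs e P :|: nbs e [set b] & conn e (D :\ v) w t) ->
  (forall w, w \in D -> exists2 t, t \in nbs e P & conn e D w t) ->
  (forall w, w \in D -> exists2 t, t \in nbs e [set b] & conn e D w t) ->
  (forall v, v \in D ->
     k.+2 < nb e D v + (v \in nbs e P) + (v \in nbs e [set b]) + o1 + o2) ->
  fam e (B :|: D :|: M) r c k.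
Proof.
move=> cD D0 BD BM DM o1_gt0 o2_gt0 pre suf [c0 hP] r1 r2 r3 deg.
set k' := if k.+2 <= o1 + o2 then 1 else k.+2 - (o1 + o2).
have [l hl] : linked e D (nbs e P) (nbs e [set b]) k'.
  apply: (LK (col := col)) => //.
  - exists (~~ c0) => v; rewrite inE => /exists_inP[p pP epv].
    by rewrite (col_nb epv) (hP _ pP).
  - by exists (~~ col b) => v; rewrite mem_nbs1 => /col_nb.
  - move=> k'1 v vD; have := deg v vD; rewrite -/(nb e D v).
    move: k'1; rewrite /k'; case: ifP; nlia.
(* The 2 counts the edges by which [D] is entered and left. *)
exists (beta + l + gamma + 2) => m mk.
have k'_gt0 : 0 < k' by rewrite /k'; case: ifP; nlia.
(* The index [m] is spent greedily: in [D], then on the prefix, the remainder on the suffix. *)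
set i := minn m k'.-1; set j := minn (m - i) o1.-1.
have ik' : i < k' by rewrite /i; nlia.
have jo1 : j < o1 by rewrite /j; nlia.
have ho2 : m - i - j < o2 by rewrite /j /i /k'; case: ifP; nlia.
have [h [t [hX tY ph]]] := hl i ik'.
move: hX; rewrite inE => /exists_inP[p pP eph].
move: tY; rewrite mem_nbs1 => ebt.
have etb : e t b by rewrite es.
have p1 := pre p j pP jo1; have p3 := suf _ ho2.
have p12 := pth_cat p1 eph ph BD (B := B :|: D) _ _.
have {p12}p12 : pth e (B :|: D) r t (beta + 2 * j + (l + 2 * i)).+1.
  by apply: p12 => z; rewrite inE => ->; rewrite ?orbT.
have -> : beta + l + gamma + 2 + 2 * m =
    ((beta + 2 * j + (l + 2 * i)).+1 + (gamma + 2 * (m - i - j))).+1.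
  by rewrite /j /i; nlia.
apply: (pth_cat p12 etb p3).
- by move=> z; rewrite inE => /orP[/BM|/DM].
- by move=> z zBD; rewrite inE zBD.
- by move=> z zM; rewrite inE zM orbT.
Qed.

(* The situation of the induction step: a complete bipartite core (S, T) at the
   root x and a connected region C, containing the target c, whose vertices
   other than c have no neighbours outside C, S and T; ex is a set of vertices
   reserved for the final segment from c to y. *)
Record frame S T C c ex : Prop := Frame {
  fr_x : x \in S;
  fr_SA : {subset S <= A};
  fr_TA : {subset T <= A};
  fr_CA : {subset C <= A};
  fr_ST : forall z, z \in S -> z \notin T;
  fr_SC : forall z, z \in S -> z \notin C;
  fr_TC : forall z, z \in T -> z \notin C;
  fr_Sex : forall z, z \in S -> z \notin ex;
  fr_Tex : forall z, z \in T -> z \notin ex;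
  fr_Cex : forall z, z \in C -> z \notin ex;
  fr_com : {in S & T, forall s t, e s t};
  fr_card : #|S| <= #|T|;
  fr_col : forall s, s \in S -> col s = col x;
  fr_conn : connected e C;
  fr_c : c \in C;
  fr_ne : exists2 w, w \in C & w != c;
  fr_nb : forall v w, v \in C -> v != c -> e v w -> w \in C :|: S :|: T;
  fr_nbT : forall v, v \in C -> v != c -> nb e T v <= #|S|;
  fr_nbS : forall v, v \in C -> v != c -> nb e S v < #|S|;
  fr_y : (y == c) || (y \in ex);
  fr_rest : forall v w, v \in A -> v \notin S :|: T :|: C :|: ex -> e v w ->
    w \notin C :|: ex;
  fr_restS : forall v, v \in A -> v \notin S :|: T :|: C :|: ex ->
    nb e S v < #|S|;
  fr_ex : exists z, forall u w, u \in T -> w \in ex -> e u w ->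
    w = z /\ (forall s, s \in S -> e s c)
}.

Section InFrame.
Variables (S T C : {set V}) (c : V) (ex : {set V}).
Hypothesis F : frame S T C c ex.

Let cC := fr_conn F.
Let cin := fr_c F.

Lemma T_col t : t \in T -> col t = ~~ col x.
Proof. by move=> tT; apply/col_nb/(fr_com F (fr_x F) tT). Qed.

Lemma S_gt0 : 0 < #|S|.
Proof. by apply/card_gt0P; exists x; apply: fr_x F. Qed.

Lemma T_ne : exists t, t \in T.
Proof. by apply/card_gt0P; apply: leq_trans S_gt0 (fr_card F). Qed.

Lemma y_notin_T : y \notin T.
Proof.
apply/negP=> yT; case/orP: (fr_y F) => [/eqP yc|yex].
  by have := fr_TC F yT; rewrite yc cin.
by have := fr_Tex F yT; rewrite yex.
Qed.

Lemma C_not_x v : v \in C -> v != x.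
Proof. by move=> vC; apply: contraTneq vC => ->; apply/(fr_SC F)/(fr_x F). Qed.

Lemma C_not_y v : v \in C -> v != c -> v != y.
Proof.
move=> vC vc; apply: contra_neq vc => vy.
by case/orP: (fr_y F) => [/eqP<-//|]; rewrite -vy (negPf (fr_Cex F vC)).
Qed.

Lemma T_not_x t : t \in T -> t != x.
Proof. by move=> tT; apply: contraTneq tT => ->; apply/(fr_ST F)/(fr_x F). Qed.

Lemma C_deg v : v \in C -> v != c -> k < #|[set w | e v w]|.
Proof.
move=> vC vc; apply: hdeg; [exact: fr_CA F _ vC|exact: C_not_x|exact: C_not_y].
Qed.

Lemma T_deg t : t \in T -> k < #|[set w | e t w]|.
Proof.
move=> tT; apply: hdeg; [exact: fr_TA F _ tT|exact: T_not_x|].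
by apply: contraTneq tT => ->; apply: y_notin_T.
Qed.

End InFrame.
End Core.

(** * Attaching an end block to the core *)

Section FramePieces.
Variables (V : finType) (col : V -> bool) (e : rel V) (A : {set V}) (x y : V).
Variable k : nat.
Hypothesis G : setting col e A x y k.
Variables (S T C : {set V}) (c : V) (ex : {set V}).
Hypothesis F : frame col e A x y S T C c ex.
Implicit Types (B D M P : {set V}) (a b u v w : V).

Let es := st_sym G.
Let cC := fr_conn F.
Let cin := fr_c F.

Lemma frame_A z : z \in S :|: T :|: C -> z \in A :\: ex.
Proof.
rewrite !inE => /orP[/orP[zS|zT]|zC].
- by rewrite (fr_SA F zS) (fr_Sex F zS).
- by rewrite (fr_TA F zT) (fr_Tex F zT).
- by rewrite (fr_CA F zC) (fr_Cex F zC).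
Qed.

Lemma piece_C b D : piece e C c b D -> {subset D <= C}.
Proof. exact: piece_subset. Qed.

Lemma piece_nc b D v : piece e C c b D -> v \in D -> v != c.
Proof. by case/pieceP=> _ cD _ vD; apply: contraNneq cD => <-. Qed.

(** The two sides of the core have opposite colours, so a vertex can see only one of them. *)
Lemma S_or_T v : nb e S v = 0 \/ nb e T v = 0.
Proof.
have [nS|nS] := posnP (nb e S v); [by left|right].
have [//|nT] := posnP (nb e T v).
move: nS nT; rewrite !nb_gt0 => /exists_inP[s sS evs] /exists_inP[t tT evt].
have := col_nb G evs; have := col_nb G evt.
rewrite (fr_col F sS) (T_col G F tT).
by case: (col x); case: (col v).
Qed.

Lemma piece_nbs b D v w : piece e C c b D -> v \in D -> e v w ->
  w \in D :|: [set b] :|: (S :|: T).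
Proof.
move=> pD vD evw; have vC := piece_C pD vD.
have := fr_nb F vC (piece_nc pD vD) evw.
rewrite !inE => /orP[/orP[wC|->]|->]; rewrite ?orbT //.
by case: (piece_closed pD vD wC evw) => [->|->]; rewrite ?eqxx ?orbT.
Qed.

Lemma piece_deg b D v : piece e C c b D -> v \in D ->
  k < nb e D v + (v \in nbs e [set b]) + nb e (S :|: T) v.
Proof.
move=> pD vD; have vC := piece_C pD vD.
have := C_deg G F vC (piece_nc pD vD).
rewrite (deg_nb (fun w => piece_nbs pD vD (w := w))).
have := nbU e (D :|: [set b]) (S :|: T) v; have := nbU e D [set b] v.
by rewrite nb1 mem_nbs1 es; nlia.
Qed.

Lemma piece_card b D : piece e C c b D -> #|D|.+2 < #|A|.
Proof.
move=> pD; have [t tT] := T_ne F; have [bC _ _] := pieceP pD.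
apply: (@card_outside3 _ _ _ x t b).
- by move=> z /(piece_C pD) /(fr_CA F).
- exact: st_x G.
- exact: fr_TA F _ tT.
- exact: fr_CA F _ bC.
- by apply/negP=> /(piece_C pD); apply/negP/(fr_SC F)/(fr_x F).
- by apply/negP=> /(piece_C pD); apply/negP/(fr_TC F).
- exact: piece_cut pD.
- by rewrite eq_sym (T_not_x F).
- by rewrite eq_sym (C_not_x F).
- by apply: contraTneq bC => <-; apply: fr_TC F _ tT.
Qed.

(** Otherwise [b] would separate [D] from both roots. *)
Lemma piece_touch b D : piece e C c b D ->
  exists v h, [/\ v \in D, h \in S :|: T & e v h].
Proof.
move=> pD; have /set0Pn[w wD] := piece_nonempty pD.
have wC := piece_C pD wD; have bD := piece_cut pD.
have out z : (z = x \/ z = y) -> conn e (A :\ b) w z -> exists v h, [/\ v \in D, h \in S :|: T & e v h].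
  move=> zxy wz; have zD : z \notin D.
    apply/negP=> zD; have zC := piece_C pD zD; case: zxy => zE.
      by have := C_not_x F zC; rewrite zE eqxx.
    by have := C_not_y F zC (piece_nc pD zD); rewrite zE eqxx.
  have [v [h [cv hA hD evh]]] := conn_first_exit wz wD zD.
  have := conn_inr cv; rewrite inE => /andP[_ vD].
  exists v, h; split=> //.
  have := piece_nbs pD vD evh.
  rewrite !inE (negPf hD) /=; case: eqP => // hb.
  by move: hA; rewrite hb !inE eqxx.
have wb : w \in A :\ b.
  by rewrite !inE (fr_CA F wC) andbT; apply: contraNneq bD => <-.
by case/orP: (st_R G wb); apply: out; [left|right].
Qed.

(** On passing to [D] a vertex loses its core neighbours and regains one edge if it sees [P], while
    [o] prefixes lower the number of lengths required of [D] by [o - 1]. The last hypothesis says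
    that the gain covers the loss. The suffix is a single path from [b] to [c] outside [D]. *)
Lemma solve_piece b D B P o beta :
  min_piece e C c b D -> (forall z, z \in B -> z \notin C) ->
  {subset B <= A :\: ex} -> (exists2 v, v \in D & v \in nbs e P) ->
  (forall p i, p \in P -> i < o -> pth e B x p (beta + 2 * i)) ->
  (exists c0 : bool, forall p, p \in P -> col p = c0) -> 0 < o ->
  (forall v, v \in D -> nb e (S :|: T) v < o + (v \in nbs e P)) ->
  fam e (A :\: ex) x c k.
Proof.
move=> mD BC BA [v0 v0D v0P] pre colP o_gt0 hN; have [pD _] := mD.
have [bC cD _] := pieceP pD.
have [gamma hg] := conn_pth (rest_connected es cC pD (cut_in_rest pD) (target_in_rest cin pD)).
apply: (@fam_sub _ _ (B :|: D :|: (C :\: D))).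
  move=> z; rewrite inE => /orP[]; last first.
    by rewrite inE => /andP[_ zC]; apply: frame_A; rewrite inE zC orbT.
  rewrite inE => /orP[/BA //|/(piece_C pD) zC].
  by apply: frame_A; rewrite inE zC orbT.
apply: (assemble G (P := P) (b := b) (o1 := o) (o2 := 1) (beta := beta) (gamma := gamma)) => //.
- exact: piece_card pD.
- exact: piece_nonempty pD.
- by move=> z /BC; apply: contra => /(piece_C pD).
- by move=> z /BC; apply: contra; rewrite inE => /andP[].
- by move=> z zD; rewrite inE zD.
- by move=> [|//] _; rewrite muln0 addn0.
- move=> v w vD wD; have [t tb wt] := min_piece_conn es mD vD wD.
  by exists t => //; rewrite inE tb orbT.
- by move=> w wD; exists v0 => //; apply: (piece_connected es pD).
- by move=> w wD; apply: (piece_to_cut es cC cin pD wD).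
- move=> v vD; have := piece_deg pD vD; have := hN v vD; nlia.
Qed.

Lemma S_white s : s \in S -> col s = col x.
Proof. exact: (fr_col F). Qed.

Lemma core_C z : z \in S :|: T -> z \notin C.
Proof. by rewrite inE => /orP[/(fr_SC F)|/(fr_TC F)]. Qed.

Lemma core_A : {subset S :|: T <= A :\: ex}.
Proof. by move=> z zH; apply: frame_A; rewrite inE zH. Qed.

Lemma nb_core v : nb e (S :|: T) v <= nb e S v + nb e T v.
Proof. exact: nbU. Qed.

(** Entering from [T] allows [#|S|] prefixes. The bounds in [frame] fit this balance: a vertex has
    at most [#|S|] neighbours in [T], one of which is regained, or fewer than [#|S|] in [S], none of
    which is. *)
Lemma piece_at_T b D v : min_piece e C c b D -> v \in D -> 0 < nb e T v ->
  fam e (A :\: ex) x c k.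
Proof.
move=> mD vD vT; have [pD _] := mD.
apply: (@solve_piece b D (S :|: T) T #|S| 1) => //.
- exact: core_C.
- exact: core_A.
- by exists v => //; rewrite mem_nbs.
- move=> p i pT iS; rewrite addnC addn1.
  apply: biclique_pth => //; [exact: fr_x F|exact: fr_com F|exact: fr_ST F|].
  exact: leq_trans iS (fr_card F).
- by exists (~~ col x) => p; apply: (T_col G F).
- exact: (S_gt0 F).
- move=> w wD; have wC := piece_C pD wD; have wc := piece_nc pD wD.
  have := fr_nbT F wC wc; have := fr_nbS F wC wc; have := nb_core w.
  by rewrite mem_nbs //; case: (S_or_T w) => ->; case: (posnP (nb e T w)); nlia.
Qed.

(** Nothing is lost, since [x] itself becomes the root. *)
Lemma piece_at_x b D : min_piece e C c b D ->
  (forall v h, v \in D -> h \in S :|: T -> e v h -> h = x) ->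
  fam e (A :\: ex) x c k.
Proof.
move=> mD only; have [pD _] := mD.
have [v [h [vD hH evh]]] := piece_touch pD.
have hx := only v h vD hH evh; rewrite {}hx in hH evh.
apply: (@solve_piece b D (S :|: T) [set x] 1 0) => //.
- exact: core_C.
- exact: core_A.
- by exists v => //; rewrite mem_nbs1 es.
- by move=> p [|//]; rewrite inE => /eqP-> _; apply: pth0.
- by exists (col x) => p; rewrite inE => /eqP->.
- move=> w wD.
  have : nb e (S :|: T) w <= nb e [set x] w.
    apply/subset_leq_card/subsetP=> h'; rewrite !inE => /andP[hH' ewh].
    by rewrite ewh andbT; apply/eqP/(only w); rewrite // inE.
  rewrite mem_nbs // nb1; case: (e w x); nlia.
Qed.

(** There are only [#|S| - 1] prefixes to a vertex of [S :\ x]. They suffice for a vertex that sees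
    [S :\ x], since it regains one edge. A vertex that sees only [x] regains none, and its lost edge
    is repaid only if [2 < #|S|]; hence the alternative. *)
Lemma piece_at_S b D a v : min_piece e C c b D ->
  (forall w, w \in D -> nb e T w = 0) -> a \in S -> a != x -> v \in D -> e v a ->
  (2 < #|S|) || [forall w in D, ~~ e w x] ->
  fam e (A :\: ex) x c k.
Proof.
move=> mD noT aS ax vD eva alt; have [pD _] := mD.
have cS : 1 < #|S|.
  by rewrite (cardsD1 x) (fr_x F) (cardsD1 a) !inE ax aS.
apply: (@solve_piece b D (S :|: T) (S :\ x) #|S|.-1 2) => //.
- exact: core_C.
- exact: core_A.
- by exists v => //; rewrite inE; apply/exists_inP; exists a; rewrite 1?es // !inE ax.
- move=> p i; rewrite !inE => /andP[px pS] iS; rewrite addnC addn2.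
  have sT := fr_card F.
  apply: biclique_pth_same => //; try nlia.
  + exact: fr_x F.
  + by rewrite eq_sym.
  + exact: fr_com F.
  + exact: fr_ST F.
- by exists (col x) => p; rewrite inE => /andP[_ /S_white].
- nlia.
- move=> w wD; have wC := piece_C pD wD; have wc := piece_nc pD wD.
  have := fr_nbS F wC wc; have := nb_core w; rewrite (noT w wD) addn0.
  have : nb e S w <= e w x + nb e (S :\ x) w.
    rewrite -nb1; apply: leq_trans (nbU _ _ _ _); apply: nb_sub.
    by move=> z; rewrite !inE; case: eqP.
  rewrite mem_nbs //; case: posnP => [-> | ]; last by nlia.
  case/orP: alt => [|/forall_inP/(_ w wD)/negPf->]; last by nlia.
  by case: (e w x); nlia.
Qed.

(* The only piece which cannot be attached to the core without losing a path. *)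
Definition stuck D :=
  [/\ #|S| = 2, forall w, w \in D -> nb e T w = 0, exists2 v, v \in D & e v x
    & exists v a, [/\ v \in D, a \in S, a != x & e v a]].

Lemma solve_or_stuck b D : min_piece e C c b D ->
  fam e (A :\: ex) x c k \/ stuck D.
Proof.
move=> mD.
have [/exists_inP[v vD vT]|noT] := boolP [exists v in D, 0 < nb e T v].
  by left; apply: piece_at_T mD vD vT.
have {}noT w : w \in D -> nb e T w = 0.
  by move=> wD; apply/eqP; rewrite -leqn0 leqNgt; apply: contra noT => h; apply/exists_inP; exists w.
have [/exists_inP[v vD /exists_inP[a]]|noS] :=
    boolP [exists v in D, [exists a in S :\ x, e v a]]; last first.
  left; apply: (piece_at_x mD) => v h vD; rewrite inE => /orP[hS|hT] evh.
    apply/eqP; apply: contraNT noS => hx; apply/exists_inP; exists v => //.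
    by apply/exists_inP; exists h; rewrite // !inE hx.
  have : 0 < nb e T v by rewrite nb_gt0; apply/exists_inP; exists h.
  by rewrite noT.
rewrite !inE => /andP[ax aS] eva.
have [s3|s3] := ltnP 2 #|S|.
  by left; apply: (piece_at_S mD noT aS ax vD eva); rewrite s3.
have [nox|] := boolP [forall w in D, ~~ e w x].
  by left; apply: (piece_at_S mD noT aS ax vD eva); rewrite nox orbT.
rewrite negb_forall_in => /exists_inP[w wD]; rewrite negbK => ewx; right.
split=> //; [|by exists w|by exists v, a].
by apply/eqP; rewrite eqn_leq s3 (cardsD1 x) (fr_x F) (cardsD1 a) !inE ax aS.
Qed.

End FramePieces.

(** * Two path lengths between the ends of a segment *)

Section Join.
Variables (V : finType) (e : rel V).

Lemma pth_uncons (B : {set V}) u v L : pth e B u v L ->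
  (u = v /\ L = 0) \/
  exists q L', [/\ L = L'.+1, e u q & pth e (B :\ u) q v L'].
Proof.
case=> [[|q p]] [] /=; first by move=> _ -> _ _ <-; left.
move=> /andP[euq pp] lp /andP[up uqp] sub <-; right.
exists q, (size p); split=> //; exists p; split=> //.
move=> z zp; rewrite !inE; apply/andP; split; last by rewrite sub // inE zp orbT.
by apply: contraNneq up => <-.
Qed.

Lemma pth_join (B1 B2 B : {set V}) u v w L1 L2 :
  pth e B1 u v L1 -> pth e B2 v w L2 ->
  (forall z, z \in B1 -> z \in B2 -> z = v) ->
  {subset B1 <= B} -> {subset B2 <= B} -> pth e B u w (L1 + L2).
Proof.
move=> p1 /pth_uncons[[<- ->]|[q [L' [-> evq p2]]]] dis s1 s2.
  by rewrite addn0; apply: pth_sub p1.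
rewrite addnS; apply: (pth_cat p1 evq p2) => //.
  by move=> z z1; rewrite !inE; apply/negP=> /andP[/eqP zv /(dis _ z1)].
by move=> z; rewrite inE => /andP[_ /s2].
Qed.

End Join.

Section Segments.
Variables (V : finType) (col : V -> bool) (e : rel V) (A : {set V}) (x y : V).
Variable k : nat.
Hypothesis G : setting col e A x y k.
Implicit Types (M : {set V}) (p q v w : V).

Let es := st_sym G.

Lemma rooted_sym M p q : rooted e M p q -> rooted e M q p.
Proof. by move=> r v w /r; rewrite orbC. Qed.

Lemma rooted_to M p q w : rooted e M p q -> w \in M -> w != q ->
  conn e (M :\ q) w p.
Proof.
move=> r wM wq; have wMq : w \in M :\ q by rewrite !inE wq.
by case/orP: (r q w wMq) => // /conn_inr; rewrite !inE eqxx.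
Qed.

Lemma seg_links M p q : #|M| < #|A| -> p \in M -> q \in M -> p != q ->
  rooted e M p q -> (exists v, [/\ v \in M, v != p & v != q]) ->
  (forall v, v \in M -> v != p -> v != q -> 2 < nb e M v) -> fam e M p q 2.
Proof.
move=> cM pM qM pq r [v0 [v0M v0p v0q]] deg.
set D := M :\ p :\ q.
have DE z : (z \in D) = [&& z != q, z != p & z \in M] by rewrite !inE.
have pD : p \notin D by rewrite DE eqxx andbF.
have qD : q \notin D by rewrite DE eqxx.
have cD : #|D|.+2 = #|M|.
  by rewrite (cardsD1 p M) pM (cardsD1 q (M :\ p)) !inE eq_sym pq qM.
have exit w : w \in D -> conn e (M :\ q) w p -> exists2 t, t \in nbs e [set p] & conn e D w t.
  move=> wD wp; have [a [b [ca bM bD eab]]] := conn_first_exit wp wD pD.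
  exists a; last by apply: conn_sub ca => z; rewrite inE => /andP[].
  rewrite mem_nbs1 es; move: bM bD; rewrite DE !inE => /andP[-> ->] /=.
  by rewrite andbT negbK => /eqP<-.
have exitq w : w \in D -> conn e (M :\ p) w q -> exists2 t, t \in nbs e [set q] & conn e D w t.
  move=> wD wp; have [a [b [ca bM bD eab]]] := conn_first_exit wp wD qD.
  exists a; last by apply: conn_sub ca => z; rewrite inE => /andP[].
  rewrite mem_nbs1 es; move: bM bD; rewrite DE !inE => /andP[-> ->] /=.
  by rewrite andbT negbK => /eqP<-.
have [l hl] : linked e D (nbs e [set p]) (nbs e [set q]) 2.
  apply: (st_links G (col := col)) => //.
  - by rewrite cD.
  - exact: st_col G.
  - by apply/set0Pn; exists v0; rewrite DE v0p v0q.
  - by exists (~~ col p) => v; rewrite mem_nbs1 => /(col_nb G).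
  - by exists (~~ col q) => v; rewrite mem_nbs1 => /(col_nb G).
  - move=> v w vD; rewrite in_setD1 => /andP[wv wD].
    have wM : w \in M :\ v by rewrite !inE wv; move: wD; rewrite DE => /and3P[].
    have out z : z = p \/ z = q -> conn e (M :\ v) w z ->
        exists2 t, t \in nbs e [set p] :|: nbs e [set q] & conn e (D :\ v) w t.
      move=> zpq wz; have zD : z \notin D by case: zpq => ->.
      have [a [b [ca bM bD eab]]] := conn_first_exit wz wD zD.
      exists a; last by apply: conn_sub ca => t; rewrite !inE => /andP[/andP[-> _] ->].
      rewrite inE !mem_nbs1; move: bM bD; rewrite DE !inE => /andP[_ ->].
      by rewrite andbT negb_and !negbK orbC => /orP[]/eqP<-; rewrite (es b) eab ?orbT.
    by case/orP: (r v w wM); apply: out; [left|right].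
  - move=> w wD; apply: exit => //; apply: rooted_to r _ _.
      by move: wD; rewrite DE => /and3P[].
    by move: wD; rewrite DE => /and3P[].
  - move=> w wD; apply: exitq => //; apply: (rooted_to (rooted_sym r)).
      by move: wD; rewrite DE => /and3P[].
    by move: wD; rewrite DE => /and3P[].
  - move=> _ v; rewrite DE => /and3P[vq vp vM]; have := deg v vM vp vq.
    rewrite -/(nb e D v) !mem_nbs1 -!nb1.
    have : nb e M v <= nb e (D :|: [set p] :|: [set q]) v.
      apply: nb_sub => z zM; rewrite inE in_set1 inE DE in_set1 zM.
      by case: (z == q); case: (z == p).
    have := nbU e (D :|: [set p]) [set q] v; have := nbU e D [set p] v.
    by rewrite !nb1 !(es v); nlia.
exists (l + 2) => i i2; have [h [t [hX tY ph]]] := hl i i2.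
rewrite !mem_nbs1 in hX tY.
have ph1 := pth_cons hX ph pD.
have DM z : z \in D -> z \in M by rewrite DE => /and3P[].
have -> : l + 2 + 2 * i = ((l + 2 * i).+1 + 0).+1 by nlia.
apply: (pth_cat ph1 _ (pth0 e (set11 q))).
- by rewrite es.
- move=> z; rewrite in_setU1 in_set1 => /orP[/eqP->//|zD].
  by apply: contraTneq zD => ->.
- by move=> z; rewrite in_setU1 => /orP[/eqP->|/DM].
- by move=> z; rewrite in_set1 => /eqP->.
Qed.

Section Cut.
Variables (M : {set V}) (p q v : V).
Hypotheses (pM : p \in M) (qM : q \in M) (vM : v \in M).
Hypotheses (r : rooted e M p q) (vp : v != p) (vq : v != q) (pq : p != q).
Hypothesis sep : ~~ conn e (M :\ v) p q.

Let P1 := comp e (M :\ v) p.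

Let pMv : p \in M :\ v.
Proof. by rewrite !inE eq_sym vp. Qed.

Lemma cut_sub z : z \in P1 -> z \in M /\ z != v.
Proof. by move/comp_subset; rewrite !inE => /andP[]. Qed.

Lemma cut_qP : q \notin P1.
Proof. by rewrite inE. Qed.

Lemma cut_closed z w : z \in P1 -> w \in M -> e z w -> w \notin P1 -> w = v.
Proof.
move=> zP wM ezw wP; apply/eqP; apply: contraNT wP => wv.
by apply: comp_closed zP ezw _; rewrite !inE wv.
Qed.

Lemma cut_vP : v \notin P1.
Proof. by apply/negP=> /cut_sub[_]; rewrite eqxx. Qed.

Lemma cut_pP : p \in P1.
Proof. exact: comp_self. Qed.

Lemma cut_conn : conn e (v |: P1) p v.
Proof.
have pv := conn_sym es (rooted_to r vM vq).
have [a [b [ca bM bP eab]]] := conn_first_exit pv cut_pP cut_vP.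
have aP : a \in P1 by have := conn_inr ca; rewrite inE => /andP[].
have bv : b = v.
  by apply: cut_closed aP _ eab bP; move: bM; rewrite inE => /andP[].
rewrite bv in eab; apply: (@conn_trans _ _ _ _ a).
  by apply: conn_sub ca => z; rewrite in_setI in_setU1 => /andP[_ ->]; rewrite orbT.
by apply: conn1; rewrite ?in_setU1 ?eqxx ?aP ?orbT.
Qed.

(** A walk can leave [P1] only into [v], so a connection to [p] or [q] restricts to one to [p] or
    [v]. *)
Lemma cut_rooted : rooted e (v |: P1) p v.
Proof.
move=> v' w; rewrite in_setD1 in_setU1 => /andP[wv' /predU1P[wv|wP]].
  by apply/orP; right; rewrite wv conn_refl // in_setD1 in_setU1 eqxx /= -wv wv'.
have [wM wv] := cut_sub wP.
have inv z : z \in P1 -> z != v' -> z \in (v |: P1) :\ v'.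
  by move=> zP zv'; rewrite in_setD1 in_setU1 zP orbT zv'.
have [v'v|v'v] := eqVneq v' v.
  rewrite (conn_sub _ (comp_connected es wP cut_pP)) // => z zP.
  by apply: inv => //; rewrite v'v; case/cut_sub: zP.
have vin : v \in (v |: P1) :\ v' by rewrite in_setD1 in_setU1 eqxx eq_sym v'v.
have stay : {subset (M :\ v') :&: P1 <= (v |: P1) :\ v'}.
  by move=> z; rewrite !in_setI in_setD1 => /andP[/andP[zv' _] zP]; apply: inv.
have out a b : conn e ((M :\ v') :&: P1) w a -> b \in M :\ v' -> b \notin P1 -> e a b ->
    conn e ((v |: P1) :\ v') w v.
  move=> ca bM bP eab; have := conn_inr ca; rewrite in_setI => /andP[aM aP].
  have bv : b = v by apply: cut_closed aP _ eab bP; move: bM; rewrite inE => /andP[].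
  rewrite bv in eab; apply: conn_trans (conn_sub stay ca) _; apply: conn1 => //.
  by apply: stay; rewrite in_setI aM.
have wMv' : w \in M :\ v' by rewrite in_setD1 wv'.
case/orP: (r wMv') => [wp|wq].
  case: (conn_stay wp wP) => [h|[a [b [ca bM bP eab]]]].
    by apply/orP; left; apply: (conn_sub stay h).
  by rewrite (out _ _ ca bM bP eab) orbT.
have [a [b [ca bM bP eab]]] := conn_first_exit wq wP cut_qP.
by rewrite (out _ _ ca bM bP eab) orbT.
Qed.

End Cut.

(* A vertex allowed to have few neighbours in M must separate p from q in M and
   have colour w0. *)
Lemma seg M p q (w0 : bool) : #|M| < #|A| -> p \in M -> q \in M -> p != q ->
  rooted e M p q ->
  (forall v, v \in M -> v != p -> v != q ->
     2 < nb e M v \/ col v = w0 /\ ~~ conn e (M :\ v) p q) ->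
  fam e M p q 2 \/
  #|M| <= 3 /\ forall v, v \in M -> v != p -> v != q -> col v = w0.
Proof.
have [n] := ubnP #|M|; elim: n M p q => // n IH M p q leM cM pM qM pq r H.
have [|] := boolP [exists v in M :\ p :\ q, nb e M v <= 2]; last first.
  move=> no; have deg v : v \in M -> v != p -> v != q -> 2 < nb e M v.
    move=> vM vp vq; rewrite ltnNge; apply: contra no => le.
    by apply/exists_inP; exists v; rewrite // !inE vq vp.
  have [/set0Pn[v]|] := boolP (M :\ p :\ q != set0).
    rewrite !inE => /and3P[vq vp vM]; left; apply: seg_links => //.
    by exists v.
  rewrite negbK => /eqP M0; right; split.
    rewrite (cardsD1 p M) pM (cardsD1 q (M :\ p)) M0 cards0 !inE eq_sym pq qM //.
  move=> v vM vp vq; have : v \in M :\ p :\ q by rewrite !inE vq vp.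
  by rewrite M0 inE.
case/exists_inP=> v; rewrite !inE => /and3P[vq vp vM] le2.
have [cv sep] : col v = w0 /\ ~~ conn e (M :\ v) p q.
  by case: (H v vM vp vq) => //; rewrite ltnNge le2.
(* [M] is split at the vertex [v] of low degree. A half with a vertex besides [p'] and [v] yields
   two lengths: in the small exceptional outcome that vertex would be adjacent to [v], although both
   have colour [w0]. *)
have half p' q' : p' \in M -> q' \in M -> p' != q' -> rooted e M p' q' -> v != p' -> v != q' ->
   ~~ conn e (M :\ v) p' q' -> 
   (forall v, v \in M -> v != p' -> v != q' ->
     2 < nb e M v \/ col v = w0 /\ ~~ conn e (M :\ v) p' q') ->
   fam e (v |: comp e (M :\ v) p') p' v 2 \/ comp e (M :\ v) p' = [set p'].
  move=> p'M q'M p'q' r' vp' vq' sep' H'.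
  set P1 := comp e (M :\ v) p'.
  have vP : v \notin P1 := cut_vP M p' v.
  have PM z : z \in P1 -> z \in M by case/cut_sub.
  have sub : v |: P1 \proper M.
    apply/properP; split.
      by apply/subsetP=> z; rewrite in_setU1 => /predU1P[->|/PM].
    by exists q'; rewrite // in_setU1 negb_or eq_sym vq' (cut_qP sep').
  have lt1 := proper_card sub.
  have p'P : p' \in P1 by apply: cut_pP.
  have [] := IH (v |: P1) p' v.
  - by nlia.
  - by nlia.
  - by rewrite in_setU1 p'P orbT.
  - by rewrite setU11.
  - by rewrite eq_sym.
  - exact: (cut_rooted p'M r' vp' sep').
  - move=> v1; rewrite in_setU1 => /predU1P[->|v1P]; first by rewrite eqxx.
    move=> v1p v1v; have v1q : v1 != q' by apply: contraTneq v1P => ->; apply: cut_qP.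
    case: (H' v1 (PM _ v1P) v1p v1q) => [d|[cv1 s1]]; [left|right; split=> //].
      apply: leq_trans d _; apply/subset_leq_card/subsetP=> w.
      rewrite !inE => /andP[wM ew]; rewrite ew andbT.
      have [//|wv] := eqVneq w v; rewrite /=.
      by have := comp_closed v1P ew (_ : w \in M :\ v); rewrite !inE wv; apply.
    (* A vertex of this half separating [p'] from [q'] in [M] also separates [p'] from [v] in the
       half, because [v] reaches [q'] on the other side. *)
    apply: contra s1 => pv.
    have := cut_conn q'M vM (rooted_sym r') vq' vp' => cq.
    apply: (@conn_trans _ _ _ _ v).
      apply: conn_sub pv => z; rewrite !in_setD1 in_setU1 => /andP[-> /predU1P[->|/PM]] //.
    apply: conn_sub (conn_sym es cq) => z; rewrite in_setU1 in_setD1.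
    case/predU1P=> [->|zP]; first by rewrite eq_sym v1v.
    have [-> _] := cut_sub zP; rewrite andbT; apply: contraTneq zP => ->.
    rewrite inE; apply/negP=> qv1; case/negP: sep'.
    by move: v1P; rewrite inE => pv1; apply: conn_trans pv1 (conn_sym es qv1).
  - by left.
  case=> c3 inner; right; apply/setP=> w; rewrite in_set1; apply/idP/eqP => [wP|->//].
  apply/eqP/negPn/negP=> wp.
  have [wM wv] := cut_sub wP.
  have cw : col w = w0 by apply: inner; rewrite // in_setU1 wP orbT.
  have only z : z \in P1 -> z != p' -> z = w.
    move=> zP zp; apply/eqP/negPn/negP=> zw; move: c3.
    rewrite (cardsD1 v) setU11 (cardsD1 p') (cardsD1 w) (cardsD1 z).
    have zv : z != v by case/cut_sub: zP.
    by rewrite !in_setD1 !in_setU1 (eq_sym p') vp' p'P wp wv wP zw zp zv zP !orbT.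
  have wq := rooted_to (rooted_sym r') wM wp.
  have [a [b [ca bM bP eab]]] := conn_first_exit wq wP (cut_qP sep').
  have := conn_inr ca; rewrite in_setI in_setD1 => /andP[/andP[ap aM] aP].
  have bv : b = v.
    by apply: cut_closed aP _ eab bP; move: bM; rewrite inE => /andP[].
  have := st_col G eab; rewrite bv cv (only a aP ap) cw eqxx //.
have qp : q != p by rewrite eq_sym.
have sep' : ~~ conn e (M :\ v) q p by apply: contra sep; apply: conn_sym.
have H' v' : v' \in M -> v' != q -> v' != p ->
    2 < nb e M v' \/ col v' = w0 /\ ~~ conn e (M :\ v') q p.
  move=> h1 h2 h3; case: (H v' h1 h3 h2) => [?|[? s1]]; [by left|right; split=> //].
  by apply: contra s1; apply: conn_sym.
have h1 := half p q pM qM pq r vp vq sep H.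
have h2 := half q p qM pM qp (rooted_sym r) vq vp sep' H'.
have PM z p' : z \in v |: comp e (M :\ v) p' -> z \in M.
  by rewrite in_setU1 => /predU1P[->//|/cut_sub[]].
have dis z : z \in v |: comp e (M :\ v) p -> z \in v |: comp e (M :\ v) q -> z = v.
  rewrite !in_setU1 => /predU1P[//|zp] /predU1P[//|zq]; case/negP: sep.
  by move: zp zq; rewrite !inE => zp zq; apply: conn_trans zp (conn_sym es zq).
have cp := cut_conn pM vM r vp vq.
have cq := conn_sym es (cut_conn qM vM (rooted_sym r) vq vp).
have [L1 p1] := conn_pth cp; have [L2 p2] := conn_pth cq.
(* Two lengths in one half suffice, the other half contributing a fixed path. If both are trivial,
   [M] consists of [p], [q] and [v]. *)
case: h1 => [[l hl]|e1].
  left; exists (l + L2) => i i2; have := pth_join (hl i i2) p2 dis (fun z => @PM z p) (fun z => @PM z q).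
  by rewrite addnAC.
case: h2 => [[l hl]|e2].
  left; exists (L1 + l) => i i2.
  have := pth_join p1 (pth_rev es (hl i i2)) dis (fun z => @PM z p) (fun z => @PM z q).
  by rewrite addnA.
have all z : z \in M -> [|| z == p, z == q | z == v].
  move=> zM; have [->|zv] := eqVneq z v; first by rewrite !orbT.
  have zMv : z \in M :\ v by rewrite !inE zv.
  case/orP: (r v z zMv) => /(conn_sym es) zc.
    have : z \in comp e (M :\ v) p by rewrite inE.
    by rewrite e1 in_set1 => ->.
  have : z \in comp e (M :\ v) q by rewrite inE.
  by rewrite e2 in_set1 => ->; rewrite orbT.
right; split.
  apply: leq_trans (_ : #|[set p; q; v]| <= 3).
    by apply/subset_leq_card/subsetP=> z /all; rewrite !inE orbA.
  by apply: leq_trans (leq_card_setU _ _) _; rewrite cards1 cards2; case: (p != q).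
by move=> z /all /or3P[/eqP->|/eqP->|/eqP->] //; rewrite eqxx.
Qed.

End Segments.

(** * The exceptional case [|S| = 2]: a second option *)

Section Stuck.
Variables (V : finType) (col : V -> bool) (e : rel V) (A : {set V}) (x y : V).
Variable k : nat.
Hypothesis G : setting col e A x y k.
Variables (S T C : {set V}) (c : V) (ex : {set V}) (a : V).
Hypothesis F : frame col e A x y S T C c ex.
Hypotheses (ax : a != x) (S2 : S = [set x; a]).
Implicit Types (B D M P K : {set V}) (b u v w : V).

Let es := st_sym G.
Let cC := fr_conn F.
Let cin := fr_c F.

Definition attached b D :=
  [/\ min_piece e C c b D, forall w, w \in D -> nb e T w = 0,
      exists2 v, v \in D & e v x & exists2 v, v \in D & e v a].

Let xS : x \in S. Proof. exact: fr_x F. Qed.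
Let aS : a \in S. Proof. by rewrite S2 !inE eqxx orbT. Qed.
Let cardS : #|S| = 2. Proof. by rewrite S2 cards2 eq_sym ax. Qed.
Let cardT : 1 < #|T|. Proof. by rewrite -cardS; apply: fr_card F. Qed.
Let ext u : u \in T -> e x u. Proof. exact: (fr_com F xS). Qed.
Let eat u : u \in T -> e a u. Proof. exact: (fr_com F aS). Qed.

Let S_cases s : s \in S -> s = x \/ s = a.
Proof. by rewrite S2 !inE => /orP[]/eqP; [left|right]. Qed.

Let coreA : {subset S :|: T <= A :\: ex}. Proof. exact: (core_A F). Qed.

Lemma short_x_a : pth e (S :|: T) x a 2.
Proof.
apply: (biclique_pth_same es (j := 0)) => //.
- by rewrite eq_sym.
- exact: fr_com F.
- exact: fr_ST F.
- by rewrite cardS.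
- exact: leq_trans cardT.
Qed.

(** The path is [x, u1, v, u2, a]; together with [short_x_a] it gives the lengths 2 and 4. *)
Lemma long_x_a v : v \notin S :|: T -> 1 < nb e T v ->
  pth e (v |: (S :|: T)) x a 4.
Proof.
rewrite !inE => /norP[vS vT] /nb_two[u1 [u2 [u1T u2T u12 e1 e2]]].
have nS u z : u \in T -> z \in S -> z != u.
  by move=> uT zS; apply: contraTneq uT => <-; apply: fr_ST F _ zS.
have nv u : u \in S -> u != v by apply: contraTneq => ->.
have nvT u : u \in T -> u != v by apply: contraTneq => ->.
exists [:: u1; v; u2; a]; split=> //.
- by rewrite /= ext // (es u1) e1 e2 (es u2) eat.
- rewrite /= !inE !negb_or (nS u1 x) // (nv x) // (nS u2 x) // (eq_sym x) ax.
  by rewrite nvT // u12 (eq_sym u1 a) (nS u1 a) // (eq_sym v u2) nvT // (eq_sym v a) nv // (eq_sym u2 a) (nS u2 a).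
- move=> z; rewrite !inE => /orP[/eqP->|/or4P[]/eqP->]; rewrite ?eqxx ?xS ?aS ?u1T ?u2T ?orbT //.
Qed.

Lemma attached_deg b D v : attached b D -> v \in D ->
  k < nb e D v + (v \in nbs e [set b]) + nb e S v /\ nb e S v <= 1.
Proof.
case=> [[pD _]] noT _ _ vD; split.
  have := piece_deg G F pD vD; have := nb_core e S T v; rewrite (noT _ vD); nlia.
by have := fr_nbS F (piece_C pD vD) (piece_nc pD vD); rewrite cardS.
Qed.

(* Going to a first costs one path in D, which the two spare options repay. *)
Lemma through_a b D B M o1 o2 beta gamma : attached b D ->
  (forall z, z \in B -> z \notin D) -> (forall z, z \in B -> z \notin M) ->
  (forall z, z \in D -> z \notin M) ->
  {subset B <= A :\: ex} -> {subset M <= A :\: ex} ->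
  0 < o1 -> 0 < o2 -> 2 < o1 + o2 ->
  (forall i, i < o1 -> pth e B x a (beta + 2 * i)) ->
  (forall i, i < o2 -> pth e M b c (gamma + 2 * i)) ->
  fam e (A :\: ex) x c k.
Proof.
move=> aD BD BM DM BA MA o10 o20 o3 pre suf.
have [mD noT _ [v0 v0D v0a]] := aD; have [pD _] := mD.
apply: (@fam_sub _ _ (B :|: D :|: M)).
  move=> z; rewrite !in_setU => /orP[/orP[/BA //|zD]|/MA //].
  by apply: (frame_A F); rewrite !in_setU (piece_C pD zD) orbT.
apply: (assemble G (P := [set a]) (b := b) (o1 := o1) (o2 := o2) (beta := beta) (gamma := gamma)) => //.
- exact: (piece_card G F pD).
- exact: piece_nonempty pD.
- by move=> p i; rewrite inE => /eqP->; apply: pre.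
- by exists (col a) => p; rewrite inE => /eqP->.
- move=> v w vD wD; have [t tb wt] := min_piece_conn es mD vD wD.
  by exists t => //; rewrite in_setU tb orbT.
- move=> w wD; exists v0; first by rewrite mem_nbs1 es.
  by apply: (piece_connected es pD).
- by move=> w wD; apply: (piece_to_cut es cC cin pD wD).
- move=> v vD; have [d1 d2] := attached_deg aD vD.
  have : nb e [set a] v <= nb e S v by apply: nb_sub => z; rewrite inE => /eqP->.
  rewrite (mem_nbs [set a]) // nb1; nlia.
Qed.

Let R0 := A :\: (S :|: T :|: C :|: ex).

Lemma rest_out v w : v \in R0 -> e v w -> w \in R0 :|: (S :|: T).
Proof.
rewrite in_setD => /andP[vn vA] evw; have wA := eAr G evw.
have := fr_rest F vA vn evw.
by rewrite !inE wA; case: (w \in C); case: (w \in ex); case: (w \in S); case: (w \in T).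
Qed.

Lemma rest_S z : z \in S -> z \notin R0.
Proof. by rewrite !inE => ->. Qed.

Lemma rest_T z : z \in T -> z \notin R0.
Proof. by rewrite !inE => ->; rewrite orbT. Qed.

Lemma rest_y : y \notin R0.
Proof. by rewrite !inE; case/orP: (fr_y F) => [/eqP->|->]; rewrite ?cin ?orbT. Qed.

Lemma rest_deg v : v \in R0 -> k < nb e R0 v + (nb e S v + nb e T v).
Proof.
move=> vR; have vA : v \in A by move: vR; rewrite inE => /andP[].
have vx : v != x by apply: contraTneq vR => ->; apply: rest_S.
have vy : v != y by apply: contraTneq vR => ->; apply: rest_y.
have := st_deg G vA vx vy; rewrite (deg_nb (fun w => rest_out vR (w := w))).
have := nbU e R0 (S :|: T) v; have := nbU e S T v; nlia.
Qed.

(* A component K of the rest which meets T has its own connections from x to a. *)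
Lemma two_x_a_rest u0 w0 : u0 \in T -> w0 \in R0 -> e u0 w0 ->
  exists beta, forall i, i < 2 -> pth e (S :|: T :|: R0) x a (beta + 2 * i).
Proof.
move=> u0T w0R e0.
(* A vertex with two neighbours in [T] gives the lengths 2 and 4. Otherwise every vertex of the rest
   has at most one neighbour in each side of the core, so membership in a trace counts its edges
   exactly. *)
have [/exists_inP[v vR v2]|no2] := boolP [exists v in R0, 1 < nb e T v].
  exists 2 => -[|[|//]] _.
    by apply: pth_sub short_x_a => z zH; rewrite inE zH.
  apply: (pth_sub _ (long_x_a _ v2)).
    by move=> z; rewrite in_setU1 => /predU1P[->|zH]; rewrite in_setU ?vR ?zH ?orbT.
  apply: contraL vR; rewrite in_setU => /orP[/rest_S|/rest_T] //.
have T1 v : v \in R0 -> nb e T v <= 1.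
  by move=> vR; rewrite leqNgt; apply: contra no2 => h; apply/exists_inP; exists v.
have S1 v : v \in R0 -> nb e S v <= 1.
  rewrite in_setD => /andP[vn vA]; have := fr_restS F vA vn.
  by rewrite cardS.
set K := comp e R0 w0.
have KR z : z \in K -> z \in R0 by apply: comp_subset.
have w0K : w0 \in K by apply: comp_self.
have Kcl v w : v \in K -> e v w -> w \in R0 -> w \in K by apply: comp_closed.
have KK : connected e K by apply: comp_connected.
clearbody K.
have Kout v w : v \in K -> e v w -> w \in K :|: (S :|: T).
  move=> vK evw; have := rest_out (KR _ vK) evw; rewrite in_setU => /orP[wR|wH].
    by rewrite in_setU (Kcl _ _ vK evw wR).
  by rewrite in_setU wH orbT.
have KH z : z \in S :|: T -> z \notin K.
  by rewrite in_setU => zH; apply/negP=> /KR; apply/negP; case/orP: zH => [/rest_S|/rest_T].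
have Kdeg v : v \in K -> 2 < nb e K v + nb e S v + nb e T v.
  move=> vK; have := st_k G; have := rest_deg (KR _ vK).
  have : nb e R0 v <= nb e K v.
    apply/subset_leq_card/subsetP=> w wN; move: wN; rewrite in_set => /andP[wR evw].
    by rewrite in_set evw andbT; apply: Kcl vK evw wR.
  nlia.
have xK : x \notin K by apply: KH; rewrite in_setU xS.
have yK : y \notin K by apply/negP=> /KR; apply/negP/rest_y.
have leave v w : w \in K -> w != v ->
    exists t h, [/\ conn e (K :\ v) w t, h \in S :|: T, h != v & e t h].
  move=> wK wv; have wA : w \in A :\ v.
    by rewrite !inE wv; move: (KR _ wK); rewrite inE => /andP[].
  have out z : z \notin K -> conn e (A :\ v) w z ->
      exists t h, [/\ conn e (K :\ v) w t, h \in S :|: T, h != v & e t h].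
    move=> zK wz; have [t [h [ct hA hK eth]]] := conn_first_exit wz wK zK.
    have := conn_inr ct; rewrite in_setI => /andP[_ tK].
    exists t, h; split=> //.
    - by apply: conn_sub ct => s; rewrite !inE => /andP[/andP[-> _] ->].
    - by have := Kout _ _ tK eth; rewrite in_setU (negPf hK).
    - by move: hA; rewrite in_setD1 => /andP[].
  by case/orP: (st_R G wA); apply: out.
have cK : #|K|.+2 < #|A|.
  apply: (@card_outside3 _ _ _ x a u0) => //.
  - by move=> z /KR; rewrite inE => /andP[].
  - exact: st_x G.
  - exact: fr_SA F _ aS.
  - exact: fr_TA F _ u0T.
  - by apply: KH; rewrite in_setU aS.
  - by apply: KH; rewrite in_setU u0T orbT.
  - by rewrite eq_sym.
  - by rewrite eq_sym (T_not_x F).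
  - by apply: contraTneq u0T => <-; apply: fr_ST F _ aS.
have K0 : K != set0 by apply/set0Pn; exists w0.
have colT P : {subset P <= T} -> exists c0 : bool, forall v, v \in nbs e P -> col v = c0.
  move=> PT; exists (col x) => v; rewrite inE => /exists_inP[p /PT pT epv].
  by rewrite (col_nb G epv) (T_col G F pT) negbK.
have sub0 z : z \in K -> z \in S :|: T :|: R0 by move/KR; rewrite in_setU => ->; rewrite orbT.
have subS z : z \in S -> z \in S :|: T :|: R0 by rewrite !in_setU => ->.
have subT z : z \in T -> z \in S :|: T :|: R0 by rewrite !in_setU => ->; rewrite orbT.
(* If [K] also sees [S], a path in [K] from a neighbour of [u] in [T] to a neighbour of one vertex
   of [S] extends over [u] to the other vertex of [S]. The 3 counts the edges outside [K]. *)
have [/exists_inP[v1 v1K v1S]|noS] := boolP [exists v in K, 0 < nb e S v].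
  have [l hl] : linked e K (nbs e T) (nbs e S) 2.
    apply: (st_links G (col := col)) => //.
    - exact: st_col G.
    - exact: colT.
    - exists (~~ col x) => v; rewrite inE => /exists_inP[p pS epv].
      by rewrite (col_nb G epv) (fr_col F pS).
    - move=> v w vK; rewrite in_setD1 => /andP[wv wK].
      have [t [h [ct hH _ eth]]] := leave v w wK wv; exists t => //.
      move: hH; rewrite !in_setU !mem_nbs // !nb_gt0 => /orP[hS|hT].
        by apply/orP; right; apply/exists_inP; exists h.
      by apply/orP; left; apply/exists_inP; exists h.
    - move=> w wK; exists w0; last exact: KK.
      by rewrite inE; apply/exists_inP; exists u0.
    - by move=> w wK; exists v1; [rewrite mem_nbs | apply: KK].
    - move=> _ v vK; have := Kdeg v vK; rewrite -/(nb e K v) !mem_nbs //.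
      have := S1 _ (KR _ vK); have := T1 _ (KR _ vK); nlia.
  exists (l + 3) => i i2; have [h [t [hX tY ph]]] := hl i i2.
  move: hX tY; rewrite !inE => /exists_inP[u uT euh] /exists_inP[s sS est].
  have htu : e h u by rewrite es.
  have uK : u \notin K by apply: KH; rewrite in_setU uT orbT.
  have finish z1 z2 s1 s2 : pth e K z1 z2 (l + 2 * i) -> s1 \in S -> s2 \in S -> s1 != s2 ->
      e s1 z1 -> e z2 u -> pth e (S :|: T :|: R0) s1 s2 (l + 3 + 2 * i).
    move=> p12 s1S s2S s12 e1 e2.
    have s1K : s1 \notin K by apply: KH; rewrite in_setU s1S.
    have s2K : s2 \notin K by apply: KH; rewrite in_setU s2S.
    have us2 : pth e [set u; s2] u s2 1.
      have := pth_cons (_ : e u s2) (pth0 e (set11 s2)); apply.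
        by rewrite es; apply: fr_com F _ _ s2S uT.
      by rewrite inE; apply: contraTneq uT => ->; apply: fr_ST F _ s2S.
    have -> : l + 3 + 2 * i = ((l + 2 * i).+1 + 1).+1 by nlia.
    apply: (pth_cat (pth_cons e1 p12 s1K) e2 us2).
    - move=> z; rewrite in_setU1 !inE negb_or => /predU1P[->|zK].
        rewrite s12 andbT; apply: contraTneq uT => <-; exact: fr_ST F _ s1S.
      by apply/andP; split; apply: contraTneq zK => ->.
    - by move=> z; rewrite in_setU1 => /predU1P[->|/sub0//]; apply: subS.
    - by move=> z; rewrite !inE -/R0 => /orP[]/eqP->; rewrite ?uT ?s2S ?orbT.
  case: (S_cases sS) => sE; rewrite sE in est.
    by apply: (finish t h) => //; [apply: pth_rev|rewrite eq_sym].
  apply: pth_rev => //.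
  by apply: (finish t h) => //; apply: pth_rev.
have T_only t h : t \in K -> h \in S :|: T -> e t h -> h \in T.
  move=> tK; rewrite in_setU => /orP[hS|//] eth; case/negP: noS.
  by apply/exists_inP; exists t; rewrite // nb_gt0; apply/exists_inP; exists h.
(* Now [K] sees only [T], and more of it than [u0], which would otherwise separate [K] from the
   roots. The path is [x, u0], a path in [K], then [u, a]; the 4 counts its edges outside [K]. *)
have [l hl] : linked e K (nbs e [set u0]) (nbs e (T :\ u0)) 2.
  apply: (st_links G (col := col)) => //.
  - exact: st_col G.
  - by apply: colT => z; rewrite inE => /eqP->.
  - by apply: colT => z; rewrite in_setD1 => /andP[].
  - move=> v w vK; rewrite in_setD1 => /andP[wv wK].
    have [t [h [ct hH _ eth]]] := leave v w wK wv; exists t => //.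
    have tK : t \in K by have := conn_inr ct; rewrite in_setD1 => /andP[].
    have hT := T_only t h tK hH eth.
    rewrite in_setU mem_nbs1 mem_nbs // nb_gt0.
    have [<-|hu] := eqVneq h u0; first by rewrite es eth.
    by apply/orP; right; apply/exists_inP; exists h; rewrite // in_setD1 hu.
  - by move=> w wK; exists w0; [rewrite mem_nbs1|apply: KK].
  - move=> w wK; have wu : w != u0.
      by apply: contraTneq wK => ->; apply: KH; rewrite in_setU u0T orbT.
    have [t [h [ct hH hu eth]]] := leave u0 w wK wu; exists t.
      have tK : t \in K by have := conn_inr ct; rewrite in_setD1 => /andP[].
      rewrite mem_nbs // nb_gt0; apply/exists_inP; exists h => //.
      by rewrite in_setD1 hu (T_only t).
    by apply: conn_sub ct => z; rewrite in_setD1 => /andP[].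
  - move=> _ v vK; have := Kdeg v vK; rewrite -/(nb e K v) !mem_nbs //.
    have nS : nb e S v = 0.
      apply/eqP; rewrite -leqn0 leqNgt; apply: contra noS => h.
      by apply/exists_inP; exists v.
    have : nb e T v <= nb e [set u0] v + nb e (T :\ u0) v.
      apply: leq_trans (nbU _ _ _ _); apply: nb_sub => z zT.
      by rewrite in_setU in_setD1 in_set1 zT andbT; case: (z == u0).
    have := T1 _ (KR _ vK); rewrite nS; nlia.
exists (l + 4) => i i2; have [h [t [hX tY ph]]] := hl i i2.
move: hX tY; rewrite mem_nbs1 inE => euh /exists_inP[u]; rewrite in_setD1 => /andP[uu0 uT] eut.
have u0K : u0 \notin K by apply: KH; rewrite in_setU u0T orbT.
have uK : u \notin K by apply: KH; rewrite in_setU uT orbT.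
have aK : a \notin K by apply: KH; rewrite in_setU aS.
have xT := fr_ST F xS; have aT := fr_ST F aS.
have nxT z : z \in T -> x != z by move=> zT; apply: contraNneq xT => ->.
have naT z : z \in T -> a != z by move=> zT; apply: contraNneq aT => ->.
have p1 := pth_cons euh ph u0K.
have p2 : pth e (x |: (u0 |: K)) x t (l + 2 * i).+2.
  by apply: pth_cons (ext u0T) p1 _; rewrite in_setU1 negb_or nxT.
have p3 : pth e [set u; a] u a 1.
  have := pth_cons (_ : e u a) (pth0 e (set11 a)); apply; first by rewrite es eat.
  by rewrite in_set1 eq_sym naT.
have -> : l + 4 + 2 * i = ((l + 2 * i).+2 + 1).+1 by nlia.
apply: (pth_cat p2 _ p3).
- by rewrite es.
- move=> z; rewrite !in_setU1 in_set1 negb_or => /predU1P[->|/predU1P[->|zK]].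
  + by rewrite nxT // eq_sym ax.
  + by rewrite eq_sym uu0 eq_sym naT.
  + by apply/andP; split; apply: contraTneq zK => ->.
- by move=> z; rewrite !in_setU1 => /predU1P[->|/predU1P[->|/sub0 //]]; [apply: subS|apply: subT].
- by move=> z; rewrite in_setU1 in_set1 => /predU1P[->|/eqP->]; [apply: subT|apply: subS].
Qed.

End Stuck.

Section StuckPieces.
Variables (V : finType) (col : V -> bool) (e : rel V) (A : {set V}) (x y : V).
Variable k : nat.
Hypothesis G : setting col e A x y k.
Variables (S T C : {set V}) (c : V) (ex : {set V}) (a : V).
Hypothesis F : frame col e A x y S T C c ex.
Hypotheses (ax : a != x) (S2 : S = [set x; a]) (k3 : 2 < k).
Implicit Types (B D M P K : {set V}) (b u v w : V).

Let es := st_sym G.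
Let cC := fr_conn F.
Let cin := fr_c F.
Let xS : x \in S. Proof. exact: fr_x F. Qed.
Let aS : a \in S. Proof. by rewrite S2 !inE eqxx orbT. Qed.
Let S_cases s : s \in S -> s = x \/ s = a.
Proof. by rewrite S2 !inE => /orP[]/eqP; [left|right]. Qed.
Let xC : x \notin C. Proof. exact: fr_SC F _ xS. Qed.
Let aC : a \notin C. Proof. exact: fr_SC F _ aS. Qed.
Let xA' : x \in A :\: ex. Proof. by rewrite inE (fr_Sex F xS) (fr_SA F xS). Qed.
Let aA' : a \in A :\: ex. Proof. by rewrite inE (fr_Sex F aS) (fr_SA F aS). Qed.
Let CA' z : z \in C -> z \in A :\: ex.
Proof. by move=> zC; rewrite inE (fr_Cex F zC) (fr_CA F zC). Qed.

(* Either D1 contains a part K seen only through v and b1, and all the paths can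
   be taken through K, or D1 + x + a is rooted. *)
Lemma two_x_a_piece b1 D1 : attached e x T C c a b1 D1 ->
  fam e (A :\: ex) x c k \/
  exists beta, forall i, i < 2 -> pth e (x |: (a |: D1)) x a (beta + 2 * i).
Proof.
move=> aD; have [mD noT [vx vxD evx] [va vaD eva]] := aD; have [pD _] := mD.
have DC := piece_subset pD.
have cD := piece_connected es pD.
have xD : x \notin D1 by apply: contra xC => /DC.
have aD1 : a \notin D1 by apply: contra aC => /DC.
pose good v w := [exists t in comp e (D1 :\ v) w, 0 < nb e S t].
have [|allgood] := boolP [exists v in D1, exists w in D1 :\ v, ~~ good v w].
  (* No vertex of [K] loses an edge when [v] and [b1] become the roots, so one prefix and one suffix
     are enough. *)
  case/exists_inP=> v vD /exists_inP[w wDv bad]; left.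
  rewrite /good in bad; set K := comp e (D1 :\ v) w in bad.
  have KDv z : z \in K -> z \in D1 :\ v by apply: comp_subset.
  have wK : w \in K by apply: comp_self.
  have Kcl z1 z2 : z1 \in K -> e z1 z2 -> z2 \in D1 :\ v -> z2 \in K by apply: comp_closed.
  have KK : connected e K by apply: comp_connected.
  have noS z : z \in K -> nb e S z = 0.
    move=> zK; apply/eqP; rewrite -leqn0 leqNgt; apply: contra bad => h.
    by apply/exists_inP; exists z.
  clearbody K.
  have KD z : z \in K -> z \in D1 by move/KDv; rewrite in_setD1 => /andP[].
  have vK : v \notin K by apply/negP=> /KDv; rewrite in_setD1 eqxx.
  have Kout z1 z2 : z1 \in K -> z2 \in D1 -> e z1 z2 -> z2 \notin K -> z2 = v.
    move=> z1K z2D e12 z2K; apply/eqP; apply: contraNT z2K => z2v.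
    by apply: Kcl z1K e12 _; rewrite in_setD1 z2v.
  have cR : connected e (D1 :\: K).
    apply: (connected_del_pendant es (b := v)) => // z1 z2 z1K z2D e12.
    have [z2K|z2K] := boolP (z2 \in K); [by left|right].
    exact: Kout z1K z2D e12 z2K.
  have vxK : vx \in D1 :\: K.
    rewrite inE vxD andbT; apply/negP=> /noS/eqP; rewrite -leqn0 leqNgt nb_gt0.
    by case/negP; apply/exists_inP; exists x.
  have vR : v \in D1 :\: K by rewrite inE vK vD.
  have [L1 p1] := conn_pth (cR _ _ vxK vR).
  have exv : e x vx by rewrite es.
  have p1' := pth_cons exv p1 (_ : x \notin _).
  have {p1'}p1 : pth e (x |: (D1 :\: K)) x v L1.+1.
    by apply: p1'; rewrite inE (negPf xD) andbF.
  have [L2 p2] := conn_pth (rest_connected es cC pD (cut_in_rest pD) (target_in_rest cin pD)).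
  apply: (@fam_sub _ _ ((x |: (D1 :\: K)) :|: K :|: (C :\: D1))).
    move=> z; rewrite 2!in_setU in_setU1 in_setD => /orP[/orP[/orP[/eqP->//|/andP[_ /DC/CA' //]]|/KD/DC/CA' //]|].
    by rewrite in_setD => /andP[_ /CA'].
  apply: (assemble G (P := [set v]) (b := b1) (o1 := 1) (o2 := 1) (beta := L1.+1) (gamma := L2)) => //.
  - apply: leq_ltn_trans (piece_card G F pD); rewrite !ltnS.
    by apply/subset_leq_card/subsetP.
  - by apply/set0Pn; exists w.
  - move=> z; rewrite in_setU1 in_setD => /predU1P[->|/andP[] //].
    by apply: contra xD => /KD.
  - move=> z; rewrite in_setU1 !in_setD => /predU1P[->|/andP[_ ->] //].
    by rewrite (negPf xC) andbF.
  - by move=> z /KD zD; rewrite in_setD zD.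
  - by move=> p [|//]; rewrite in_set1 => /eqP-> _; rewrite muln0 addn0.
  - by move=> [|//] _; rewrite muln0 addn0.
  - by exists (col v) => p; rewrite in_set1 => /eqP->.
  - move=> v' w' v'K; rewrite in_setD1 => /andP[wv' w'K].
    have w'D : w' \in D1 :\ v' by rewrite in_setD1 wv' KD.
    have [t tb wt] := min_piece_conn es mD (KD _ v'K) w'D.
    have sub : {subset (D1 :\ v') :&: K <= K :\ v'}.
      by move=> z; rewrite in_setI !in_setD1 => /andP[/andP[-> _] ->].
    case: (conn_stay wt w'K) => [/(conn_sub sub) h|[s [r [cs rD rK esr]]]].
      by exists t; rewrite // in_setU tb orbT.
    exists s; last exact: conn_sub sub cs.
    have sK : s \in K by have := conn_inr cs; rewrite in_setI => /andP[].
    have rD' : r \in D1 by move: rD; rewrite in_setD1 => /andP[].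
    by rewrite in_setU !mem_nbs1 es -(Kout _ _ sK rD' esr rK) esr.
  - move=> w' w'K; have [s [r [cs rD rK esr]]] := conn_first_exit (cD _ _ (KD _ w'K) vD) w'K vK.
    have sK : s \in K by have := conn_inr cs; rewrite in_setI => /andP[].
    exists s; first by rewrite mem_nbs1 es -(Kout _ _ sK rD esr rK) esr.
    by apply: conn_sub cs => z; rewrite in_setI => /andP[].
  - move=> w' w'K; have [t tb wt] := min_piece_conn es mD vD (KDv _ w'K).
    exists t => //; apply: KK => //.
    case: (conn_stay wt w'K) => [/conn_inr|[s [r [cs rD rK esr]]]].
      by rewrite in_setI => /andP[].
    have sK : s \in K by have := conn_inr cs; rewrite in_setI => /andP[].
    by rewrite (Kcl _ _ sK esr rD) in rK.
  - move=> v' v'K; have [d1 _] := attached_deg G F ax S2 aD (KD _ v'K).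
    move: d1; rewrite (noS _ v'K) addn0 mem_nbs1 => d1.
    have : nb e D1 v' <= nb e K v' + nb e [set v] v'.
      apply: leq_trans (nbU _ _ _ _); apply/subset_leq_card/subsetP=> z zN; move: zN.
      rewrite in_set => /andP[zD ez]; rewrite in_set ez andbT in_setU in_set1.
      by have [//|zK] := boolP (z \in K); rewrite (Kout _ _ v'K zD ez zK) eqxx.
    by rewrite !mem_nbs1 nb1 (es v v'); nlia.
right.
have {}allgood v w : v \in D1 -> w \in D1 :\ v ->
    exists2 t, conn e (D1 :\ v) w t & 0 < nb e S t.
  move=> vD wD; have : good v w.
    apply: contraT => bad; case/negP: allgood.
    by apply/exists_inP; exists v => //; apply/exists_inP; exists w.
  rewrite /good => /existsP[t /andP[]]; rewrite inE => ct St; by exists t.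
have nbS v : nb e S v <= nb e [set x] v + nb e [set a] v by rewrite S2; apply: nbU.
have [l hl] : linked e D1 (nbs e [set x]) (nbs e [set a]) 2.
  apply: (st_links G (col := col)) => //.
  - exact: (piece_card G F pD).
  - exact: st_col G.
  - exact: piece_nonempty pD.
  - by exists (~~ col x) => v; rewrite mem_nbs1 => /(col_nb G).
  - by exists (~~ col a) => v; rewrite mem_nbs1 => /(col_nb G).
  - move=> v w vD wD; have [t ct St] := allgood v w vD wD; exists t => //.
    have := leq_trans St (nbS t); rewrite in_setU !mem_nbs1 !nb1 !(es t).
    by case: (e x t); case: (e a t).
  - by move=> w wD; exists vx; [rewrite mem_nbs1 es|apply: cD].
  - by move=> w wD; exists va; [rewrite mem_nbs1 es|apply: cD].
  (* The edge to [b1] is lost; by [2 < k] the degree left is still greater than 2, as two lengths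
     require. *)
  - move=> _ v vD; have [d1 d2] := attached_deg G F ax S2 aD vD.
    have := nbS v; rewrite -/(nb e D1 v) !mem_nbs1 !nb1 !(es v).
    by move: d1; rewrite mem_nbs1; case: (e b1 v); nlia.
exists (l + 2) => i i2; have [h [t [hX tY ph]]] := hl i i2.
rewrite !mem_nbs1 in hX tY.
have -> : l + 2 + 2 * i = ((l + 2 * i).+1 + 0).+1 by nlia.
apply: (pth_cat (pth_cons hX ph xD) _ (pth0 e (set11 a))).
- by rewrite es.
- move=> z; rewrite in_setU1 in_set1 => /predU1P[->|zD]; first by rewrite eq_sym.
  by apply: contraTneq zD => ->.
- by move=> z; rewrite !in_setU1 => /predU1P[->|->]; rewrite ?eqxx ?orbT.
- by move=> z; rewrite !in_setU1 in_set1 => /eqP->; rewrite eqxx orbT.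
Qed.

(** [D1] provides two lengths from [x] to [a], whence [D] is traversed to [b]. The region without
    both pieces still joins [b] to [c]. *)
Lemma two_pieces b D b1 D1 : attached e x T C c a b D ->
  attached e x T C c a b1 D1 -> D != D1 -> fam e (A :\: ex) x c k.
Proof.
move=> aD aD1 ne; have [mD _ _ _] := aD; have [mD1 _ _ _] := aD1.
have [pD _] := mD; have [pD1 _] := mD1.
have [dis bD1] := min_pieces_apart es cC cin mD mD1 ne.
case: (two_x_a_piece aD1) => // -[beta pre].
have DC := piece_subset pD; have D1C := piece_subset pD1.
have cM : connected e ((C :\: D) :\: D1).
  apply: (connected_del_pendant es (b := b1)).
  - exact: rest_connected pD.
  - by move=> z zD1; rewrite in_setD D1C // andbT; apply/negP=> /dis; rewrite zD1.
  - move=> v w vD; rewrite in_setD => /andP[_ wC] evw.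
    exact: (piece_closed pD1 vD wC evw).
have bM : b \in (C :\: D) :\: D1 by rewrite in_setD bD1 (cut_in_rest pD).
have cM' : c \in (C :\: D) :\: D1.
  by rewrite in_setD (target_in_rest cin pD) andbT; case/pieceP: pD1.
have [gamma suf] := conn_pth (cM _ _ bM cM').
apply: (through_a G F ax S2 aD (B := x |: (a |: D1)) (M := (C :\: D) :\: D1) (o1 := 2) (o2 := 1) (beta := beta) (gamma := gamma)) => //.
- move=> z; rewrite !in_setU1 => /predU1P[->|/predU1P[->|zD1]].
  + by apply: contra xC => /DC.
  + by apply: contra aC => /DC.
  + by apply/negP=> /dis; rewrite zD1.
- move=> z; rewrite !in_setU1 !in_setD => /predU1P[->|/predU1P[->|->//]].
  + by rewrite (negPf xC) !andbF.
  + by rewrite (negPf aC) !andbF.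
- by move=> z zD; rewrite !in_setD zD andbF.
- by move=> z; rewrite !in_setU1 => /predU1P[->//|/predU1P[->//|/D1C/CA']].
- by move=> z /setDP[/setDP[/CA']].
- by move=> [|//] _; rewrite muln0 addn0.
Qed.

End StuckPieces.

(** * The segment beyond the cut vertex of the only end block *)

Section LastPiece.
Variables (V : finType) (col : V -> bool) (e : rel V) (A : {set V}) (x y : V).
Variable k : nat.
Hypothesis G : setting col e A x y k.
Variables (S T C : {set V}) (c : V) (ex : {set V}) (a : V).
Hypothesis F : frame col e A x y S T C c ex.
Hypotheses (ax : a != x) (S2 : S = [set x; a]).
Implicit Types (B D M P K : {set V}) (b u v w : V).

Let es := st_sym G.
Let cC := fr_conn F.
Let cin := fr_c F.
Let xS : x \in S. Proof. exact: fr_x F. Qed.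
Let aS : a \in S. Proof. by rewrite S2 !inE eqxx orbT. Qed.
Let CA' z : z \in C -> z \in A :\: ex.
Proof. by move=> zC; rewrite inE (fr_Cex F zC) (fr_CA F zC). Qed.
Let coreA : {subset S :|: T <= A :\: ex}. Proof. exact: (core_A F). Qed.
Let xT u : u \in T -> x != u.
Proof. by move=> uT; rewrite eq_sym (T_not_x F). Qed.
Let aT u : u \in T -> a != u.
Proof. by move=> uT; apply: contraTneq uT => <-; apply: fr_ST F _ aS. Qed.
Let ext u : u \in T -> e x u. Proof. exact: (fr_com F xS). Qed.
Let eat u : u \in T -> e a u. Proof. exact: (fr_com F aS). Qed.
Let neC z u : z \in S :|: T -> u \in C -> z != u.
Proof. by move=> zH; apply: contraTneq => <-; apply: (core_C F). Qed.
Let xH : x \in S :|: T. Proof. by rewrite in_setU xS. Qed.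
Let aH : a \in S :|: T. Proof. by rewrite in_setU aS. Qed.
Let TH u : u \in T -> u \in S :|: T. Proof. by rewrite in_setU => ->; rewrite orbT. Qed.

Lemma two_T : exists u1 u2, [/\ u1 \in T, u2 \in T & u1 != u2].
Proof.
have : 1 < #|T| by apply: leq_trans (fr_card F); rewrite S2 cards2 eq_sym ax.
by case/card_gt1P=> u1 [u2 [h1 h2 h3]]; exists u1, u2.
Qed.

Hypothesis Trest : forall u w, u \in T -> e u w -> w \in S :|: T :|: C :|: ex.

(** In the frames constructed later, [T] has edges to [ex] only if the target [c] was itself taken
    from the common neighbours of [S]; [fr_ex] records this. *)
Lemma ex_complete u : u \in T -> 0 < nb e ex u -> forall s, s \in S -> e s c.
Proof.
move=> uT; rewrite nb_gt0 => /exists_inP[w wex euw].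
by have [z /(_ u w uT wex euw)[]] := fr_ex F.
Qed.

Lemma ex_le1 u : u \in T -> nb e ex u <= 1.
Proof.
move=> uT; rewrite leqNgt; apply/negP=> /nb_two[w1 [w2 [w1ex w2ex ne e1 e2]]].
have [z hz] := fr_ex F; case/eqP: ne.
by have [-> _] := hz u w1 uT w1ex e1; have [-> _] := hz u w2 uT w2ex e2.
Qed.

Lemma nbT_T u : u \in T -> nb e T u = 0.
Proof.
move=> uT; apply: nb0 => w wT; apply/negP=> /(col_nb G).
by rewrite (T_col G F uT) (T_col G F wT); case: (col x).
Qed.

Lemma three_x_c : (forall s, s \in S -> e s c) ->
  pth e (A :\: ex) x c 1 /\ pth e (A :\: ex) x c 3.
Proof.
move=> com; have [u1 [_ [u1T _ _]]] := two_T; split.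
  exists [:: c]; split=> //; first by rewrite /= com.
    by rewrite /= !inE (neC xH cin).
  by move=> z; rewrite !in_cons in_nil orbF => /orP[]/eqP->; [apply: coreA|apply: CA'].
exists [:: u1; a; c]; split=> //.
- by rewrite /= ext // es eat // com.
- rewrite /= !inE !negb_or (xT u1T) (neC xH cin) (neC (TH u1T) cin) (neC aH cin).
  by rewrite eq_sym ax eq_sym (aT u1T).
- by move=> z; rewrite !in_cons in_nil orbF => /or4P[]/eqP->; [apply: coreA|apply/coreA/TH|apply: coreA|apply: CA'].
Qed.

Lemma T_deg_le D u : (forall w, w \in D -> nb e T w = 0) -> u \in T ->
  k < 2 + nb e (C :\: D) u + nb e ex u.
Proof.
move=> noT uT; have := T_deg G F uT.
have Nu w : e u w -> w \in S :|: (C :\: D) :|: ex :|: T.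
  move=> euw; have := Trest uT euw.
  have wD : w \notin D.
    apply/negP=> /noT/eqP; rewrite -leqn0 leqNgt nb_gt0 => /negP; apply.
    by apply/exists_inP; exists u; rewrite // es.
  by rewrite !in_setU in_setD wD; case: (w \in S); case: (w \in T); case: (w \in C); case: (w \in ex).
rewrite (deg_nb Nu).
have := nbU e (S :|: (C :\: D) :|: ex) T u; have := nbU e (S :|: (C :\: D)) ex u.
have := nbU e S (C :\: D) u; have := nb_le_card e S u.
by rewrite (nbT_T uT) S2 cards2 eq_sym ax; nlia.
Qed.

(** The core alone offers two lengths from [x] to [u], and any path from there to [c] will do. If
    [u] has no neighbour in [C], its degree forces an edge to [ex], and then [c] is complete to
    [S]. *)
Lemma fam_k2 : k = 2 -> fam e (A :\: ex) x c k.
Proof.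
move=> k2; have [u [_ [uT _ _]]] := two_T.
have [/exists_inP[w wC euw]|noC] := boolP [exists w in C, e u w].
  have [L pL] := conn_pth (cC wC cin).
  exists (L + 2) => i; rewrite k2 => i2.
  have -> : L + 2 + 2 * i = ((2 * i).+1 + L).+1 by nlia.
  apply: (pth_cat _ euw pL).
  - apply: (biclique_pth es xS uT (fr_com F) (fr_ST F)).
      by rewrite S2 cards2 eq_sym ax.
    by apply: leq_trans (fr_card F); rewrite S2 cards2 eq_sym ax.
  - by move=> z zH; apply: (core_C F).
  - exact: coreA.
  - by move=> z /CA'.
have com : forall s, s \in S -> e s c.
  have h0 w : w \in set0 -> nb e T w = 0 by rewrite inE.
  have noC' : nb e C u = 0.
    by apply: nb0 => w wC; apply: contra noC => euw; apply/exists_inP; exists w.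
  apply: (ex_complete uT); have := T_deg_le h0 uT; rewrite setD0 noC'; nlia.
exists 1 => i; rewrite k2; have [p1 p3] := three_x_c com.
by case: i => [|[|//]] _.
Qed.

(** A vertex of [T] has at most two neighbours in [S], one in [C :\: D] and one in [ex]; its degree
    forces [k = 3] and all of these edges. Two vertices of [T] then share the neighbour [w], and the
    lengths 1, 3, 5 come from [x, c], from [x, u1, a, c] and from [x, u1, w, u2, a, c]. *)
Lemma endgame D : 2 < k -> (forall w, w \in D -> nb e T w = 0) ->
  {in C :\: D &, forall w1 w2, col w1 = col x -> col w2 = col x -> w1 = w2} ->
  {in C :\: D, forall w, col w = col x -> col c != col x -> e w c} ->
  fam e (A :\: ex) x c k.
Proof.
move=> k3 noT uniqM toc.
have whiteN u w : u \in T -> e u w -> col w = col x.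
  by move=> uT /(col_nb G)->; rewrite (T_col G F uT) negbK.
have M1 u : u \in T -> nb e (C :\: D) u <= 1.
  move=> uT; rewrite leqNgt; apply/negP=> /nb_two[w1 [w2 [h1 h2 ne e1 e2]]].
  by case/eqP: ne; apply: uniqM => //; apply: whiteN uT _.
have [u1 [u2 [u1T u2T u12]]] := two_T.
have com : forall s, s \in S -> e s c.
  apply: (ex_complete u1T); have := T_deg_le noT u1T; have := M1 u1 u1T; nlia.
have cb : col c != col x by rewrite eq_sym; apply: (st_col G); apply: com.
have k4 : k = 3.
  have := T_deg_le noT u1T; have := M1 u1 u1T; have := ex_le1 u1T; nlia.
have getw u : u \in T -> exists2 w, w \in C :\: D & e u w.
  move=> uT; have : 0 < nb e (C :\: D) u.
    have := T_deg_le noT uT; have := ex_le1 uT; nlia.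
  by rewrite nb_gt0 => /exists_inP[w wM euw]; exists w.
have [w wM e1] := getw u1 u1T; have [w2 w2M e2] := getw u2 u2T.
have ww : w2 = w by apply: uniqM => //; [apply: whiteN e2|apply: whiteN e1].
rewrite {w2 w2M}ww in e2.
have ewc := toc w wM (whiteN _ _ u1T e1) cb.
have wC : w \in C by move: wM; rewrite in_setD => /andP[].
have [p1 p3] := three_x_c com.
exists 1 => i; rewrite k4; case: i => [|[|[|//]]] _ //.
exists [:: u1; w; u2; a; c]; split=> //.
- by rewrite /= ext // e1 es e2 es eat // com.
- have wc : w != c by apply: contraTneq ewc => ->; apply/negP=> /(st_col G); rewrite eqxx.
  rewrite /= !inE !negb_or (xT u1T) (neC xH wC) (xT u2T) (neC xH cin) (eq_sym x a) ax.
  rewrite (neC (TH u1T) wC) u12 (eq_sym u1 a) (aT u1T) (neC (TH u1T) cin).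
  rewrite (eq_sym w u2) (neC (TH u2T) wC) (eq_sym w a) (neC aH wC) wc.
  by rewrite (eq_sym u2 a) (aT u2T) (neC (TH u2T) cin) (neC aH cin).
- by move=> z; rewrite !in_cons in_nil orbF => /orP[/eqP->|/orP[/eqP->|/or4P[]/eqP->]]; [apply: coreA|apply/coreA/TH|apply: CA'|apply/coreA/TH|apply: coreA|apply: CA'].
Qed.

Lemma last_piece b D : 2 < k -> attached e x T C c a b D ->
  (forall b' D', piece e C c b' D' -> D \subset D') -> fam e (A :\: ex) x c k.
Proof.
move=> k3 aD all; have [mD noT _ _] := aD; have [pD _] := mD.
set M := C :\: D.
have bM : b \in M := cut_in_rest pD.
have cM : c \in M := target_in_rest cin pD.
have conM : connected e M := rest_connected es cC pD.
have MC z : z \in M -> z \in C by rewrite in_setD => /andP[].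
have MD z : z \in M -> z \notin D by rewrite in_setD => /andP[].
have /set0Pn[d dD] := piece_nonempty pD.
have dC := piece_subset pD dD.
have fromD v w : v \in M -> e v w -> w \in D -> v = b.
  move=> vM evw wD; have ewv : e w v by rewrite es.
  case: (piece_closed pD wD (MC _ vM) ewv) => // vD.
  by have := MD _ vM; rewrite vD.
have xM : x \notin M by apply/negP=> /MC; apply/negP/(fr_SC F).
(* A component of [C :\ v] missing [c] is a piece, hence contains [D], and a walk from [M] enters
   [D] only from [b]. *)
have reach v w : v \in M -> w \in M -> w != v ->
    conn e (M :\ v) w b \/ conn e (M :\ v) w c.
  move=> vM wM wv; have wCv : w \in C :\ v by rewrite in_setD1 wv MC.
  have sub : {subset (C :\ v) :&: M <= M :\ v}.
    by move=> z; rewrite in_setI !in_setD1 => /andP[/andP[-> _] ->].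
  have out s r : conn e ((C :\ v) :&: M) w s -> r \in C :\ v -> r \notin M -> e s r ->
      conn e (M :\ v) w b \/ conn e (M :\ v) w c.
    move=> cs rC rM esr; left; have := conn_inr cs; rewrite in_setI => /andP[_ sM].
    have rD : r \in D.
      by move: rC rM; rewrite in_setD1 !in_setD negb_and negbK => /andP[_ ->]; rewrite orbF.
    by rewrite -(fromD _ _ sM esr rD); apply: conn_sub cs.
  have [wc|nc] := boolP (conn e (C :\ v) w c).
    case: (conn_stay wc wM) => [/(conn_sub sub)|[s [r [cs rC rM esr]]]]; first by right.
    exact: out cs rC rM esr.
  have pK : piece e C c v (comp e (C :\ v) w).
    by apply: piece_comp => //; [apply: MC|rewrite inE].
  have := subsetP (all _ _ pK) _ dD; rewrite inE => wd.
  have dM : d \notin M by rewrite in_setD dD.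
  have [s [r [cs rC rM esr]]] := conn_first_exit wd wM dM.
  exact: out cs rC rM esr.
have ebc_nb v w : v \in M -> v != b -> v != c -> e v w -> w \in M :|: S :|: T.
  move=> vM vb vc evw; have := fr_nb F (MC _ vM) vc evw.
  rewrite !in_setU in_setD; case: (boolP (w \in D)) => [wD|//].
  by rewrite (fromD _ _ vM evw wD) eqxx in vb.
have Mdeg v : v \in M -> v != b -> v != c -> k < nb e M v + nb e S v + nb e T v.
  move=> vM vb vc; have := C_deg G F (MC _ vM) vc.
  rewrite (deg_nb (fun w => ebc_nb v w vM vb vc)).
  by have := nbU e (M :|: S) T v; have := nbU e M S v; nlia.
have S1 v : v \in M -> v != c -> nb e S v <= 1.
  move=> vM vc; have := fr_nbS F (MC _ vM) vc.
  by rewrite [in X in _ < X -> _]S2 cards2 eq_sym ax.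
have [bc|bc] := eqVneq b c.
  have M1 w : w \in M -> w = c.
    move=> wM; apply/eqP/negPn/negP=> wc.
    by case: (reach c w cM wM wc) => /conn_inr; rewrite in_setD1 ?bc eqxx.
  apply: (endgame k3 noT) => [w1 w2 /M1-> /M1-> //|w /M1-> ->].
  by rewrite eqxx.
have MA' z : z \in M -> z \in A :\: ex by move/MC/CA'.
(* A vertex with two neighbours in [T] that can be avoided between [b] and [c] is used for a longer
   way from [x] to [a]. *)
have [/existsP[v /andP[/and4P[vM vb vc vT] vcon]]|nobypass] :=
    boolP [exists v, [&& v \in M, v != b, v != c & 1 < nb e T v] && conn e (M :\ v) b c].
  have [gamma suf] := conn_pth vcon.
  have vH : v \notin S :|: T by apply/negP=> /(core_C F); rewrite MC.
  apply: (through_a G F ax S2 aD (B := v |: (S :|: T)) (M := M :\ v) (o1 := 2) (o2 := 1) (beta := 2) (gamma := gamma)) => //.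
  - move=> z; rewrite in_setU1 => /predU1P[->|/(core_C F)]; first exact: MD.
    by apply: contra => /(piece_subset pD).
  - move=> z; rewrite in_setU1 in_setD1 => /predU1P[->|/(core_C F) zC]; first by rewrite eqxx.
    by rewrite negb_and; apply/orP; right; apply: contra zC => /MC.
  - by move=> z zD; rewrite in_setD1 in_setD zD andbF.
  - by move=> z; rewrite in_setU1 => /predU1P[->|/coreA //]; apply: MA'.
  - by move=> z; rewrite in_setD1 => /andP[_ /MA'].
  - move=> [|[|//]] _.
      apply: pth_sub (short_x_a G F ax S2) => z zH; by rewrite in_setU1 zH orbT.
    exact: (long_x_a G F ax S2).
  - by move=> [|//] _; rewrite muln0 addn0.
have cardM : #|M| < #|A|.
  apply/proper_card/properP; split; first by apply/subsetP=> z /MC/(fr_CA F).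
  by exists x => //; apply: st_x G.
have rM : rooted e M b c.
  move=> v w; rewrite in_setD1 => /andP[wv wM].
  have [vM|vM] := boolP (v \in M).
    by case: (reach v w vM wM wv) => ->; rewrite ?orbT.
  rewrite (conn_sub _ (conM _ _ wM bM)) // => z zM.
  by rewrite in_setD1 zM andbT; apply: contraNneq vM => <-.
(* Only a vertex with several neighbours in [T] can have low degree in [M]. It has the colour of
   [x], and by [nobypass] it separates [b] from [c], which is the alternative that [seg] allows. *)
have [] := seg G (w0 := col x) cardM bM cM bc rM.
- move=> v vM vb vc; have := Mdeg v vM vb vc.
  have [vT|vT] := leqP (nb e T v) 1.
    have := S1 v vM vc; case: (S_or_T G F v) => ->; left; nlia.
  right; split.
    move: (ltnW vT); rewrite nb_gt0 => /exists_inP[t tT evt].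
    have etv : e t v by rewrite es.
    by rewrite (col_nb G etv) (T_col G F tT) negbK.
  apply: contra nobypass => vcon; apply/existsP; exists v.
  by rewrite vM vb vc vT.
- case=> gamma suf.
  apply: (through_a G F ax S2 aD (B := S :|: T) (M := M) (o1 := 1) (o2 := 2) (beta := 2) (gamma := gamma)) => //.
  - by move=> z /(core_C F); apply: contra => /(piece_subset pD).
  - by move=> z /(core_C F); apply: contra => /MC.
  - by move=> z zD; rewrite in_setD zD.
  - by move=> [|//] _; apply: (short_x_a G F ax S2).
(* At most one vertex besides [b] and [c] remains, and adjacency leaves at most one vertex of the
   colour of [x] in [M], as [endgame] demands. *)
case=> M3 inner.
have third v w : v \in M -> v != b -> v != c -> w \in M -> [|| w == b, w == c | w == v].
  move=> vM vb vc wM; apply: contraT; rewrite !negb_or => /and3P[wb wc wv].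
  move: M3; rewrite (cardsD1 b) bM (cardsD1 c) (cardsD1 v) (cardsD1 w).
  by rewrite !in_setD1 (eq_sym c) bc cM vb vc vM wb wc wv wM.
have inner_adj v : v \in M -> v != b -> v != c -> e v b /\ e v c.
  move=> vM vb vc.
  have adj z z' : z \in M -> z != z' -> v != z' -> v != z ->
     (forall w, w \in M -> [|| w == z, w == z' | w == v]) ->
     conn e (M :\ z') v z -> e v z.
    move=> zM zz' vz' vz al cz.
    have zv : z \notin [set v] by rewrite in_set1 eq_sym.
    have [s [r [cs rD rK esr]]] := conn_first_exit cz (set11 v) zv.
    have := conn_inr cs; rewrite in_setI in_set1 => /andP[_ /eqP sv].
    move: rD rK; rewrite in_setD1 in_set1 => /andP[rz' rM'] rv.
    have := al r rM'; rewrite (negPf rz') (negPf rv) orbF orbF => /eqP rz.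
    by rewrite -sv -rz.
  split; [apply: (adj b c) => //|apply: (adj c b) => //].
  - by move=> w; apply: third.
  - by case: (reach c v cM vM vc) => // /conn_inr; rewrite in_setD1 eqxx.
  - by rewrite eq_sym.
  - by move=> w wM; have := third v w vM vb vc wM; case: (w == b); case: (w == c).
  - by case: (reach b v bM vM vb) => // /conn_inr; rewrite in_setD1 eqxx.
have ebc : (forall v, v \in M -> (v == b) || (v == c)) -> e b c.
  move=> only; have cb : c \notin [set b] by rewrite in_set1 eq_sym.
  have [s [r [cs rM' rb esr]]] := conn_first_exit (conM _ _ bM cM) (set11 b) cb.
  have := conn_inr cs; rewrite in_setI in_set1 => /andP[_ /eqP sb].
  have := only r rM'; move: rb; rewrite in_set1 => /negPf-> /= /eqP rc.
  by rewrite -sb -rc.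
have colne u v : e u v -> col u = col x -> col v = col x -> False.
  by move=> /(st_col G) h e1 e2; rewrite e1 e2 eqxx in h.
have noinner : (exists v, [/\ v \in M, v != b & v != c]) \/
    (forall v, v \in M -> (v == b) || (v == c)).
  have [/existsP[v /and3P[? ? ?]]|no] := boolP [exists v, [&& v \in M, v != b & v != c]].
    by left; exists v.
  right=> v vM; apply: contraNT no; rewrite negb_or => /andP[vb vc].
  by apply/existsP; exists v; rewrite vM vb vc.
case: noinner => [[v [vM vb vc]]|only].
  have [evb evc] := inner_adj v vM vb vc; have cv := inner v vM vb vc.
  have only w : w \in M -> col w = col x -> w = v.
    move=> wM cw; have := third v w vM vb vc wM => /or3P[]/eqP wE //; subst w.
      by case: (colne _ _ evb).
    by case: (colne _ _ evc).
  apply: (endgame k3 noT) => [w1 w2 m1 m2 c1 c2|w wM cw _].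
    by rewrite (only w1) // (only w2).
  by rewrite (only w).
have e_bc := ebc only.
apply: (endgame k3 noT) => [w1 w2 m1 m2 c1 c2|w wM cw ccx].
  move: c1 c2; case/orP: (only w1 m1) => /eqP->; case/orP: (only w2 m2) => /eqP-> // c1 c2.
    by case: (colne _ _ e_bc).
  by case: (colne _ _ e_bc).
move: cw; case/orP: (only w wM) => /eqP-> // cw.
by rewrite cw eqxx in ccx.
Qed.

End LastPiece.

Theorem frame_fam (V : finType) (col : V -> bool) (e : rel V) (A : {set V}) x y k
    (S T C : {set V}) c ex :
  setting col e A x y k -> frame col e A x y S T C c ex ->
  fam e (A :\: ex) x c k.
Proof.
move=> G F; have es := st_sym G; have cin := fr_c F; have cC := fr_conn F.
have [w wC wc] := fr_ne F.
have p0 : piece e C c c (comp e (C :\ c) w).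
  apply: piece_comp => //; first by rewrite in_setD1 wc.
  by apply/negP=> /comp_subset; rewrite in_setD1 eqxx.
have [b [D [mD _]]] := exists_min_piece p0.
have [//|[S2' noT [v1 v1D ev1] [v2 [a [v2D aS ax ev2]]]]] := solve_or_stuck G F mD.
have S2 : S = [set x; a].
  apply/esym/eqP; rewrite eqEcard S2' cards2 eq_sym ax andbT.
  by apply/subsetP=> z; rewrite !inE => /orP[]/eqP->; rewrite ?(fr_x F).
have att b' D' : min_piece e C c b' D' ->
    fam e (A :\: ex) x c k \/ attached e x T C c a b' D'.
  move=> m'; case: (solve_or_stuck G F m'); [by left|right].
  case: b0 => _ n' h1 [v [a' [vD' a'S a'x eva']]]; split=> //.
  exists v => //; move: a'S; rewrite S2 !inE (negPf a'x) => /eqP<- //.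
case: (att _ _ mD) => // aD; have [pD _] := mD.
have [/existsP[u /existsP[z /and3P[uT zR euz]]]|noR] :=
    boolP [exists u, exists z, [&& u \in T, z \in A :\: (S :|: T :|: C :|: ex) & e u z]].
  have [beta pre] := two_x_a_rest G F ax S2 uT zR euz.
  have [gamma suf] := conn_pth (rest_connected es cC pD (cut_in_rest pD) (target_in_rest cin pD)).
  have BC t : t \in S :|: T :|: (A :\: (S :|: T :|: C :|: ex)) -> t \notin C.
    rewrite in_setU => /orP[/(core_C F)//|]; rewrite in_setD !in_setU => /andP[].
    by case: (t \in C); rewrite ?orbT.
  apply: (through_a G F ax S2 aD (o1 := 2) (o2 := 1) _ _ _ _ _ _ _ _ pre (gamma := gamma) (M := C :\: D)) => //.
  - by move=> t /BC; apply: contra => /(piece_subset pD).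
  - by move=> t /BC; apply: contra => /setDP[].
  - by move=> t tD; rewrite in_setD tD.
  - move=> t; rewrite in_setU => /orP[/(core_A F)//|].
    by rewrite !in_setD !in_setU !negb_or => /andP[/andP[_ ->] ->].
  - by move=> t /setDP[tC _]; apply: (frame_A F); rewrite in_setU tC orbT.
  - by move=> [|//] _; rewrite muln0 addn0.
have Trest u z : u \in T -> e u z -> z \in S :|: T :|: C :|: ex.
  move=> uT euz; apply: contraNT noR => zn; apply/existsP; exists u; apply/existsP; exists z.
  by rewrite uT euz in_setD zn (eAr G euz).
(* The case [k = 2] is separated because both a second end block and the segment beyond the cut
   vertex need a spare degree. *)
have [k2|k3] := leqP k 2.
  by apply: (fam_k2 G F ax S2 Trest); have := st_k G; nlia.
have [/existsP[b1 /existsP[D1 /andP[p1 nD]]]|no] :=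
    boolP [exists b1 : V, exists D1 : {set V}, piece e C c b1 D1 && ~~ (D \subset D1)].
  have [b2 [D2 [m2 s2]]] := exists_min_piece p1.
  case: (att _ _ m2) => // a2.
  apply: (two_pieces G F ax S2 k3 aD a2).
  by apply: contraNneq nD => ->.
apply: (last_piece G F ax S2 Trest k3 aD) => b' D' p'.
apply: contraNT no => nD; apply/existsP; exists b'; apply/existsP; exists D'.
by rewrite p' nD.
Qed.

(** * The choice of the core *)

Section Step.
Variables (V : finType) (col : V -> bool) (e : rel V) (A : {set V}) (x y : V).
Variable k : nat.
Hypothesis G : setting col e A x y k.
Hypothesis inner : exists w, [/\ w \in A, w != x & w != y].
Implicit Types (C D S T ex : {set V}) (a c s t u v w : V).

Let es := st_sym G.
Let xA := st_x G.
Let yA := st_y G.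
Let xy := st_xy G.
Let nxy := st_nxy G.
Let colN u v : e u v -> col v = ~~ col u. Proof. exact: (col_nb G). Qed.

(** The neighbour [w] ensures that the component of [c] has a second vertex and therefore contains a
    piece. *)
Lemma component_frame S T ex c w :
  x \in S -> {subset S <= A :\ y} -> {subset T <= A :\ y} ->
  (forall s, s \in S -> col s = col x) -> {in S & T, forall s t, e s t} ->
  #|S| <= #|T| -> c \in A -> c \notin S :|: T :|: ex ->
  (forall z, z \in ex -> z \notin S :|: T) ->
  e c w -> w \notin S :|: T :|: ex -> (y == c) || (y \in ex) ->
  (forall v z, v \in A -> v \notin S :|: T :|: ex -> v != c -> z \in ex -> ~~ e v z) ->
  (forall v, v \in A -> v \notin S :|: T :|: ex -> v != c ->
     nb e T v <= #|S| /\ nb e S v < #|S|) ->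
  (exists z, forall u w, u \in T -> w \in ex -> e u w ->
     w = z /\ (forall s, s \in S -> e s c)) ->
  frame col e A x y S T (comp e (A :\: (S :|: T :|: ex)) c) c ex.
Proof.
move=> xS SA TA Sw com card cA cn exn ecw wn hy noex hnb hex.
set R := A :\: (S :|: T :|: ex).
have cR : c \in R by rewrite in_setD cn.
have wR : w \in R by rewrite in_setD wn (eAr G ecw).
have CR z : z \in comp e R c -> z \in R by apply: comp_subset.
have Cn z : z \in comp e R c -> z \in A /\ z \notin S :|: T :|: ex.
  by move/CR; rewrite in_setD => /andP[].
have ST z : z \in S -> z \notin T.
  move=> zS; apply/negP=> zT; have := colN (com _ _ xS zT).
  by rewrite (Sw _ zS); case: (col x).
split=> //.
- by move=> z /SA; rewrite in_setD1 => /andP[].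
- by move=> z /TA; rewrite in_setD1 => /andP[].
- by move=> z /Cn[].
- by move=> z zS; apply/negP=> /Cn[_]; rewrite !in_setU zS.
- by move=> z zT; apply/negP=> /Cn[_]; rewrite !in_setU zT orbT.
- by move=> z zS; apply/negP=> /exn; rewrite in_setU zS.
- by move=> z zT; apply/negP=> /exn; rewrite in_setU zT orbT.
- by move=> z /Cn[_]; rewrite in_setU => /norP[].
- exact: comp_connected.
- exact: comp_self.
- exists w; first by apply: comp_closed (comp_self _ cR) ecw wR.
  by apply: contraTneq ecw => ->; apply/negP=> /colN; case: (col c).
- move=> v z vC vc evz; have [vA vn] := Cn _ vC.
  have zA := eAr G evz.
  have [zn|zn] := boolP (z \in S :|: T :|: ex); last first.
    have zC : z \in comp e R c by apply: comp_closed vC evz _; rewrite in_setD zn.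
    by rewrite !(in_setU z) zC.
  move: zn; rewrite (in_setU z (S :|: T)) => /orP[|zex].
    by rewrite !(in_setU z) => /orP[]->; rewrite ?orbT.
  by have := noex v z vA vn vc zex; rewrite evz.
- by move=> v vC vc; have [vA vn] := Cn _ vC; case: (hnb v vA vn vc).
- by move=> v vC vc; have [vA vn] := Cn _ vC; case: (hnb v vA vn vc).
- move=> v z vA vn evz; apply/negP; rewrite in_setU => /orP[zC|zex].
    have vR : v \in R.
      by move: vn; rewrite in_setD vA andbT !(in_setU v); case: (v \in S); case: (v \in T); case: (v \in ex); rewrite ?orbT.
    have ezv : e z v by rewrite es.
    by move: vn; rewrite !(in_setU v) (comp_closed zC ezv vR) ?orbT.
  have vn' : v \notin S :|: T :|: ex.
    by move: vn; rewrite !(in_setU v); case: (v \in S); case: (v \in T); case: (v \in ex); rewrite ?orbT.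
  have vc : v != c.
    apply: contraNneq vn => ->; by rewrite !(in_setU c) comp_self ?orbT.
  by have := noex v z vA vn' vc zex; rewrite evz.
- move=> v vA vn.
  have vn' : v \notin S :|: T :|: ex.
    by move: vn; rewrite !(in_setU v); case: (v \in S); case: (v \in T); case: (v \in ex); rewrite ?orbT.
  have vc : v != c.
    apply: contraNneq vn => ->; by rewrite !(in_setU c) comp_self ?orbT.
  by case: (hnb v vA vn' vc).
Qed.

(** For given [S] this is the largest possible [T]. The root [y] is excluded so that the core never
    passes through it. *)
Definition cm S := [set w in A :\ y | [forall s in S, e s w]].

Definition precore S :=
  [/\ x \in S, {subset S <= A :\ y} & forall s, s \in S -> col s = col x].

Definition core S := precore S /\ #|S| <= #|cm S|.

Lemma cm_adj S s t : s \in S -> t \in cm S -> e s t.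
Proof. by move=> sS; rewrite inE => /andP[_ /forall_inP]; apply. Qed.

Lemma cm_sub S : {subset cm S <= A :\ y}.
Proof. by move=> z; rewrite inE => /andP[]. Qed.

Lemma cm_anti S S' : {subset S <= S'} -> {subset cm S' <= cm S}.
Proof.
move=> sub z; rewrite !inE => /andP[-> /forall_inP h] /=.
by apply/forall_inP=> s /sub; apply: h.
Qed.

Lemma cm_col S t : precore S -> t \in cm S -> col t = ~~ col x.
Proof. by case=> xS _ _ tT; apply/colN/(cm_adj xS tT). Qed.

Lemma precore_cm S z : precore S -> z \in S -> z \notin cm S.
Proof.
move=> pS zS; apply/negP=> /(cm_col pS); have [_ _ ->//] := pS.
by case: (col x).
Qed.

Lemma nb_core_lt S v : v \in A -> v != y -> v \notin cm S -> nb e S v < #|S|.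
Proof.
move=> vA vy vcm; rewrite ltn_neqAle nb_le_card andbT.
apply: contra vcm => /eqP full; rewrite !inE vy vA /=.
by apply/forall_inP=> s sS; rewrite es; apply: nb_full full sS.
Qed.

(** Adding [v] to [S] leaves more than [#|S|] common neighbours, enough for a core with one more
    vertex. Contraposed, this bounds the neighbours in [T] of a vertex outside a maximal core. *)
Lemma core_ext S T v : precore S -> {subset T <= cm S} -> v \in A -> v != y ->
  v \notin S -> #|S| < nb e T v ->
  core (v |: S) /\ {subset [set t in T | e v t] <= cm (v |: S)}.
Proof.
move=> pS TS vA vy vS lt; have [xS SA Sw] := pS.
have sub : {subset [set t in T | e v t] <= cm (v |: S)}.
  move=> t; rewrite in_set => /andP[tT evt]; rewrite in_set (cm_sub (TS _ tT)) /=.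
  by apply/forall_inP=> s; rewrite in_setU1 => /predU1P[->//|sS]; apply: cm_adj sS (TS _ tT).
split=> //; split; last first.
  by rewrite cardsU1 vS; apply: leq_trans lt _; apply/subset_leq_card/subsetP.
split.
- by rewrite in_setU1 xS orbT.
- by move=> z; rewrite in_setU1 => /predU1P[->|/SA//]; rewrite in_setD1 vy vA.
- move=> s; rewrite in_setU1 => /predU1P[->|/Sw//].
  have : 0 < nb e T v by apply: leq_ltn_trans lt.
  rewrite nb_gt0 => /exists_inP[t tT evt]; have etv : e t v by rewrite es.
  by rewrite (colN etv) (cm_col pS (TS _ tT)) negbK.
Qed.

Lemma fam_append ex c q L : fam e (A :\: ex) x c k -> {subset ex <= A} ->
  e c q -> pth e ex q y L -> fam e A x y k.
Proof.
move=> [l h] exA ecq pq; exists (l + L + 1) => i ik.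
have -> : l + L + 1 + 2 * i = ((l + 2 * i) + L).+1 by nlia.
apply: (pth_cat (h i ik) ecq pq) => //.
  by move=> z /setDP[].
by move=> z /setDP[].
Qed.

Lemma x_neighbour : exists2 w, w \in A :\ y & e x w.
Proof.
have [w [wA wx wy]] := inner.
have wAy : w \in A :\ y by rewrite in_setD1 wy.
have wx' : conn e (A :\ y) w x.
  by case/orP: (st_R G wAy) => // /conn_inr; rewrite in_setD1 eqxx.
have wn : w \notin [set x] by rewrite in_set1.
have [s [r [cs rA _ esr]]] := conn_first_exit (conn_sym es wx') (set11 x) wn.
have := conn_inr cs; rewrite in_setI in_set1 => /andP[_ /eqP sx].
by exists r; rewrite // -sx.
Qed.

Lemma y_neighbour : exists w, e y w.
Proof.
have [w [wA wx wy]] := inner.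
have wAx : w \in A :\ x by rewrite in_setD1 wx.
have wy' : conn e (A :\ x) w y.
  by case/orP: (st_R G wAx) => // /conn_inr; rewrite in_setD1 eqxx.
have wn : w \notin [set y] by rewrite in_set1.
have [s [r [cs rA _ esr]]] := conn_first_exit (conn_sym es wy') (set11 y) wn.
have := conn_inr cs; rewrite in_setI in_set1 => /andP[_ /eqP sy].
by exists r; rewrite -sy.
Qed.

(** The root [y] is itself the target, its region contains [w], and no final segment is reserved. *)
Lemma open_core S w : core S -> (forall S', core S' -> #|S'| <= #|S|) ->
  e y w -> w \notin S :|: cm S -> fam e A x y k.
Proof.
move=> cS maxS eyw wn; have [pS cardS] := cS; have [xS SA Sw] := pS.
have yS : y \notin S by apply/negP=> /SA; rewrite in_setD1 eqxx.
have yT : y \notin cm S by apply/negP=> /cm_sub; rewrite in_setD1 eqxx.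
have F : frame col e A x y S (cm S) (comp e (A :\: (S :|: cm S :|: set0)) y) y set0.
  apply: (@component_frame _ _ _ _ w) => //; rewrite ?setU0 //.
  - exact: cm_sub.
  - by move=> s t; apply: cm_adj.
  - by rewrite in_setU (negPf yS).
  - by move=> z; rewrite in_set0.
  - by rewrite eqxx.
  - by move=> v z _ _ _; rewrite in_set0.
  - move=> v vA; rewrite in_setU => /norP[vS vT] vy; split; last exact: nb_core_lt.
    rewrite leqNgt; apply/negP=> lt.
    have [cS' _] := core_ext pS (fun z h => h) vA vy vS lt.
    by have := maxS _ cS'; rewrite cardsU1 vS; nlia.
  - by exists y => u z _; rewrite in_set0.
by have := frame_fam G F; rewrite setD0.
Qed.

End Step.

(** * All neighbours of [y] in the core *)

Section Closed.
Variables (V : finType) (col : V -> bool) (e : rel V) (A : {set V}) (x y : V).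
Variable k : nat.
Hypothesis G : setting col e A x y k.
Implicit Types (C D S T ex : {set V}) (a c s t u v w : V).

Notation core := (core col e A x y).
Notation cm := (cm e A y).

Variable S : {set V}.
Hypothesis cS : core S.
(** Required of all cores of the same size, since the exchange arguments replace a vertex of [S]. *)
Hypothesis good : forall S', core S' -> #|S'| = #|S| ->
  forall w, e y w -> w \in S' :|: cm S'.
Hypothesis maxS : forall S', core S' -> #|S'| <= #|S|.

Let es := st_sym G.
Let nxy := st_nxy G.
Let pS := cS.1.
Let xS : x \in S. Proof. by case: pS. Qed.
Let SA : {subset S <= A :\ y}. Proof. by case: pS. Qed.
Let Sw s : s \in S -> col s = col x. Proof. by case: pS => _ _; apply. Qed.
Let colN u v : e u v -> col v = ~~ col u. Proof. exact: (col_nb G). Qed.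
Let Tb t : t \in cm S -> col t = ~~ col x. Proof. exact: (cm_col G pS). Qed.
Let ST z : z \in S -> z \notin cm S. Proof. exact: (precore_cm G pS). Qed.
Let yS : y \notin S. Proof. by apply/negP=> /SA; rewrite in_setD1 eqxx. Qed.
Let yT : y \notin cm S. Proof. by apply/negP=> /cm_sub; rewrite in_setD1 eqxx. Qed.
Let y_near w : e y w -> w \in S :|: cm S. Proof. exact: good. Qed.
Let com : {in S & cm S, forall s t, e s t}.
Proof. by move=> s t; apply: cm_adj. Qed.

Let SAA z : z \in S -> z \in A. Proof. by move/SA; rewrite in_setD1 => /andP[]. Qed.
Let TAA z : z \in cm S -> z \in A.
Proof. by move/cm_sub; rewrite in_setD1 => /andP[]. Qed.
Let nyT z : z \in cm S -> z != y. Proof. by apply: contraTneq => ->. Qed.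
Let nyS z : z \in S -> z != y. Proof. by apply: contraTneq => ->. Qed.

Lemma end_at_y c : fam e (A :\: [set y]) x c k -> e c y -> fam e A x y k.
Proof.
move=> f ecy; apply: (fam_append f _ ecy (pth0 e (set11 y))).
by move=> z; rewrite in_set1 => /eqP->; apply: st_y G.
Qed.

Section Minus.
Variable a : V.
Hypotheses (aS : a \in S) (ax : a != x).

Let S1 := S :\ a.

Lemma minus_pre : precore col A x y S1.
Proof.
split.
- by rewrite in_setD1 eq_sym ax.
- by move=> z /setD1P[_ /SA].
- by move=> z /setD1P[_ /Sw].
Qed.

Lemma minus_card : #|S| = #|S1|.+1.
Proof. by rewrite (cardsD1 a) aS. Qed.

Lemma minus_cm : {subset cm S <= cm S1}.
Proof. by apply: cm_anti => z; rewrite in_setD1 => /andP[]. Qed.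

Lemma minus_sub z : z \in S1 -> z \in S.
Proof. by rewrite in_setD1 => /andP[]. Qed.

(* Otherwise exchanging a for v gives a large core that loses q. *)
Lemma minus_nb T v q : {subset T <= cm S1} -> v \in A -> v != y -> v \notin S1 ->
  e y q -> q \notin v |: S1 -> q \notin cm (v |: S1) -> nb e T v <= #|S1|.
Proof.
move=> TS vA vy vS1 eyq q1 q2; rewrite leqNgt; apply/negP=> lt.
have [cS' _] := core_ext G minus_pre TS vA vy vS1 lt.
have cardS' : #|v |: S1| = #|S| by rewrite cardsU1 vS1 minus_card.
by have := good cS' cardS' eyq; rewrite in_setU (negPf q1) (negPf q2).
Qed.

Lemma minus_nbS v : v \in A -> v != y -> v \notin cm S1 -> nb e S1 v < #|S1|.
Proof. exact: (nb_core_lt G). Qed.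

End Minus.

Section BlackNeighbour.
Variable u : V.
Hypotheses (euy : e u y) (uT : u \in cm S).

Let eyu : e y u. Proof. by rewrite es. Qed.
Let ycol : col y = col x. Proof. by rewrite (colN euy) (Tb uT) negbK. Qed.

Lemma y_in_T w : e y w -> w \in cm S.
Proof.
move=> eyw; have := y_near eyw; rewrite in_setU => /orP[wS|//].
by have := colN eyw; rewrite (Sw wS) ycol; case: (col x).
Qed.

Lemma direct_black : k <= #|S| -> fam e A x y k.
Proof.
move=> kS; exists 2 => i ik.
have -> : 2 + 2 * i = ((2 * i).+1 + 0).+1 by nlia.
have iS : i < #|S| by nlia.
apply: (pth_cat (biclique_pth es xS uT com ST iS (leq_trans iS cS.2)) euy (pth0 e (set11 y))).
- move=> z; rewrite in_setU in_set1 => /orP[]; [exact: nyS|exact: nyT].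
- by move=> z; rewrite in_setU => /orP[]; [apply: SAA|apply: TAA].
- by move=> z; rewrite in_set1 => /eqP->; apply: st_y G.
Qed.

Lemma u_degree : k < #|[set w | e u w]|.
Proof.
apply: (st_deg G); [exact: TAA|by apply: contraTneq uT => ->; apply: ST|exact: nyT].
Qed.

(** A strictly larger [T] can spare [u], which becomes the target, followed by the edge to [y]. Its
    degree exceeds [#|S| + 1], so it has a neighbour outside [S] and [y] to start the region. *)
Lemma big_T : #|S| < #|cm S| -> #|S| < k -> fam e A x y k.
Proof.
move=> tS kS; set T0 := cm S :\ u.
have T0S z : z \in T0 -> z \in cm S by rewrite in_setD1 => /andP[].
have uS : u \notin S by apply/negP=> /ST; rewrite uT.
have [w euw wn] : exists2 w, e u w & w \notin S :|: [set y].
  have [/existsP[w /andP[euw wn]]|no] := boolP [exists w, e u w && (w \notin S :|: [set y])].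
    by exists w.
  have := u_degree; rewrite (@deg_nb _ _ (S :|: [set y])).
    have := nbU e S [set y] u; have := nb_le_card e S u; rewrite nb1 euy; nlia.
  move=> w euw; apply: contraNT no => wn; apply/existsP; exists w; by rewrite euw.
have F : frame col e A x y S T0 (comp e (A :\: (S :|: T0 :|: [set y])) u) u [set y].
  apply: (@component_frame _ _ _ _ _ _ _ G _ _ _ _ w) => //.
  - by move=> z /T0S /cm_sub.
  - by move=> s t sS /T0S; apply: com.
  - by rewrite /T0; move: tS; rewrite (cardsD1 u (cm S)) uT.
  - exact: TAA.
  - by rewrite !in_setU in_set1 (negPf uS) in_setD1 eqxx (negPf (nyT uT)).
  - move=> z; rewrite in_set1 => /eqP->; rewrite in_setU negb_or yS /=.
    by apply/negP=> /T0S; apply/negP.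
  - move: wn; rewrite !in_setU => /norP[/negPf-> /negPf->]; rewrite orbF /=.
    apply/negP=> /T0S /Tb; have := colN euw; rewrite (Tb uT) => ->.
    by case: (col x).
  - by rewrite in_set1 eqxx orbT.
  - move=> v z vA vn vu; rewrite in_set1 => /eqP->; apply/negP=> evy.
    have eyv : e y v by rewrite es.
    move: vn; rewrite !in_setU in_setD1 vu (y_in_T eyv) /= orbT //.
  - move=> v vA; rewrite !in_setU in_set1 in_setD1 => vn vu.
    have {vn}[vS vT vy] : [/\ v \notin S, v \notin cm S & v != y].
      by move: vn; rewrite vu /= !negb_or => /andP[/andP[-> ->] ->].
    split; last exact: (nb_core_lt G).
    rewrite leqNgt; apply/negP=> lt.
    have [cS' _] := core_ext G pS T0S vA vy vS lt.
    by have := maxS cS'; rewrite cardsU1 vS; nlia.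
  - exists y => v z _; rewrite in_set1 => /eqP-> _; split=> // s sS; exact: com.
exact: end_at_y (frame_fam G F) euy.
Qed.

Hypothesis maxT : forall S', core S' -> #|S'| = #|S| -> #|cm S'| <= #|cm S|.

(** When the sides have equal size, removing [u] from [T] requires removing some [a] from [S] as
    well; [a] then lies in the region of the target [u]. *)
Lemma small_T : #|cm S| <= #|S| -> #|S| < k -> fam e A x y k.
Proof.
move=> tS kS; have eqT : #|cm S| = #|S| by apply/eqP; rewrite eqn_leq tS cS.2.
have [a aS ax] : exists2 a, a \in S & a != x.
  have [/existsP[a /andP[aS ax]]|no] := boolP [exists a, (a \in S) && (a != x)].
    by exists a.
  (* Without such an [a], [u] is the only neighbour of [x] and of [y], so it separates both from a
     third neighbour [w] of its own. *)
  have Sx : S = [set x].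
    apply/setP=> z; rewrite in_set1; apply/idP/eqP => [zS|->//].
    by apply/eqP; apply: contraNT no => zx; apply/existsP; exists z; rewrite zS.
  have onlyT z : z \in cm S -> z = u.
    move=> zT; apply/eqP/negPn/negP=> zu; move: eqT.
    have cardS : #|S| = 1 by rewrite Sx cards1.
    by rewrite cardS (cardsD1 u) uT (cardsD1 z) in_setD1 zu zT.
  have [w [euw wx wy]] : exists w, [/\ e u w, w != x & w != y].
    have [/existsP[w /and3P[? ? ?]]|no'] := boolP [exists w, [&& e u w, w != x & w != y]].
      by exists w.
    have := u_degree; rewrite (@deg_nb _ _ [set x; y]).
      have := nb_le_card e [set x; y] u; rewrite cards2; have := st_k G.
      by case: (x != y); nlia.
    move=> w euw; apply: contraNT no'; rewrite !inE => /norP[wx wy].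
    by apply/existsP; exists w; rewrite euw wx.
  have wAu : w \in A :\ u.
    rewrite in_setD1 (eAr G euw) andbT; apply: contraTneq euw => ->.
    by apply/negP=> /colN; case: (col u).
  have stuck z : (forall t, e z t -> t = u) -> w != z -> ~~ conn e (A :\ u) w z.
    move=> only wz; apply/negP=> wc; have wn : w \notin [set z] by rewrite in_set1.
    have [s [r [cs rA _ esr]]] := conn_first_exit (conn_sym es wc) (set11 z) wn.
    have := conn_inr cs; rewrite in_setI in_set1 => /andP[_ /eqP sz].
    by move: rA; rewrite in_setD1 (only r) ?eqxx // -sz.
  have : conn e (A :\ u) w x || conn e (A :\ u) w y by apply: st_R G _ _ wAu.
  rewrite (negPf (stuck x _ wx)) ?(negPf (stuck y _ wy)) //.
    by move=> t /y_in_T /onlyT.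
  move=> t ext; apply: onlyT; rewrite inE in_setD1 (eAr G ext) andbT.
  have -> : t != y by apply: contraTneq ext => ->.
  by apply/forall_inP=> s; rewrite Sx in_set1 => /eqP->.
set S1 := S :\ a; set T0 := cm S1 :\ u.
have pS1 : precore col A x y S1 := minus_pre ax.
have cardS1 : #|S| = #|S1|.+1 := minus_card aS.
have T0S z : z \in T0 -> z \in cm S1 by rewrite in_setD1 => /andP[].
have uS1 : u \in cm S1 by apply: minus_cm.
have S1S z : z \in S1 -> z \in S by apply: minus_sub.
have T0b t : t \in T0 -> col t = ~~ col x by move/T0S/(cm_col G pS1).
have aT0 : a \notin S1 :|: T0 :|: [set y].
  rewrite !in_setU in_set1 [a \in S1]in_setD1 eqxx /= (negPf (nyS aS)) orbF.
  by apply/negP=> /T0b; rewrite (Sw aS); case: (col x).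
have eua : e u a by rewrite es com.
have xS1 : x \in S1 by case: pS1.
have F : frame col e A x y S1 T0 (comp e (A :\: (S1 :|: T0 :|: [set y])) u) u [set y].
  apply: (@component_frame _ _ _ _ _ _ _ G _ _ _ _ a) => //.
  - by move=> z /S1S /SA.
  - by move=> z /T0S /cm_sub.
  - by move=> z /S1S /Sw.
  - by move=> s t sS /T0S; apply: cm_adj.
  - have : #|cm S| <= #|cm S1| by apply/subset_leq_card/subsetP/minus_cm.
    by rewrite (cardsD1 u (cm S1)) uS1 -/T0; nlia.
  - exact: TAA.
  - rewrite !in_setU in_set1 [u \in T0]in_setD1 eqxx (negPf (nyT uT)) orbF /= orbF.
    by apply/negP=> /S1S /ST; rewrite uT.
  - move=> z; rewrite in_set1 => /eqP->; rewrite in_setU negb_or.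
    apply/andP; split; first by apply: contra yS => /S1S.
    by apply/negP=> /T0S /cm_sub; rewrite in_setD1 eqxx.
  - by rewrite in_set1 eqxx orbT.
  - move=> v z vA vn vu; rewrite in_set1 => /eqP->; apply/negP=> evy.
    have eyv : e y v by rewrite es.
    by move: vn; rewrite !in_setU [v \in T0]in_setD1 vu minus_cm ?(y_in_T eyv) //= orbT.
  - move=> v vA; rewrite !in_setU in_set1 !negb_or => /andP[/andP[vS1 vT0] vy] vu.
    have vcm : v \notin cm S1 by move: vT0; rewrite in_setD1 vu.
    split; last exact: minus_nbS.
    (* Too many neighbours of [v] in [T0] would make [v |: S1] a core of the size of [S]. By [good]
       it has [u] as a further common neighbour, outside [T0], and this contradicts [maxT]. *)
    rewrite leqNgt; apply/negP=> lt.
    have [cS' sub] := core_ext G pS1 T0S vA vy vS1 lt.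
    have cardS' : #|v |: S1| = #|S| by rewrite cardsU1 vS1 cardS1.
    have := good cS' cardS' eyu.
    have uv : (u == v) = false by rewrite eq_sym (negPf vu).
    rewrite in_setU in_setU1 uv /=.
    have -> : u \in S1 = false by apply/negP=> /S1S /ST; rewrite uT.
    rewrite /= => ucm.
    have : #|u |: [set t in T0 | e v t]| <= #|cm (v |: S1)|.
      by apply/subset_leq_card/subsetP=> z; rewrite in_setU1 => /predU1P[->|/sub].
    rewrite cardsU1 [u \in _]in_set in_setD1 eqxx /=.
    by have := maxT cS' cardS'; move: lt; rewrite /nb; nlia.
  - exists y => v z _; rewrite in_set1 => /eqP-> _; split=> // s sS; exact: cm_adj sS uS1.
exact: end_at_y (frame_fam G F) euy.
Qed.

End BlackNeighbour.

Section WhiteNeighbour.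
Variable a : V.
Hypotheses (eay : e a y) (aS : a \in S).

Let eya : e y a. Proof. by rewrite es. Qed.
Let ax : a != x. Proof. by apply: contraTneq eay => ->. Qed.
Let ycol : col y = ~~ col x. Proof. by rewrite (colN eay) (Sw aS). Qed.

Lemma y_in_S w : e y w -> w \in S.
Proof.
move=> eyw; have := y_near eyw; rewrite in_setU => /orP[//|wT].
by have := colN eyw; rewrite (Tb wT) ycol; case: (col x).
Qed.

Lemma direct_white : k < #|S| -> fam e A x y k.
Proof.
move=> kS; exists 3 => i ik.
have -> : 3 + 2 * i = ((2 * i).+2 + 0).+1 by nlia.
have iS : i.+1 < #|S| by nlia.
have xa : x != a by rewrite eq_sym.
apply: (pth_cat (biclique_pth_same es xS aS xa com ST iS (leq_trans (ltnW iS) cS.2)) eay (pth0 e (set11 y))).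
- move=> z; rewrite in_setU in_set1 => /orP[]; [exact: nyS|exact: nyT].
- by move=> z; rewrite in_setU => /orP[]; [apply: SAA|apply: TAA].
- by move=> z; rewrite in_set1 => /eqP->; apply: st_y G.
Qed.

Let S1 := S :\ a.
Let pS1 := minus_pre ax.
Let cardS1 := minus_card aS.
Let S1S z : z \in S1 -> z \in S. Proof. exact: minus_sub. Qed.
Let xS1 : x \in S1. Proof. by case: pS1. Qed.
Let aS1 : a \notin S1. Proof. by rewrite in_setD1 eqxx. Qed.
Let T1b t : t \in cm S1 -> col t = ~~ col x. Proof. exact: (cm_col G pS1). Qed.
Let aT1 : a \notin cm S1.
Proof. by apply/negP=> /T1b; rewrite (Sw aS); case: (col x). Qed.
Let yT1 : y \notin cm S1. Proof. by apply/negP=> /cm_sub; rewrite in_setD1 eqxx. Qed.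
Let yS1 : y \notin S1. Proof. by apply: contra yS => /S1S. Qed.
Let cardT1 : #|S1| < #|cm S1|.
Proof.
have : #|cm S| <= #|cm S1| by apply/subset_leq_card/subsetP/minus_cm.
by have := cS.2; rewrite cardS1; apply: leq_trans.
Qed.

(** The neighbour of [y] lost in the exchange is [a], which has left [S] and has the wrong colour
    for a common neighbour. *)
Lemma white_nb T v : {subset T <= cm S1} -> v \in A -> v != y -> v \notin S1 ->
  v != a -> nb e T v <= #|S1|.
Proof.
move=> TS vA vy vS1 va.
have q1 : a \notin v |: S1 by rewrite in_setU1 (negPf aS1) orbF eq_sym.
apply: (minus_nb aS ax TS vA vy vS1 eya q1).
by apply: contra aT1; apply: cm_anti => z zS1; rewrite in_setU1 zS1 orbT.
Qed.

(** [a] leaves [S] and becomes the target, with the edge to [y] as final segment and [w] in its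
    region. *)
Lemma leave_at_a w : e a w -> w \notin cm S1 -> w != y -> fam e A x y k.
Proof.
move=> eaw wT wy.
have F : frame col e A x y S1 (cm S1) (comp e (A :\: (S1 :|: cm S1 :|: [set y])) a) a [set y].
  apply: (@component_frame _ _ _ _ _ _ _ G _ _ _ _ w) => //.
  - by move=> z /S1S /SA.
  - exact: cm_sub.
  - by move=> z /S1S /Sw.
  - by move=> s t; apply: cm_adj.
  - exact: ltnW.
  - exact: SAA.
  - by rewrite !in_setU in_set1 (negPf aS1) (negPf aT1) (negPf (nyS aS)).
  - by move=> z; rewrite in_set1 => /eqP->; rewrite in_setU negb_or yS1.
  - rewrite !in_setU in_set1 (negPf wT) (negPf wy) !orbF.
    apply/negP=> /S1S /Sw; have := colN eaw; rewrite (Sw aS) => ->.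
    by case: (col x).
  - by rewrite in_set1 eqxx orbT.
  - move=> v z vA vn va; rewrite in_set1 => /eqP->; apply/negP=> evy.
    have eyv : e y v by rewrite es.
    by move: vn; rewrite !in_setU [v \in S1]in_setD1 va y_in_S.
  - move=> v vA; rewrite !in_setU in_set1 !negb_or => /andP[/andP[vS1 vT0] vy] va.
    split; last exact: minus_nbS.
    by apply: white_nb.
  - exists y => u z uT; rewrite in_set1 => /eqP-> euy.
    have eyu : e y u by rewrite es.
    by have := Sw (y_in_S eyu); rewrite (T1b uT); case: (col x).
exact: end_at_y (frame_fam G F) eay.
Qed.

(** Having no region of its own, [a] is reserved for the final segment [u, a, y], and a vertex [u]
    of [T] becomes the target. All edges from [T] to [ex] end at [a], as [fr_ex] demands. *)
Lemma leave_at_T : #|S| <= k -> (forall w, e a w -> w \in cm S1 :|: [set y]) ->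
  fam e A x y k.
Proof.
move=> Sk aN.
have [u uT] : exists u, u \in cm S.
  by apply/card_gt0P; apply: leq_trans cS.2; apply/card_gt0P; exists x.
have uT1 : u \in cm S1 by apply: minus_cm.
set T0 := cm S1 :\ u; set ex := [set a; y].
have T0S z : z \in T0 -> z \in cm S1 by rewrite in_setD1 => /andP[].
have uS : u \notin S by apply/negP=> /ST; rewrite uT.
have eua : e u a by rewrite es com.
have nuy : ~~ e u y.
  apply/negP=> euy; have eyu : e y u by rewrite es.
  by have := y_in_S eyu; rewrite (negPf uS).
have ux : u != x by apply: contraTneq uT => ->; apply: ST.
have [w euw wS] : exists2 w, e u w & w \notin S.
  have [/existsP[w /andP[euw wn]]|no] := boolP [exists w, e u w && (w \notin S)].
    by exists w.
  have := st_deg G (TAA uT) ux (nyT uT).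
  rewrite (@deg_nb _ _ S); first by have := nb_le_card e S u; nlia.
  by move=> w euw; apply: contraNT no => wn; apply/existsP; exists w; rewrite euw.
have F : frame col e A x y S1 T0 (comp e (A :\: (S1 :|: T0 :|: ex)) u) u ex.
  apply: (@component_frame _ _ _ _ _ _ _ G _ _ _ _ w) => //.
  - by move=> z /S1S /SA.
  - by move=> z /T0S /cm_sub.
  - by move=> z /S1S /Sw.
  - by move=> s t sS /T0S; apply: cm_adj.
  - by move: cardT1; rewrite (cardsD1 u (cm S1)) uT1.
  - exact: TAA.
  - rewrite !in_setU !in_set1 [u \in T0]in_setD1 eqxx (negPf (nyT uT)) /= !orbF.
    apply/norP; split; first by apply: contra uS => /S1S.
    by apply: contraTneq uT => ->; apply: ST.
  - move=> z /set2P[]->; rewrite in_setU negb_or.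
      by rewrite aS1; apply/negP=> /T0S; apply/negP.
    by rewrite yS1; apply/negP=> /T0S; apply/negP.
  - rewrite !in_setU !in_set1.
    have -> : w \in S1 = false by apply/negP=> /S1S; apply/negP.
    have -> : w \in T0 = false.
      apply/negP=> /T0S /T1b; have := colN euw; rewrite (Tb uT) => ->.
      by case: (col x).
    have /negPf-> : w != a by apply: contraNneq wS => ->.
    by apply: contraTneq euw => ->.
  - by rewrite set22 orbT.
  - move=> v z vA vn vu /set2P[]->; apply/negP=> evz.
      have eav : e a v by rewrite es.
      have := aN v eav; move: vn.
      rewrite !in_setU !in_set1 [v \in T0]in_setD1 vu /= !negb_or.
      by case/and3P=> /andP[_ /negPf->] _ /negPf->.
    have eyv : e y v by rewrite es.
    have := y_in_S eyv; move: vn; rewrite !in_setU !in_set1 !negb_or in_setD1.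
    by case/and3P=> /andP[h _] va _; move: h; rewrite va /= => /negPf->.
  - move=> v vA; rewrite !in_setU !in_set1 !negb_or => /and3P[/andP[vS1 vT0] va vy] vu.
    have vcm : v \notin cm S1 by move: vT0; rewrite in_setD1 vu.
    split; last exact: minus_nbS.
    by apply: white_nb.
  - exists a => v z vT /set2P[]-> evz.
      by split=> // s sS; apply: cm_adj sS uT1.
    have eyv : e y v by rewrite es.
    by have := Sw (y_in_S eyv); rewrite (T1b (T0S _ vT)); case: (col x).
apply: (fam_append (frame_fam G F) _ eua (L := 1)).
  by move=> z /set2P[]->; [apply: SAA|apply: st_y G].
have := pth_cons eay (pth0 e (set11 y)); apply.
by rewrite in_set1 nyS.
Qed.

End WhiteNeighbour.

End Closed.

Lemma induction_step (V : finType) (col : V -> bool) (e : rel V) (A : {set V}) x y k :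
  setting col e A x y k -> (exists w, [/\ w \in A, w != x & w != y]) ->
  fam e A x y k.
Proof.
move=> G inner; have es := st_sym G.
pose coreb (S : {set V}) := [&& x \in S, S \subset A :\ y, [forall s in S, col s == col x]
  & #|S| <= #|cm e A y S|].
have coreP S : reflect (core col e A x y S) (coreb S).
  apply: (iffP and4P) => [[xS /subsetP SA /forall_inP Sw card]|[[xS SA Sw] card]].
    by split=> //; split=> // s /Sw /eqP.
  by split=> //; [apply/subsetP|apply/forall_inP=> s /Sw/eqP].
have c0 : coreb [set x].
  have [w wA exw] := x_neighbour G inner.
  apply/coreP; split; first split.
  - exact: set11.
  - by move=> z; rewrite in_set1 => /eqP->; rewrite in_setD1 (st_xy G) (st_x G).
  - by move=> s; rewrite in_set1 => /eqP->.
  rewrite cards1; apply/card_gt0P; exists w; rewrite in_set wA /=.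
  by apply/forall_inP=> s; rewrite in_set1 => /eqP->.
have [S1 cS1 maxS1] := arg_maxnP (fun S : {set V} => #|S|) c0.
have [|S /andP[/coreP cS /eqP eS] maxT1] :=
    @arg_maxnP _ S1 (fun S => coreb S && (#|S| == #|S1|)) (fun S => #|cm e A y S|).
  by rewrite cS1 eqxx.
have maxS S' : core col e A x y S' -> #|S'| <= #|S|.
  by move/coreP=> cS'; rewrite eS; apply: maxS1.
have maxT S' : core col e A x y S' -> #|S'| = #|S| -> #|cm e A y S'| <= #|cm e A y S|.
  by move/coreP=> cS' E; apply: maxT1; rewrite cS' E eS eqxx.
(* [open_core] applies to any core of maximum [#|S|], whatever its number of common neighbours. If
   it applies to none of them, [good] holds. *)
have [/existsP[S' /existsP[w /and4P[/coreP cS' /eqP E eyw wn]]]|no] :=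
    boolP [exists S' : {set V}, exists w,
      [&& coreb S', #|S'| == #|S|, e y w & w \notin S' :|: cm e A y S']].
  by apply: (open_core G cS' _ eyw wn) => S''; rewrite E; apply: maxS.
have good S' : core col e A x y S' -> #|S'| = #|S| ->
    forall w, e y w -> w \in S' :|: cm e A y S'.
  move=> /coreP cS' E w eyw; apply: contraNT no => wn.
  by apply/existsP; exists S'; apply/existsP; exists w; rewrite cS' E eqxx eyw.
have [w eyw] := y_neighbour G inner; have ewy : e w y by rewrite es.
have := good S cS erefl w eyw; rewrite in_setU => /orP[wS|wT].
  have [kS|kS] := ltnP k #|S|; first exact: (direct_white G cS ewy wS kS).
  have [/existsP[z /and3P[ewz zT zy]]|no'] :=
      boolP [exists z, [&& e w z, z \notin cm e A y (S :\ w) & z != y]].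
    exact: (leave_at_a G cS good ewy wS ewz zT zy).
  apply: (leave_at_T G cS good ewy wS kS) => z ewz.
  apply: contraNT no'; rewrite in_setU in_set1 => /norP[zT zy].
  by apply/existsP; exists z; rewrite ewz zT.
have [kS|kS] := leqP k #|S|; first exact: (direct_black G cS ewy wT kS).
have [tS|tS] := leqP #|cm e A y S| #|S|.
  exact: (small_T G cS good ewy wT maxT tS kS).
exact: (big_T G cS good maxS ewy wT tS kS).
Qed.

(** * Deleting the root edge, and the induction *)

Definition del_edge (V : eqType) (e : rel V) x y : rel V := fun u v =>
  e u v && ~~ ((u == x) && (v == y) || (u == y) && (v == x)).

(** A walk towards [x] or [y], stopped at the first of the two that it meets, does not use the edge
    between them. *)
Lemma rooted_del_edge (V : finType) (e : rel V) (A : {set V}) x y :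
  rooted e A x y -> rooted (del_edge e x y) A x y.
Proof.
move=> r v w wAv; have wA := wAv.
have [wx|wx] := eqVneq w x; first by rewrite -wx conn_refl.
have [wy|wy] := eqVneq w y; first by rewrite orbC -wy conn_refl.
set D := [set u | (u != x) && (u != y)].
have wD : w \in D by rewrite inE wx.
have out z : z = x \/ z = y -> conn e (A :\ v) w z ->
    conn (del_edge e x y) (A :\ v) w x || conn (del_edge e x y) (A :\ v) w y.
  move=> zxy wz; have zD : z \notin D.
    by rewrite inE negb_and !negbK; case: zxy => ->; rewrite eqxx ?orbT.
  have [s [r0 [cs rA rD esr]]] := conn_first_exit wz wD zD.
  have := conn_inr cs; rewrite in_setI => /andP[sA].
  rewrite inE => /andP[sx sy].
  have wr : conn (del_edge e x y) (A :\ v) w r0.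
    apply: (@conn_trans _ _ _ _ s).
      apply: (@conn_sub _ _ ((A :\ v) :&: D)); first by move=> t /setIP[].
      apply: conn_subrel cs => t t' /setIP[_]; rewrite inE => /andP[tx ty] /setIP[_].
      by rewrite /del_edge (negPf tx) (negPf ty) => _ ->.
    by apply: conn1; rewrite // /del_edge (negPf sx) (negPf sy) esr.
  move: rD; rewrite inE negb_and !negbK => /orP[]/eqP re; rewrite re in wr; by rewrite wr ?orbT.
by case/orP: (r v w wAv); apply: out; [left|right].
Qed.

Theorem rooted_paths (V : finType) n : paths_at V n.
Proof.
elim: n => // n IH col e A x y k ltA es hcol eA xA yA xy inner r deg.
have [k1|k1] := leqP k 1.
  have [w [wA wx wy]] := inner.
  have wAy : w \in A :\ y by rewrite in_setD1 wy.
  have wAx : w \in A :\ x by rewrite in_setD1 wx.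
  have c1 : conn e A w x.
    case/orP: (r y w wAy) => [|/conn_inr]; last by rewrite in_setD1 eqxx.
    by apply: conn_sub => z; rewrite in_setD1 => /andP[].
  have c2 : conn e A w y.
    case/orP: (r x w wAx) => [/conn_inr|]; first by rewrite in_setD1 eqxx.
    by apply: conn_sub => z; rewrite in_setD1 => /andP[].
  have [l h] := conn_pth (conn_trans (conn_sym es c1) c2).
  by exists l => i ik; have -> : l + 2 * i = l by nlia.
(* Deleting the edge [xy] changes only the degrees of the roots, which are unrestricted. *)
set e' := del_edge e x y.
have sub u v : e' u v -> e u v by case/andP.
have [l h] : fam e' A x y k.
  apply: (@induction_step _ col) => //.
  have es' : symmetric e'.
    move=> u v; rewrite /e' /del_edge es; congr (_ && ~~ _).
    by rewrite [(u == x) && _]andbC [(u == y) && _]andbC orbC.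
  split=> //.
  - by move=> u v /sub /hcol.
  - by move=> u v /sub /eA.
  - by rewrite /e' /del_edge !eqxx /= andbF.
  - exact: rooted_del_edge.
  - move=> v vA vx vy; rewrite (_ : [set w | e' v w] = [set w | e v w]); first exact: deg.
    by apply/setP=> w; rewrite !inE /e' /del_edge (negPf vx) (negPf vy) andbT.
  - apply: links_of_paths; first exact: max_card.
    move=> col2 e2 A2 x2 y2 k2 lt; apply: IH; exact: leq_trans lt _.
by exists l => i /h; apply: pth_subrel.
Qed.

(** * Cycles in dense graphs *)

Lemma pth_cycle (V : finType) (e : rel V) B u v L :
  symmetric e -> e u v -> 1 < L -> pth e B u v L -> has_cycle_of_length e L.+1.
Proof.
move=> es euv L1 [p [pp lp up _ sp]]; exists (u :: p); split=> //=.
- by rewrite sp.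
- by rewrite rcons_path pp lp es.
Qed.

Lemma bipartite_cycles (V : finType) (col : V -> bool) (e : rel V) (U : {set V}) k :
  0 < k -> symmetric e -> properly col e -> (forall u v, e u v -> u \in U) ->
  U != set0 -> (forall u, u \in U -> k < #|[set w | e u w]|) ->
  exists m, 2 <= m /\ forall i, i < k -> has_cycle_of_length e (2 * m + 2 * i).
Proof.
move=> k0 es hcol eU /set0Pn[c cU] deg.
have eUr u v : e u v -> v \in U by rewrite es; apply: eU.
set C := comp e U c.
have cin : c \in C by apply: comp_self.
have cC : connected e C by apply: comp_connected.
have Ccl v w : v \in C -> e v w -> w \in C.
  by move=> vC evw; apply: comp_closed vC evw (eUr _ _ evw).
have CU z : z \in C -> z \in U by apply: comp_subset.
clearbody C.
have nee u v : e u v -> u != v.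
  by apply: contraTneq => ->; apply/negP=> /hcol; rewrite eqxx.
have [w ecw] : exists w, e c w.
  have : 0 < #|[set w | e c w]| by apply: leq_ltn_trans (deg c cU).
  by case/card_gt0P=> w; rewrite inE; exists w.
(* The vertex [c] is arbitrary and serves only to select an end block of its component. *)
have p0 : piece e C c c (comp e (C :\ c) w).
  apply: piece_comp => //; first by rewrite in_setD1 (Ccl _ _ cin ecw) eq_sym nee.
  by apply/negP=> /comp_subset; rewrite in_setD1 eqxx.
have [b [D [mD _]]] := exists_min_piece p0.
have [pD _] := mD; have [bC _ _] := pieceP pD; have bD := piece_cut pD.
have DC := piece_subset pD.
have [t tD ebt] := piece_attached es cC cin pD.
have etb : e t b by rewrite es.
set A := b |: D; pose e1 u v := [&& u \in A, v \in A & e u v].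
have bA : b \in A by apply: setU11.
have DA z : z \in D -> z \in A by move=> zD; rewrite in_setU1 zD orbT.
have e1s : symmetric e1 by move=> u v; rewrite /e1 es andbCA.
have Dout v z : v \in D -> e v z -> z \in A.
  move=> vD evz; have zC := Ccl _ _ (DC _ vD) evz.
  by rewrite in_setU1; case: (piece_closed pD vD zC evz) => ->; rewrite ?eqxx ?orbT.
have bt : b != t by apply: nee.
have e1_e u v : e1 u v -> e u v by case/and3P.
have ce1 (B : {set V}) v z : {subset B <= A} -> conn e B v z -> conn e1 B v z.
  by move=> BA; apply: conn_subrel => u u' uB u'B euu'; rewrite /e1 !BA.
have r1 : rooted e1 A b t.
  move=> v z; rewrite in_setD1 in_setU1 => /andP[zv /predU1P[zb|zD]].
    by apply/orP; left; rewrite zb conn_refl // in_setD1 bA -zb zv.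
  have [vD|vD] := boolP (v \in D).
    have zDv : z \in D :\ v by rewrite in_setD1 zv.
    have [s sb zs] := min_piece_conn es mD vD zDv.
    rewrite mem_nbs1 in sb; apply/orP; left.
    have bv : b != v by apply: contraNneq bD => ->.
    have sD := conn_inr zs; have /andP[sv sD'] : (s != v) && (s \in D) by rewrite -in_setD1.
    apply: (@conn_trans _ _ _ _ s).
      apply: (@conn_sub _ _ (D :\ v)).
        by move=> u; rewrite !in_setD1 => /andP[-> /DA].
      by apply: ce1 => // u; rewrite in_setD1 => /andP[_ /DA].
    apply: conn1; first by rewrite in_setD1 sv DA.
      by rewrite in_setD1 bv.
    by rewrite /e1 DA // bA es.
  apply/orP; right; apply: (@conn_sub _ _ D).
    by move=> u uD; rewrite in_setD1 DA // andbT; apply: contraNneq vD => <-.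
  by apply: ce1 => //; apply: (piece_connected es pD).
have [l hl] : fam (del_edge e1 b t) A b t k.
  apply: (@rooted_paths V #|A|.+1 col) => //.
  - by move=> u v; rewrite /del_edge e1s [(u == b) && _]andbC [(u == t) && _]andbC orbC.
  - by move=> u v /andP[/e1_e/hcol].
  - by move=> u v /andP[/and3P[]].
  - exact: DA.
  - have : 1 < #|[set z | e t z]| by apply: leq_ltn_trans (deg t (CU _ (DC _ tD))).
    case/card_gt1P=> z1 [z2 []]; rewrite !inE => e1' e2' z12.
    have get z : e t z -> z != b -> exists w0, [/\ w0 \in A, w0 != b & w0 != t].
      by move=> etz zb; exists z; split; [apply: Dout etz|by []|rewrite eq_sym nee].
    have [z1b|z1b] := eqVneq z1 b; last exact: get e1' z1b.
    by apply: get e2' _; rewrite eq_sym -z1b.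
  - exact: rooted_del_edge.
  - move=> _ v; rewrite in_setU1 => /predU1P[->|vD]; first by rewrite eqxx.
    move=> vb vt; rewrite (_ : [set z | _] = [set z | e v z]); first by apply/deg/CU/DC.
    apply/setP=> z; rewrite !inE /del_edge /e1 (negPf vb) (negPf vt) andbT DA //=.
    by apply/andP/idP => [[]//|evz]; rewrite evz (Dout v).
have sub3 : subrel (del_edge e1 b t) e by move=> u v /andP[/e1_e].
(* The ends are adjacent in [e], so the lengths are odd, and length 1 would be the deleted edge.
   Closing up with [bt] gives length [l + 1], which determines [m]. *)
have l_odd : odd l.
  have := pth_parity hcol (pth_subrel sub3 (hl 0 k0)); rewrite muln0 addn0 => ->.
  exact: hcol.
have l1 : l != 1.
  apply/eqP=> l1; have := hl 0 k0; rewrite l1 muln0 => -[p [pp lp _ _ sp]].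
  case: p sp pp lp => [|z [|? ?]] //= _ /andP[ebz _] zt.
  by move: ebz; rewrite zt /del_edge !eqxx andbF.
have lE : 2 * (l.+1)./2 = l.+1 by rewrite mul2n -[RHS]odd_double_half /= l_odd.
have l3 : 2 < l by case: (l) l_odd l1 => [|[|[]]].
exists (l.+1)./2; split; first by rewrite -(leq_pmul2l (isT : 0 < 2)) lE.
move=> i ik; have -> : 2 * (l.+1)./2 + 2 * i = (l + 2 * i).+1 by rewrite lE.
by apply: (pth_cycle es ebt) (pth_subrel sub3 (hl i ik)); rewrite (leq_trans _ (leq_addr _ _)) // ltnW.
Qed.

(** * Maximum cuts, edge counts and nearly complete graphs *)

Lemma nb_sum (V : finType) (e : rel V) (X : {set V}) v :
  nb e X v = \sum_(w in X) (e v w : nat).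
Proof.
rewrite /nb -sum1dep_card big_mkcondr.
by apply: eq_bigr => w _; case: (e v w).
Qed.

(** When the number [F X] of crossing edges is maximum, moving a vertex across gains nothing, so at
    least half of its edges cross. [F] is invariant under complementation in [U], so it is enough to
    move a vertex out of the set. *)
Lemma max_cut (V : finType) (e : rel V) (U : {set V}) :
  symmetric e -> irreflexive e ->
  exists X : {set V}, forall v, v \in U ->
    nb e U v <= 2 * nb e [set w in U | (v \in X) != (w \in X)] v.
Proof.
move=> es ei.
pose F (X : {set V}) := \sum_(u in X) \sum_(w in U :\: X) (e u w : nat).
have [X XU maxX] := @arg_maxnP _ (set0 : {set V}) (fun X : {set V} => X \subset U) F (sub0set U).
have half (Y : {set V}) v : Y \subset U -> (forall Z : {set V}, Z \subset U -> F Z <= F Y) -> v \in Y ->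
    nb e Y v <= nb e (U :\: Y) v.
  move=> YU maxY vY.
  have := maxY (Y :\ v) (subset_trans (subsetDl _ _) YU).
  have vU := subsetP YU _ vY.
  have UE : U :\: (Y :\ v) = v |: (U :\: Y).
    apply/setP=> z; rewrite !inE negb_and negbK.
    by have [->|_] := eqVneq z v; rewrite ?vU ?vY.
  have -> : F (Y :\ v) = \sum_(u in Y :\ v) (e u v : nat) + \sum_(u in Y :\ v) \sum_(w in U :\: Y) (e u w : nat).
    rewrite /F -big_split /=; apply: eq_bigr => u _.
    by rewrite UE big_setU1 //= !inE vY.
  have -> : F Y = nb e (U :\: Y) v + \sum_(u in Y :\ v) \sum_(w in U :\: Y) (e u w : nat).
    by rewrite /F (big_setD1 v) //= nb_sum.
  rewrite leq_add2r; apply: leq_trans.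
  rewrite nb_sum (big_setD1 v) //= ei add0n.
  by rewrite leq_eqVlt (eq_bigr (fun u => e u v : nat)) ?eqxx // => u _; rewrite es.
have FC (Y : {set V}) : Y \subset U -> F (U :\: Y) = F Y.
  move=> YU; rewrite /F setDDr setDv set0U (setIidPr YU) exchange_big /=.
  by apply: eq_bigr => u _; apply: eq_bigr => w _; rewrite es.
exists X => v vU.
have split_nb : nb e U v <= nb e X v + nb e (U :\: X) v.
  apply: leq_trans (nbU _ _ _ _); apply: nb_sub => z zU.
  by rewrite !inE zU andbT; case: (z \in X).
have [vX|vX] := boolP (v \in X).
  have := half X v XU maxX vX.
  have -> : [set w in U | true != (w \in X)] = U :\: X.
    by apply/setP=> w; rewrite !inE andbC; case: (w \in X).
  nlia.
have := half (U :\: X) v (subsetDl _ _) _ _; rewrite inE vX vU => /(_ _ isT).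
have -> : U :\: (U :\: X) = X by rewrite setDDr setDv set0U (setIidPr XU).
have -> : [set w in U | false != (w \in X)] = X.
  apply/setP=> w; rewrite !inE; case wX: (w \in X); rewrite ?andbF //.
  by rewrite (subsetP XU).
move=> h; have : nb e (U :\: X) v <= nb e X v by apply: h => Z ZU; rewrite FC //; apply: maxX.
nlia.
Qed.

Definition edges_in (V : finType) (e : rel V) (U : {set V}) :=
  [set E in edges e | E \subset U].

Lemma edges_in_del (V : finType) (e : rel V) (U : {set V}) v :
  symmetric e -> #|edges_in e U| <= #|edges_in e (U :\ v)| + nb e U v.
Proof.
move=> es.
have : edges_in e U \subset
    edges_in e (U :\ v) :|: [set [set v; w] | w in [set w in U | e v w]].
  apply/subsetP=> E; rewrite !inE => /andP[EE EU].
  have [vE|vE] := boolP (v \in E); last first.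
    apply/orP; left; rewrite EE; apply/subsetP=> z zE.
    rewrite !inE (subsetP EU) // andbT; apply: contraNneq vE => <- //.
  apply/orP; right; apply/imsetP.
  case/existsP: EE => a /existsP[b /andP[eab /eqP Eab]]; subst E.
  have aU : a \in U by apply: (subsetP EU); rewrite !inE eqxx.
  have bU : b \in U by apply: (subsetP EU); rewrite !inE eqxx orbT.
  move: vE; rewrite !inE => /orP[]/eqP->.
    by exists b; rewrite ?inE ?bU.
  by exists a; rewrite ?inE ?aU 1?es // setUC.
move/subset_leq_card/leq_trans; apply; apply: leq_trans (leq_card_setU _ _) _.
by rewrite leq_add2l leq_imset_card.
Qed.

Lemma dense_or_complete (V : finType) (e : rel V) k (U : {set V}) :
  symmetric e -> 2 * k + 2 <= #|U| -> k * (2 * #|U| - 2 * k - 1) <= #|edges_in e U| ->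
  (exists2 W : {set V}, W != set0 & forall v, v \in W -> 2 * k < nb e W v) \/
  (exists2 W : {set V}, #|W| = 2 * k + 2 & k * (2 * k + 3) <= #|edges_in e W|).
Proof.
move=> es; have [n] := ubnP #|U|; elim: n U => // n IH U ltU leU hU.
have [eU|neU] := eqVneq #|U| (2 * k + 2).
  right; exists U => //; apply: leq_trans hU; rewrite eU.
  by have -> : 2 * (2 * k + 2) - 2 * k - 1 = 2 * k + 3 by nlia.
have [/exists_inP[v vU dv]|no] := boolP [exists v in U, nb e U v <= 2 * k]; last first.
  left; exists U; first by rewrite -card_gt0; nlia.
  by move=> v vU; rewrite ltnNge; apply: contra no => h; apply/exists_inP; exists v.
have cU := cardsD1 v U; rewrite vU in cU.
have ltkU : 2 * k + 2 < #|U| by rewrite ltn_neqAle eq_sym neU.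
apply: (IH (U :\ v)); [by nlia|by nlia|].
have := edges_in_del U v es.
have -> : 2 * #|U :\ v| - 2 * k - 1 = 2 * #|U| - 2 * k - 1 - 2 by nlia.
by rewrite mulnBr; nlia.
Qed.

Lemma near_complete (V : finType) (e : rel V) k (W : {set V}) :
  symmetric e -> irreflexive e -> #|W| = 2 * k + 2 ->
  k * (2 * k + 3) <= #|edges_in e W| ->
  exists u v, [/\ u \in W, v \in W, u != v &
    forall a b, a \in W -> b \in W -> a != b -> [set a; b] != [set u; v] -> e a b].
Proof.
move=> es ei cW hW.
pose pairs := [set E : {set V} | E \subset W & #|E| == 2].
(* The number of pairs is [(k + 1) * (2 * k + 1)], one more than the lower bound on the edges. *)
have cP : #|pairs| = k * (2 * k + 3) + 1.
  rewrite cards_draws cW bin2; have -> : (2 * k + 2).-1 = 2 * k + 1 by nlia.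
  have -> : (2 * k + 2) * (2 * k + 1) = (k * (2 * k + 3) + 1).*2 by nlia.
  by rewrite doubleK.
have sub : edges_in e W \subset pairs.
  apply/subsetP=> E; rewrite !inE => /andP[/existsP[a /existsP[b /andP[eab /eqP->]]] ->] /=.
  by rewrite cards2 (_ : a != b) //; apply: contraTneq eab => ->; rewrite ei.
have nonedge a b : ~~ e a b -> [set a; b] \notin edges_in e W.
  apply: contra; rewrite !inE => /andP[/existsP[c /existsP[d /andP[ecd /eqP E]]] _].
  have cd : c != d by apply: contraTneq ecd => ->; rewrite ei.
  have : c \in [set a; b] by rewrite E !inE eqxx.
  have : d \in [set a; b] by rewrite E !inE eqxx orbT.
  rewrite !inE => /orP[]/eqP hd /orP[]/eqP hc; subst c d; rewrite ?eqxx // in cd *.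
  by rewrite es.
have pairP a b : a \in W -> b \in W -> a != b -> [set a; b] \in pairs.
  move=> aW bW ab; rewrite !inE cards2 ab eqxx andbT.
  by apply/subsetP=> z; rewrite !inE => /orP[]/eqP->.
(* The pair is a missing edge if there is one, and arbitrary otherwise. *)
have [u [v [uW vW uv none]]] : exists u v, [/\ u \in W, v \in W, u != v &
    (exists a b, [/\ a \in W, b \in W, a != b & ~~ e a b]) -> ~~ e u v].
  have [/existsP[u /existsP[v /and4P[uW vW uv nuv]]]|no] :=
      boolP [exists u, exists v, [&& u \in W, v \in W, u != v & ~~ e u v]].
    by exists u, v.
  have : 1 < #|W| by nlia.
  case/card_gt1P=> u [v [uW vW uv]]; exists u, v; split=> // -[a [b [aW bW ab nab]]].
  by case/negP: no; apply/existsP; exists a; apply/existsP; exists b; apply/and4P.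
exists u, v; split=> // a b aW bW ab ne; apply: contraT => nab.
have nuv : ~~ e u v by apply: none; exists a, b.
have : edges_in e W \subset pairs :\ [set u; v] :\ [set a; b].
  apply/subsetP=> E EE; rewrite !in_setD1 (subsetP sub) // andbT.
  by apply/andP; split; apply: contraTneq EE => ->; apply: nonedge.
move/subset_leq_card; have := cardsD1 [set u; v] pairs.
have := cardsD1 [set a; b] (pairs :\ [set u; v]).
rewrite in_setD1 ne !pairP //= => c1 c2 /(leq_trans hW) le; move: cP; rewrite c2 c1.
by rewrite addn1 !add1n => -[E]; move: le; rewrite -E ltnn.
Qed.

(** In the cycle [u, p, v, r'] the vertex [p] and the list [r'] separate [u] from [v] on both sides,
    so the pair that may be missing is never consecutive. The list is nonempty because [3 < L]. *)
Lemma near_complete_cycles (V : finType) (e : rel V) (W : {set V}) u v L :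
  symmetric e -> u \in W -> v \in W -> u != v ->
  (forall a b, a \in W -> b \in W -> a != b -> [set a; b] != [set u; v] -> e a b) ->
  3 < L -> L <= #|W| -> has_cycle_of_length e L.
Proof.
move=> es uW vW uv adj L3 LW.
have adj_u a b : a \in W -> b \in W -> a != b -> a != u -> b != u -> e a b.
  move=> aW bW ab au bu; apply: adj => //; apply/eqP=> E.
  have : u \in [set a; b] by rewrite E !inE eqxx.
  by rewrite !inE !(eq_sym u) (negPf au) (negPf bu).
have adj_v a b : a \in W -> b \in W -> a != b -> a != v -> b != v -> e a b.
  move=> aW bW ab au bu; apply: adj => //; apply/eqP=> E.
  have : v \in [set a; b] by rewrite E !inE eqxx orbT.
  by rewrite !inE !(eq_sym v) (negPf au) (negPf bu).
have cW : #|W| = #|W :\ u :\ v|.+2.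
  by rewrite (cardsD1 u) uW (cardsD1 v (W :\ u)) !inE eq_sym uv vW.
have : size (enum (W :\ u :\ v)) = #|W :\ u :\ v| by rewrite -cardE.
case E : (enum _) => [|p r] sz; first by rewrite -sz /= in cW; nlia.
have : uniq (p :: r) by rewrite -E enum_uniq.
have mem z : z \in p :: r -> [&& z != v, z != u & z \in W] by rewrite -E mem_enum !inE.
move=> /= /andP[pr ur]; have /and3P[pv pu pW] := mem p (mem_head _ _).
set r' := take (L - 3) r.
have szr : size r' = L - 3 by rewrite size_takel //; move: sz => /= sz; nlia.
have r'r z : z \in r' -> z \in r by apply: mem_take.
have memr z : z \in r' -> [&& z != v, z != u & z \in W].
  by move/r'r => zr; apply: mem; rewrite inE zr orbT.
have ur' : uniq r' by rewrite take_uniq.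
have lastr : last v r' \in r'.
  by case: (r') szr => [|a s] /=; [nlia|rewrite mem_last].
have pathr : path e v r'.
  have : uniq (v :: r') by rewrite /= ur' andbT; apply/negP=> /memr; rewrite eqxx.
  have : {subset v :: r' <= W :\ u}.
    move=> z; rewrite inE => /predU1P[->|/memr/and3P[_ zu zW]]; rewrite !inE ?zu ?zW //.
    by rewrite eq_sym uv.
  elim: (r') (v) => //= a s IH z sub /andP[zas us].
  have := sub z (mem_head _ _); have := sub a; rewrite !inE eqxx orbT => /(_ isT).
  move=> /andP[au aW] /andP[zu zW].
  rewrite adj_u //=; last by move: zas; rewrite inE negb_or => /andP[].
  by apply: IH => // b bs; apply: sub; rewrite inE bs orbT.
have /and3P[lv lu lW] := memr _ lastr.
exists (u :: p :: v :: r'); split=> //.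
- exact: ltnW.
- by rewrite /= szr; nlia.
- rewrite /= !inE !negb_or ur' andbT (eq_sym u p) pu uv pv /=.
  apply/and3P; split.
  + by apply/negP=> /memr; rewrite eqxx andbF.
  + by apply: contra pr => /r'r.
  + by apply/negP=> /memr; rewrite eqxx.
rewrite /= rcons_path pathr /=; apply/and3P; split.
- by apply: adj_v; rewrite // eq_sym.
- by apply: adj_u; rewrite // eq_sym.
- exact: adj_v.
Qed.

(* e(G) >= 2k(n - k - 1/2)  is written as the equivalent integer
   inequality  e(G) >= k (2n - 2k - 1)  (exact, since n >= 2k+2). *)
Theorem theorem1p7 (k : nat) (T : finType) (e : rel T) :
  1 <= k -> simple_graph e -> 2 * k + 2 <= #|T| ->
  k * (2 * #|T| - 2 * k - 1) <= num_edges e ->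
  exists m : nat, 2 <= m /\
    forall i : nat, i < k -> has_cycle_of_length e (2 * m + 2 * i).
Proof.
move=> k0 [es ei] cT hT.
have eT : edges_in e setT = edges e.
  by apply/setP=> E; rewrite inE subsetT andbT.
have := @dense_or_complete T e k setT es; rewrite cardsT eT => /(_ cT hT).
case=> [[W W0 degW]|[W cW hW]]; last first.
  have [u [v [uW vW uv adj]]] := near_complete es ei cW hW.
  (* The longest cycle wanted has length [4 + 2 * (k - 1)], the order of [W]. *)
  exists 2; split=> // i ik; apply: (near_complete_cycles es uW vW uv adj); nlia.
have [X hX] := max_cut W es ei.
pose e2 u v := [&& u \in W, v \in W, (u \in X) != (v \in X) & e u v].
have [] := @bipartite_cycles T (fun z => z \in X) e2 W k k0 _ _ _ W0.
- by move=> u v; rewrite /e2 es andbCA; congr [&& _, _, _ & _]; rewrite eq_sym.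
- by move=> u v /and4P[].
- by move=> u v /and4P[].
- move=> u uW; have := degW u uW; have := hX u uW.
  have -> : nb e [set w in W | (u \in X) != (w \in X)] u = #|[set w | e2 u w]|.
    by apply: eq_card => w; rewrite !inE /e2 uW /= andbA.
  nlia.
move=> m [m2 hm]; exists m; split=> // i ik; have [s [s3 ss us cs]] := hm i ik.
exists s; split=> //; case: s cs {s3 ss us} => //= a s.
by apply: sub_path => u v /and4P[].
Qed.
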